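(* Let $\mathbb{F}$ be a locally compact non-Archimedean field, let $M\ge 2$, let $T_1,\dots,T_M$ be non-singular contractive linear transformations of $\mathbb{F}^n$ (i.e. $\|T_i\|<1$), and for $\mathbf{b}=(b_1,\dots,b_M)\in\mathbb{F}^{nM}$ (with $b_i\in\mathbb{F}^n$) let $K(\mathbf{b})$ be the self-affine set of the system $S_i(x)=T_ix+b_i$, $1\le i\le M$. Then: (i) $\dim_H K(\mathbf{b})\le \overline{\dim}_B K(\mathbf{b})\le d(T_1,\dots,T_M)$ for all $\mathbf{b}\in\mathbb{F}^{nM}$; (ii) $\dim_H K(\mathbf{b})=\dim_B K(\mathbf{b})=\min\{n,d(T_1,\dots,T_M)\}$ for $\mu^{nM}$-almost every $\mathbf{b}\in\mathbb{F}^{nM}$.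
   Context: $\mathbb{F}$ is a field with a non-Archimedean absolute value $\|\cdot\|$ ($\|x\|=0$ iff $x=0$, $\|xy\|=\|x\|\|y\|$, $\|x+y\|\le\max\{\|x\|,\|y\|\}$), locally compact for the metric $\|x-y\|$. Let $O=\{a:\|a\|\le1\}$, $P=\{a:\|a\|<1\}$, $q=\#(O/P)$ (finite), $P=\pi O$, with normalization $\|\pi\|=1/q$. $\mu$ is the Haar measure on $(\mathbb{F},+)$ with $\mu(O)=1$, and $\mu^k$ the product measure on $\mathbb{F}^k$. On $\mathbb{F}^k$ use the norm $\|x\|=\max_i\|x_i\|$ and its metric; Hausdorff and box dimensions are with respect to this metric. For a linear map $T$ of $\mathbb{F}^n$ (identified with its matrix in the standard basis), $\|T\|=\sup_{x\ne0}\|Tx\|/\|x\|$. Let $I_n=\{T:\|T\|=1=\|\det T\|\}$. Every non-singular $T$ factors as $T=PDQ$ with $P,Q\in I_n$ and $D=\mathrm{diag}(\sigma_1,\dots,\sigma_n)$, $\|\sigma_1\|\ge\dots\ge\|\sigma_n\|>0$, and the numbers $\alpha_i=\|\sigma_i\|$ (the singular values of $T$) are uniquely determined by $T$. The singular value function is $\phi^s(T)=\alpha_1\cdots\alpha_{m-1}\alpha_m^{s-m+1}$ for $0\le s\le n$, where $m=\lceil s\rceil$, and $\phi^s(T)=(\alpha_1\cdots\alpha_n)^{s/n}$ for $s>n$. For a word $w=(i_1,\dots,i_r)\in\{1,\dots,M\}^r$ write $T_w=T_{i_1}\cdots T_{i_r}$, and $J_r=\{1,\dots,M\}^r$. $d(T_1,\dots,T_M)$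 is the unique $s\ge0$ with $\lim_{r\to\infty}\frac1r\log\sum_{w\in J_r}\phi^s(T_w)=0$. $K(\mathbf{b})$ is the unique non-empty compact set with $K(\mathbf{b})=\bigcup_{i=1}^M S_i(K(\mathbf{b}))$. *)

(* Defs.v *)
From HB Require Import structures.
From mathcomp Require Import all_boot all_order all_algebra.
From mathcomp Require Import all_classical all_reals all_analysis.
Set Implicit Arguments. Unset Strict Implicit. Unset Printing Implicit Defensive.
Import Order.TTheory GRing.Theory Num.Theory.
Local Open Scope classical_set_scope.
Local Open Scope ring_scope.

Section Defs.
Variables (R : realType) (F : fieldType) (nrm : F -> R).

Definition na_nonarch_abs : Prop :=
  (forall x, nrm x = 0 <-> x = 0) /\
  (forall x, 0 <= nrm x) /\
  (forall x y, nrm (x * y) = nrm x * nrm y) /\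
  (forall x y, nrm (x + y) <= Num.max (nrm x) (nrm y)).

Definition na_mopen {X : Type} (dist : X -> X -> R) (U : set X) : Prop :=
  forall x, U x -> exists2 r, 0 < r & [set y | dist x y < r] `<=` U.

Definition na_mcompact {X : Type} (dist : X -> X -> R) (A : set X) : Prop :=
  forall Us : set (set X), (forall U, Us U -> na_mopen dist U) ->
    A `<=` \bigcup_(U in Us) U ->
    exists (k : nat) (V : nat -> set X),
      (forall j, (j < k)%N -> Us (V j)) /\
      A `<=` \bigcup_(j in [set j | (j < k)%N]) V j.

Definition na_distF (x y : F) : R := nrm (x - y).

Definition na_locally_compact : Prop :=
  forall x : F, exists K : set F, na_mcompact na_distF K /\
    exists2 r, 0 < r & [set y | na_distF x y < r] `<=` K.

(** P = pi O, q = #(O/P) finite, ||pi|| = 1/q *)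
Definition na_normalized : Prop :=
  exists pi : F,
    (forall a, nrm a < 1 <-> exists c, nrm c <= 1 /\ a = pi * c) /\
    exists (q : nat) (r : 'I_q -> F),
      (forall i, nrm (r i) <= 1) /\
      (forall a, nrm a <= 1 -> exists! i, nrm (a - r i) < 1) /\
      nrm pi = (q%:R)^-1.

Definition na_borelF (A : set F) : Prop :=
  forall S : set (set F),
    S set0 -> (forall B, S B -> S (~` B)) ->
    (forall B : nat -> set F, (forall i, S (B i)) -> S (\bigcup_i B i)) ->
    (forall U, na_mopen na_distF U -> S U) -> S A.

Definition na_is_haar (mu : set F -> \bar R) : Prop :=
  mu set0 = 0%E /\
  (forall A, na_borelF A -> (0 <= mu A)%E) /\
  (forall B : nat -> set F, (forall i, na_borelF (B i)) ->
     (forall i j, i <> j -> B i `&` B j = set0) ->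
     (fun N => (\sum_(i < N) mu (B i))%E) @ \oo --> mu (\bigcup_i B i)) /\
  (forall (a : F) A, na_borelF A -> mu [set a + x | x in A] = mu A) /\
  mu [set x | nrm x <= 1] = 1%E.

(** mu^(nM)-null subsets of F^(nM) (points b : 'M_(n,M), b_i = col i b):
    outer measure generated by measurable rectangles is zero *)
Definition na_prodnull (n M : nat) (mu : set F -> \bar R)
    (E : set 'M[F]_(n, M)) : Prop :=
  forall eps : R, 0 < eps ->
    exists A : nat -> 'I_n -> 'I_M -> set F,
      (forall j k l, na_borelF (A j k l)) /\
      E `<=` \bigcup_j [set b | forall k l, A j k l (b k l)] /\
      forall N : nat,
        (\sum_(j < N) \prod_(k < n) \prod_(l < M) mu (A j k l) <= eps%:E)%E.

Variable n : nat.

Definition na_vnorm (x : 'cV[F]_n) : R := \big[Num.max/0]_(i < n) nrm (x i 0).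

Definition na_opnorm (T : 'M[F]_n) : R :=
  sup [set na_vnorm (T *m x) / na_vnorm x | x in [set x : 'cV[F]_n | x != 0]].

Definition na_In_group (T : 'M[F]_n) : Prop :=
  na_opnorm T = 1 /\ nrm (\det T) = 1.

Definition na_singvals (T : 'M[F]_n) (sv : seq R) : Prop :=
  exists (P Q : 'M[F]_n) (sigma : 'rV[F]_n),
    na_In_group P /\ na_In_group Q /\ T = P *m diag_mx sigma *m Q /\
    (forall i j : 'I_n, (i <= j)%N -> nrm (sigma 0 j) <= nrm (sigma 0 i)) /\
    (forall i, 0 < nrm (sigma 0 i)) /\
    sv = [seq nrm (sigma 0 i) | i <- enum 'I_n].

Definition na_sv_of (T : 'M[F]_n) : seq R := xget [::] (na_singvals T).

Definition na_phi (s : R) (T : 'M[F]_n) : R :=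
  let a := na_sv_of T in
  let m := absz (Num.ceil s) in
  if s <= n%:R then
    (if s == 0 then 1 else
      (\prod_(i < m.-1) nth 0 a i) * powR (nth 0 a m.-1) (s - m%:R + 1))
  else powR (\prod_(i < n) nth 0 a i) (s / n%:R).

Definition na_Tword (M : nat) (T : 'I_M -> 'M[F]_n) (r : nat) (w : r.-tuple 'I_M)
  : 'M[F]_n := foldr (fun i A => T i *m A) 1%:M w.

Definition na_is_dimd (M : nat) (T : 'I_M -> 'M[F]_n) (s : R) : Prop :=
  0 <= s /\
  (fun r : nat => (r%:R)^-1 * ln (\sum_(w : r.-tuple 'I_M) na_phi s (na_Tword T w)))
    @ \oo --> 0.

Definition na_attractor (M : nat) (T : 'I_M -> 'M[F]_n) (b : 'M[F]_(n, M))
    (K : set 'cV[F]_n) : Prop :=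
  K !=set0 /\ na_mcompact (fun x y => na_vnorm (x - y)) K /\
  K = \bigcup_(i in [set: 'I_M]) [set T i *m x + col i b | x in K].

Definition na_diam_le (U : set 'cV[F]_n) (delta : R) : Prop :=
  forall x y, U x -> U y -> na_vnorm (x - y) <= delta.

Definition na_diam (U : set 'cV[F]_n) : R :=
  sup [set r | exists x y, U x /\ U y /\ r = na_vnorm (x - y)].

Definition na_Hcontent (delta s : R) (E : set 'cV[F]_n) : \bar R :=
  ereal_inf [set (\sum_(j <oo) (if `[< U j !=set0 >] then (powR (na_diam (U j)) s)%:E
                                else 0%E))%E
            | U in [set U : nat -> set 'cV[F]_n |
                      E `<=` \bigcup_j U j /\ forall j, na_diam_le (U j) delta]].

Definition na_Hmeasure (s : R) (E : set 'cV[F]_n) : \bar R :=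
  ereal_sup [set na_Hcontent delta s E | delta in [set delta : R | 0 < delta]].

Definition na_dimH (E : set 'cV[F]_n) : \bar R :=
  ereal_inf [set s%:E | s in [set s : R | 0 <= s /\ na_Hmeasure s E = 0%E]].

Definition na_Ncover (delta : R) (E : set 'cV[F]_n) : \bar R :=
  ereal_inf [set (k%:R)%:E | k in [set k : nat | exists U : nat -> set 'cV[F]_n,
     E `<=` \bigcup_(j in [set j | (j < k)%N]) U j /\ forall j, na_diam_le (U j) delta]].

Definition na_boxratio (E : set 'cV[F]_n) (delta : R) : R :=
  ln (fine (na_Ncover delta E)) / (- ln delta).

Definition na_ubox (E : set 'cV[F]_n) : \bar R :=
  ereal_inf [set ereal_sup [set (na_boxratio E delta)%:E
                           | delta in [set delta : R | 0 < delta < d0]]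
            | d0 in [set d0 : R | 0 < d0 < 1]].

Definition na_lbox (E : set 'cV[F]_n) : \bar R :=
  ereal_sup [set ereal_inf [set (na_boxratio E delta)%:E
                           | delta in [set delta : R | 0 < delta < d0]]
            | d0 in [set d0 : R | 0 < d0 < 1]].

End Defs.

(* Main.v *)
(* Ultrametricity makes the argument combinatorial. Let [N_k(T)] be the number of balls of radius
   [q^-k] needed to cover [T O^n]; by the Smith form it is the product of [max(1, alpha_i q^k)],
   and [phi^s(T)] is the minimum over [k] of [N_k(T) q^(-ks)].

   Upper bound: for [d < s <= n] the series of [phi^s(T_w)] converges, and stopping each branch
   of the word tree at a suitable word [w i] covers its cylinder by [phi^s(T_w) q^(ks)] balls of
   radius [q^-k].

   Lower bound: for [s < min(n, d)] max-flow/min-cut on the word tree yields a unit flow [nu] with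
   [nu(w) <= phi^s(T_w)]. If [u] and [v] separate after the common prefix [w], the difference of
   their projections is [T_w] applied to a vector that is uniformly distributed in [b], since
   [T_i] contracts; so they agree modulo [pi^k] for a proportion [1/N_k(T_w)] of the [b] modulo
   [pi^k]. Hence the mean of the energy, the sum of the squared masses of the balls of radius
   [q^-k], is at most [(k+1) q^(-ks)]. Markov and Borel-Cantelli bound the energies for almost
   every [b], and compactness of [K] turns this into a lower bound of the Hausdorff dimension. *)

(* Averages over translations are finite counts. A word [w] is projected to [S_w(0)]; every [T_i]
   gains a factor [pi], so for integral [b] the first [k] letters fix the projection modulo [pi^k].
   The energy at scale [k] is thus a finite sum that depends only on [b] modulo [pi^k].

   The factor [k+1] counts the depths at which two words of length [k] can separate. The prefixes
   [w] of one depth contribute at most the sum of [nu(w)^2 / N_k(T_w)]; the minimum formula for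
   [phi^s] gives [nu(w) <= N_k(T_w) q^(-ks)], and the total flow 1 leaves [q^(-ks)]. Working with
   energies at an exponent below [s] frees a geometric factor that absorbs [k+1] and makes the
   exceptional sets summable.

   Any contraction ratio will do: for [i <> j] the projections of [i u] and [j v] differ by
   [b_i - b_j] plus terms divisible by [pi], and such a perturbation of a surjective map stays
   surjective modulo every [pi^k]. A translation that is not integral is made so by a homothety
   [pi^l], which scales all projections. *)
Require Import Defs.
From HB Require Import structures.
From mathcomp Require Import all_boot all_order all_algebra.
From mathcomp Require Import all_classical all_reals all_analysis.
From mathcomp Require Import perm ring lra zify.
Import Order.TTheory GRing.Theory Num.Theory numFieldNormedType.Exports.
Set Implicit Arguments. Unset Strict Implicit. Unset Printing Implicit Defensive.
Local Open Scope classical_set_scope.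
Local Open Scope ring_scope.

(** * Local fields *)

(** The witnesses hidden in the existential [na_normalized] become fields, so that the uniformizer
    and the residue representatives can enter definitions such as [rep]. *)
Record local_field (R : realType) (F : fieldType) (nrm : F -> R) := LocalField {
  lf_abs : na_nonarch_abs nrm;
  lf_pi : F;
  lf_piP : forall a, nrm a < 1 <-> exists c, nrm c <= 1 /\ a = lf_pi * c;
  lf_q : nat;
  lf_res : 'I_lf_q -> F;
  lf_res1 : forall i, nrm (lf_res i) <= 1;
  lf_resP : forall a, nrm a <= 1 -> exists! i, nrm (a - lf_res i) < 1;
  lf_nrm_pi : nrm lf_pi = (lf_q%:R)^-1 }.

Arguments lf_res {R F nrm} l i.
Arguments lf_piP {R F nrm} l a.
Arguments lf_resP {R F nrm} l [a].

Section LocalFieldTheory.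
Variables (R : realType) (F : fieldType) (nrm : F -> R) (L : local_field nrm).

Notation q := (lf_q L).
Notation pi := (lf_pi L).

Definition th : R := q%:R^-1.

Lemma nrm_eq0P x : nrm x = 0 <-> x = 0.
Proof using L. exact: (lf_abs L).1. Qed.

Lemma nrm0 : nrm 0 = 0. Proof. exact/nrm_eq0P. Qed.

Lemma nrm_ge0 x : 0 <= nrm x.
Proof. exact: (lf_abs L).2.1. Qed.

Lemma nrmM x y : nrm (x * y) = nrm x * nrm y.
Proof. exact: (lf_abs L).2.2.1. Qed.

Lemma nrmD_max x y : nrm (x + y) <= Num.max (nrm x) (nrm y).
Proof. exact: (lf_abs L).2.2.2. Qed.

Lemma nrm_gt0 x : x != 0 -> 0 < nrm x.
Proof.
move=> x0; rewrite lt_def nrm_ge0 andbT; apply: contra x0 => /eqP/nrm_eq0P ->//.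
Qed.

Lemma nrm1 : nrm 1 = 1.
Proof.
have h := nrmM 1 1; rewrite mulr1 in h.
have h1 : nrm 1 != 0 by rewrite gt_eqF // nrm_gt0 // oner_neq0.
by apply: (mulfI h1); rewrite mulr1 -h.
Qed.

Lemma nrmN x : nrm (- x) = nrm x.
Proof.
have hN1 : nrm (-1) = 1.
  have h : nrm (-1) ^+ 2 = 1 by rewrite expr2 -nrmM mulrNN mulr1 nrm1.
  by apply/eqP; rewrite -(@eqrXn2 _ 2%N) ?nrm_ge0 ?expr1n ?h.
by rewrite -mulN1r nrmM hN1 mul1r.
Qed.

Lemma nrmD c x y : nrm x <= c -> nrm y <= c -> nrm (x + y) <= c.
Proof. by move=> hx hy; rewrite (le_trans (nrmD_max x y)) // ge_max hx hy. Qed.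

Lemma nrmB c x y : nrm x <= c -> nrm y <= c -> nrm (x - y) <= c.
Proof. by move=> hx hy; apply: nrmD => //; rewrite nrmN. Qed.

Lemma nrmD_lt c x y : nrm x < c -> nrm y < c -> nrm (x + y) < c.
Proof. by move=> hx hy; rewrite (le_lt_trans (nrmD_max x y)) // gt_max hx hy. Qed.

Lemma nrm_sum c (I : Type) (s : seq I) (P : pred I) (f : I -> F) :
  0 <= c -> (forall i, P i -> nrm (f i) <= c) -> nrm (\sum_(i <- s | P i) f i) <= c.
Proof.
move=> c0 h; elim/big_rec: _ => [|i x Pi hx]; first by rewrite nrm0.
by apply: nrmD => //; exact: h.
Qed.

Lemma nrm_prod (I : Type) (s : seq I) (P : pred I) (f : I -> F) :
  nrm (\prod_(i <- s | P i) f i) = \prod_(i <- s | P i) nrm (f i).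
Proof. by elim/big_rec2: _ => [|i x y _ <-]; rewrite ?nrm1 ?nrmM. Qed.

Lemma nrmX x k : nrm (x ^+ k) = nrm x ^+ k.
Proof. by elim: k => [|k ih]; rewrite ?expr0 ?nrm1 // !exprS nrmM ih. Qed.

Lemma nrmV x : nrm x^-1 = (nrm x)^-1.
Proof.
have [->|x0] := eqVneq x 0; first by rewrite invr0 nrm0 invr0.
have h : nrm x != 0 by rewrite gt_eqF // nrm_gt0.
by apply: (mulfI h); rewrite mulfV // -nrmM mulfV // nrm1.
Qed.

(** With a single residue class, 0 and 1 would be congruent modulo [P], forcing [nrm 1 < 1]. *)
Lemma q_gt1 : (1 < q)%N.
Proof.
have [i0 [/= h0 u0]] : exists! i, nrm (0 - lf_res L i) < 1.
  by apply: lf_resP; rewrite nrm0.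
have [i1 [/= h1 u1]] : exists! i, nrm (1 - lf_res L i) < 1.
  by apply: lf_resP; rewrite nrm1.
rewrite ltnNge; apply/negP => q1.
have e : i0 = i1 by apply: val_inj => /=; have := ltn_ord i0; have := ltn_ord i1; lia.
subst i1; suff : nrm 1 < 1 by rewrite nrm1 ltxx.
have -> : 1 = (1 - lf_res L i0) - (0 - lf_res L i0) :> F by ring.
by apply: nrmD_lt => //; rewrite nrmN.
Qed.

Lemma q_gt0 : (0 < q)%N. Proof. exact: ltnW q_gt1. Qed.

Lemma th_gt0 : 0 < th. Proof. by rewrite invr_gt0 ltr0n q_gt0. Qed.
Lemma th_lt1 : th < 1.
Proof. by rewrite invf_lt1 ?ltr1n ?q_gt1 // ltr0n q_gt0. Qed.
Lemma th_ge0 : 0 <= th. Proof. exact: ltW th_gt0. Qed.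
Lemma th_le1 : th <= 1. Proof. exact: ltW th_lt1. Qed.
Lemma thX_gt0 k : 0 < th ^+ k. Proof. exact: exprn_gt0 th_gt0. Qed.
Lemma thX_ge0 k : 0 <= th ^+ k. Proof. exact: ltW (thX_gt0 k). Qed.
Lemma thX_le1 k : th ^+ k <= 1. Proof. by apply: exprn_ile1; rewrite ?th_ge0 ?th_le1. Qed.
Lemma thX_leW k l : (l <= k)%N -> th ^+ k <= th ^+ l.
Proof. by move=> h; apply: ler_wiXn2l; rewrite ?th_ge0 ?th_le1. Qed.
Lemma ler_thX k l : (th ^+ k <= th ^+ l) = (l <= k)%N.
Proof. by rewrite ler_iXn2l ?th_gt0 ?th_lt1. Qed.
Lemma qXth k : (q ^ k)%:R * th ^+ k = 1 :> R.
Proof. by rewrite natrX -exprMn mulfV ?expr1n // pnatr_eq0 -lt0n q_gt0. Qed.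

Lemma nrm_pi : nrm pi = th. Proof. exact: lf_nrm_pi. Qed.
Lemma nrm_piX k : nrm (pi ^+ k) = th ^+ k. Proof. by rewrite nrmX nrm_pi. Qed.
Lemma pi_neq0 : pi != 0.
Proof. by apply/eqP => /nrm_eq0P; rewrite nrm_pi => h; have := th_gt0; rewrite h ltxx. Qed.

Lemma thX_small (e : R) : 0 < e -> exists k, th ^+ k < e.
Proof.
move=> e0; have : (fun k => th ^+ k) @ \oo --> (0 : R).
  by apply: cvg_expr; rewrite ger0_norm ?th_ge0 ?th_lt1.
move/cvgr0Pnorm_lt => /(_ e e0) [N _ h].
by exists N; have := h N (leqnn N); rewrite /= ger0_norm ?thX_ge0.
Qed.

Lemma nrm_lt1 a : nrm a < 1 -> nrm a <= th.
Proof.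
move/(lf_piP L) => [c [hc ->]]; rewrite nrmM nrm_pi.
by rewrite ler_piMr // th_ge0.
Qed.

(** Division by [pi] multiplies the norm by [q], so an integral element of norm above [th^N] reaches
    norm 1 after fewer than [N] divisions. *)
Lemma nrm_val a : a != 0 -> nrm a <= 1 -> exists k, nrm a = th ^+ k.
Proof.
move=> a0 a1; have [N hN] := thX_small (nrm_gt0 a0).
elim: N a a0 a1 hN => [|N ih] a a0 a1 hN.
  by have := lt_le_trans hN a1; rewrite expr0 ltxx.
have [a1e|] := eqVneq (nrm a) 1; first by exists 0%N; rewrite expr0.
move=> an1; have /(lf_piP L)[c [hc e]] : nrm a < 1 by rewrite lt_neqAle an1.
have c0 : c != 0 by apply: contra_neq a0 => c0; rewrite e c0 mulr0.
move: hN; rewrite e nrmM nrm_pi exprS ltr_pM2l ?th_gt0 // => /(ih _ c0 hc)[k ->].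
by exists k.+1; rewrite exprS.
Qed.

Lemma nrm_int a : exists k, nrm (pi ^+ k * a) <= 1.
Proof.
have [->|a0] := eqVneq a 0; first by exists 0%N; rewrite mulr0 nrm0.
have /thX_small [k hk] : 0 < (nrm a)^-1 by rewrite invr_gt0 nrm_gt0.
exists k; rewrite nrmM nrm_piX.
by rewrite -ler_pdivlMr ?nrm_gt0 // div1r ltW.
Qed.

Definition digit (i : nat) : F := oapp (lf_res L) 0 (insub i).

Lemma digit_ord (i : 'I_q) : digit i = lf_res L i.
Proof. by rewrite /digit valK. Qed.

Lemma digit_le1 i : nrm (digit i) <= 1.
Proof. by rewrite /digit; case: insubP => /= [u _ _|_]; rewrite ?lf_res1 ?nrm0. Qed.

(* Representatives of [O / pi^k O], indexed by the base-[q] digits of [a < q^k]. *)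
Fixpoint rep (k a : nat) : F :=
  if k is k'.+1 then digit (a %% q) + pi * rep k' (a %/ q) else 0.

Lemma rep_le1 k a : nrm (rep k a) <= 1.
Proof.
elim: k a => [|k ih] a /=; first by rewrite nrm0.
apply: nrmD; rewrite ?digit_le1 // nrmM nrm_pi.
by apply: mulr_ile1; rewrite ?th_ge0 ?nrm_ge0 ?th_le1.
Qed.

Lemma rep_surj k x : nrm x <= 1 ->
  exists2 a, (a < q ^ k)%N & nrm (x - rep k a) <= th ^+ k.
Proof.
elim: k x => [|k ih] x hx; first by exists 0%N => //=; rewrite subr0.
have [i [/= /(lf_piP L) [c [hc e]] _]] := lf_resP L hx.
have [a ha h] := ih c hc.
exists (a * q + i)%N.
  rewrite expnSr; have := ltn_ord i; nia.
rewrite /= modnMDl modn_small ?ltn_ord // divnMDl ?q_gt0 // divn_small ?ltn_ord // addn0.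
rewrite digit_ord opprD addrA e -mulrBr nrmM nrm_pi exprS ler_pM2l ?th_gt0 //.
Qed.

(** Reduction modulo [pi] recovers the last digit; cancelling it and dividing by [pi] leaves the
    same question for [k - 1]. Together with [rep_surj], [pi^k O] has index exactly [q^k] in [O]. *)
Lemma rep_inj k a b : (a < q ^ k)%N -> (b < q ^ k)%N ->
  nrm (rep k a - rep k b) <= th ^+ k -> a = b.
Proof.
elim: k a b => [|k ih] a b ha hb h; first by move: ha hb; rewrite expn0; lia.
have hq := q_gt0.
have piI c : nrm c <= 1 -> nrm (pi * c) < 1.
  by move=> hc; apply/(lf_piP L); exists c.
have e0 : (a %% q = b %% q)%N.
  have [i [_ u]] := lf_resP L (digit_le1 (a %% q)).
  have hA : digit (a %% q) = lf_res L (Ordinal (ltn_pmod a hq)).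
    exact: digit_ord (Ordinal _).
  have hB : digit (b %% q) = lf_res L (Ordinal (ltn_pmod b hq)).
    exact: digit_ord (Ordinal _).
  have : Ordinal (ltn_pmod a hq) = Ordinal (ltn_pmod b hq); last by case.
  have uA : i = Ordinal (ltn_pmod a hq) by apply: u; rewrite /= -hA subrr nrm0.
  rewrite -uA; apply: u; rewrite /= -hB.
  have -> : digit (a %% q) - digit (b %% q) = (rep k.+1 a - rep k.+1 b)
       + (pi * (rep k (b %/ q) - rep k (a %/ q))) by rewrite /=; ring.
  apply: nrmD_lt.
    by rewrite (le_lt_trans h) // exprn_ilt1 ?th_ge0 ?th_lt1.
  by apply: piI; apply: nrmB; apply: rep_le1.
have e1 : (a %/ q = b %/ q)%N.
  apply: ih.
  - by rewrite ltn_divLR // -expnSr.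
  - by rewrite ltn_divLR // -expnSr.
  move: h; rewrite /= e0 opprD addrACA subrr add0r -mulrBr nrmM nrm_pi exprS.
  by rewrite ler_pM2l ?th_gt0.
by rewrite (divn_eq a q) (divn_eq b q) e0 e1.
Qed.

(** Congruence to 0 modulo [pi^k]. By the ultrametric inequality [small k (x - y)] is an equivalence
    relation, and on vectors its classes are the balls of radius [th^k]. *)
Definition small (k : nat) m p (A : 'M[F]_(m, p)) : Prop :=
  forall i j, nrm (A i j) <= th ^+ k.

Lemma small0 k m p : small k (0 : 'M[F]_(m, p)).
Proof. by move=> i j; rewrite mxE nrm0 thX_ge0. Qed.

Lemma smallD k m p (A B : 'M[F]_(m, p)) : small k A -> small k B -> small k (A + B).
Proof. by move=> hA hB i j; rewrite mxE; apply: nrmD. Qed.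

Lemma smallN k m p (A : 'M[F]_(m, p)) : small k A -> small k (- A).
Proof. by move=> hA i j; rewrite mxE nrmN. Qed.

Lemma smallB k m p (A B : 'M[F]_(m, p)) : small k A -> small k B -> small k (A - B).
Proof. by move=> hA hB; apply: smallD => //; apply: smallN. Qed.

Lemma smallBC k m p (A B : 'M[F]_(m, p)) : small k (A - B) -> small k (B - A).
Proof. by move=> h; rewrite -opprB; apply: smallN. Qed.

Lemma small_tri k m p (A B C : 'M[F]_(m, p)) :
  small k (A - B) -> small k (B - C) -> small k (A - C).
Proof. by move=> h1 h2; rewrite -(subrKA B); apply: smallD. Qed.

Lemma smallM k l m p r (A : 'M[F]_(m, p)) (B : 'M[F]_(p, r)) :
  small k A -> small l B -> small (k + l) (A *m B).
Proof.
move=> hA hB i j; rewrite mxE; apply: nrm_sum => [|s _]; first exact: thX_ge0.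
by rewrite nrmM exprD ler_pM ?nrm_ge0.
Qed.

Lemma smallW k l m p (A : 'M[F]_(m, p)) : (l <= k)%N -> small k A -> small l A.
Proof. by move=> h hA i j; rewrite (le_trans (hA i j)) // thX_leW. Qed.

Lemma smallMl k m p r (A : 'M[F]_(m, p)) (B : 'M[F]_(p, r)) :
  small 0 A -> small k B -> small k (A *m B).
Proof. exact: smallM. Qed.

Lemma smallMr k m p r (A : 'M[F]_(m, p)) (B : 'M[F]_(p, r)) :
  small k A -> small 0 B -> small k (A *m B).
Proof. by move=> hA hB; rewrite -[k]addn0; apply: smallM. Qed.

Lemma small_col k m p (A : 'M[F]_(m, p)) j : small k A -> small k (col j A).
Proof. by move=> h i i'; rewrite mxE. Qed.

Lemma small1 m : small 0 (1%:M : 'M[F]_m).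
Proof. by move=> i j; rewrite mxE; case: (i == j); rewrite ?nrm1 ?nrm0 ?ler01. Qed.

Lemma small_piZ k l m p (A : 'M[F]_(m, p)) : small (l + k) (pi ^+ l *: A) <-> small k A.
Proof.
by split=> h i j; have := h i j; rewrite mxE nrmM nrm_piX exprD ler_pM2l ?thX_gt0.
Qed.

Lemma small_piZ0 l m p (A : 'M[F]_(m, p)) : small l (pi ^+ l *: A) <-> small 0 A.
Proof. by rewrite -{1}[l]addn0; exact: small_piZ. Qed.

Lemma small_int m p (A : 'M[F]_(m, p)) : exists l, small 0 (pi ^+ l *: A).
Proof.
have /choice[f hf] : forall i : 'I_m * 'I_p, exists k, nrm (pi ^+ k * A i.1 i.2) <= 1.
  by move=> i; exact: nrm_int.
exists (\max_i f i) => i j; rewrite mxE expr0.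
have h : (f (i, j) <= \max_i f i)%N by apply: leq_bigmax.
rewrite -(subnK h) exprD -mulrA nrmM nrm_piX.
by apply: mulr_ile1; rewrite ?thX_ge0 ?nrm_ge0 ?thX_le1 //; exact: (hf (i, j)).
Qed.

End LocalFieldTheory.

(** * Smith normal form and operator norm *)

Section SingularValues.
Variables (R : realType) (F : fieldType) (nrm : F -> R) (L : local_field nrm).

Notation q := (lf_q L).
Notation pi := (lf_pi L).
Notation th := (th L).
Notation small := (small L).

Lemma vnorm_le n (x : 'cV[F]_n) c : 0 <= c ->
  (na_vnorm nrm x <= c) <-> (forall i, nrm (x i 0) <= c).
Proof.
move=> c0; split=> [h i|h].
  by apply: le_trans h; rewrite /na_vnorm (bigD1 i) //= le_max lexx.
by rewrite /na_vnorm; elim/big_rec: _ => // i y _ hy; rewrite ge_max h hy.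
Qed.

Lemma vnorm_ge0 n (x : 'cV[F]_n) : 0 <= na_vnorm nrm x.
Proof. by rewrite /na_vnorm; elim/big_rec: _ => // i y _ hy; rewrite le_max hy orbT. Qed.

Lemma vnorm_small n (x : 'cV[F]_n) k : na_vnorm nrm x <= th ^+ k <-> small k x.
Proof.
split=> [/vnorm_le h i j|h]; first by rewrite ord1; apply: h; rewrite thX_ge0.
by apply/vnorm_le => [|i]; rewrite ?thX_ge0.
Qed.

Lemma le_vnorm n (x : 'cV[F]_n) i : nrm (x i 0) <= na_vnorm nrm x.
Proof. by move: i; apply/vnorm_le; rewrite ?vnorm_ge0. Qed.

Lemma vnorm_gt0 n (x : 'cV[F]_n) : x != 0 -> 0 < na_vnorm nrm x.
Proof.
move=> x0; rewrite lt_def vnorm_ge0 andbT; apply: contra x0 => /eqP h.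
apply/eqP/matrixP => i j; rewrite ord1 mxE; apply/(nrm_eq0P L)/eqP.
by rewrite eq_le nrm_ge0 // andbT -h le_vnorm.
Qed.

Lemma vnorm_mul n (T : 'M[F]_n) (x : 'cV[F]_n) c :
  0 <= c -> (forall i j, nrm (T i j) <= c) -> na_vnorm nrm (T *m x) <= c * na_vnorm nrm x.
Proof.
move=> c0 h; apply/vnorm_le => [|i]; first by rewrite mulr_ge0 ?vnorm_ge0.
rewrite mxE; apply: (nrm_sum L) => [|j _]; first by rewrite mulr_ge0 ?vnorm_ge0.
by rewrite (nrmM L) ler_pM ?(nrm_ge0 L) ?le_vnorm.
Qed.

Lemma mx_nrm_bound m p (A : 'M[F]_(m, p)) : exists2 c, 0 <= c & forall i j, nrm (A i j) <= c.
Proof.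
exists (\sum_i \sum_j nrm (A i j)).
  by apply: sumr_ge0 => i _; apply: sumr_ge0 => j _; rewrite (nrm_ge0 L).
move=> i j; rewrite (bigD1 i) //= (bigD1 j) //= -addrA lerDl addr_ge0 //.
  by apply: sumr_ge0 => ? _; rewrite (nrm_ge0 L).
by apply: sumr_ge0 => ? _; apply: sumr_ge0 => ? _; rewrite (nrm_ge0 L).
Qed.

(** The supremum dominates its set only once that set is known to be bounded, hence [mx_nrm_bound];
    the entry is then read off the [j]-th basis vector. *)
Lemma entry_le_opnorm n (T : 'M[F]_n) i j : nrm (T i j) <= na_opnorm nrm T.
Proof.
have [c c0 hc] := mx_nrm_bound T.
have ub : has_ubound [set na_vnorm nrm (T *m x) / na_vnorm nrm x
                     | x in [set x : 'cV[F]_n | x != 0]].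
  exists c => _ [x /= x0 <-].
  by rewrite ler_pdivrMr ?vnorm_gt0 // vnorm_mul.
pose e : 'cV[F]_n := delta_mx j 0.
have ve : na_vnorm nrm e = 1.
  apply/eqP; rewrite eq_le; apply/andP; split.
    apply/vnorm_le => // k; rewrite mxE eqxx andbT.
    by case: (k == j); rewrite ?(nrm1 L) ?(nrm0 L) ?ler01.
  by have := le_vnorm e j; rewrite mxE !eqxx (nrm1 L).
have e0 : e != 0.
  by apply/eqP => h; move/matrixP: h => /(_ j 0); rewrite !mxE !eqxx => /eqP; rewrite oner_eq0.
have h : na_vnorm nrm (T *m e) / na_vnorm nrm e <= na_opnorm nrm T.
  by apply: ub_le_sup => //; exists e.
apply: le_trans h; rewrite ve divr1 -colE.
by have := le_vnorm (col j T) i; rewrite mxE.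
Qed.

(** The value group is discrete: a norm below 1 is at most [th], which supplies the uniform
    contraction ratio. *)
Lemma opnorm_lt1_small n (T : 'M[F]_n) : na_opnorm nrm T < 1 -> small 1 T.
Proof. by move=> h i j; rewrite expr1; apply: nrm_lt1; apply: le_lt_trans (entry_le_opnorm T i j) h. Qed.

Lemma nrm_det_le1 n (A : 'M[F]_n) : small 0 A -> nrm (\det A) <= 1.
Proof.
move=> h; apply: (nrm_sum L) => // s _; rewrite (nrmM L) (nrmX L) (nrmN L) (nrm1 L) expr1n mul1r.
rewrite (nrm_prod L); elim/big_rec: _ => // i x _ hx.
by rewrite (le_trans (ler_wpM2l (nrm_ge0 L _) hx)) // mulr1; exact: h.
Qed.

(** Membership in [GL_n(O)], the algebraic form of the isometry group [I_n]. *)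
Definition integral_unit n (P : 'M[F]_n) := small 0 P /\ nrm (\det P) = 1.

Lemma iunit_unitmx n (P : 'M[F]_n) : integral_unit P -> P \in unitmx.
Proof.
move=> [_ h]; rewrite unitmxE unitfE; apply/eqP => h0.
by move: h; rewrite h0 (nrm0 L) => /eqP; rewrite eq_sym oner_eq0.
Qed.

(** The inverse is the adjugate divided by a determinant of norm 1, and cofactors of an integral
    matrix are integral. *)
Lemma iunitV n (P : 'M[F]_n) : integral_unit P -> integral_unit (invmx P).
Proof.
move=> hP; have uP := iunit_unitmx hP; case: hP => hP hd; split; last first.
  by rewrite det_inv (nrmV L) hd invr1.
rewrite /invmx uP => i j; rewrite !mxE (nrmM L) (nrmV L) hd invr1 mul1r.
rewrite (nrmM L) (nrmX L) (nrmN L) (nrm1 L) expr1n mul1r.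
by apply: nrm_det_le1 => k l; rewrite !mxE.
Qed.

Lemma iunitM n (P Q : 'M[F]_n) :
  integral_unit P -> integral_unit Q -> integral_unit (P *m Q).
Proof.
move=> [hP dP] [hQ dQ]; split; last by rewrite det_mulmx (nrmM L) dP dQ mulr1.
exact: (smallM (L := L) (k := 0) (l := 0)).
Qed.

Lemma iunit1 n : integral_unit (1%:M : 'M[F]_n).
Proof. by split; [exact: small1|rewrite det1 (nrm1 L)]. Qed.

Lemma iunit_tperm n (i j : 'I_n) : integral_unit (tperm_mx i j : 'M[F]_n).
Proof.
split; last by rewrite det_perm (nrmX L) (nrmN L) (nrm1 L) expr1n.
by move=> k l; rewrite !mxE; case: eqP => _; rewrite ?(nrm1 L) ?(nrm0 L) ?ler01.
Qed.

Lemma iunit_vnorm n (P : 'M[F]_n) x : integral_unit P ->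
  na_vnorm nrm (P *m x) = na_vnorm nrm x.
Proof.
move=> hP; apply/eqP; rewrite eq_le; apply/andP; split.
  by rewrite -[leRHS]mul1r vnorm_mul // => i j; apply: hP.1.
rewrite -[leRHS]mul1r -{1}(mulKmx (iunit_unitmx hP) x) vnorm_mul // => i j.
exact: (iunitV hP).1.
Qed.

(** For [n = 0] there is no nonzero vector and [na_opnorm] is the supremum of the empty set, which
    is 0; hence [0 < n]. *)
Lemma In_groupP n (P : 'M[F]_n) : (0 < n)%N -> na_In_group nrm P <-> integral_unit P.
Proof.
move=> n0; split=> [[h1 h2]|hP].
  by split=> // i j; rewrite expr0 -h1 entry_le_opnorm.
split; last exact: hP.2.
rewrite /na_opnorm (_ : [set _ | _ in _] = [set 1]) ?sup1 //.
apply/seteqP; split => [_ [x /= x0 <-]|_ ->].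
  by rewrite /= iunit_vnorm // divff // gt_eqF // vnorm_gt0.
exists (const_mx 1).
  apply/eqP => /matrixP /(_ (Ordinal n0) 0); rewrite !mxE => /eqP; by rewrite oner_eq0.
rewrite iunit_vnorm // divff // gt_eqF // vnorm_gt0 //.
apply/eqP => /matrixP /(_ (Ordinal n0) 0); rewrite !mxE => /eqP; by rewrite oner_eq0.
Qed.

(** Gaussian elimination with a pivot of maximal norm: quotients by the pivot are integral, and the
    Schur complement has entries no larger than the pivot. The last conjunct strengthens the
    induction, as it places the pivot before the remaining diagonal entries. *)
Lemma smith_form n (A : 'M[F]_n) : exists (P Q : 'M[F]_n) (s : 'rV[F]_n),
  [/\ integral_unit P, integral_unit Q, A = P *m diag_mx s *m Q,
      forall i j : 'I_n, (i <= j)%N -> nrm (s 0 j) <= nrm (s 0 i) &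
      forall c, 0 <= c -> (forall i j, nrm (A i j) <= c) -> forall i, nrm (s 0 i) <= c].
Proof.
elim: n A => [|n ih] A.
  exists 1%:M, 1%:M, 0; split; try exact: iunit1.
  - by apply/matrixP => [[]].
  - by case.
  - by move=> c _ _ [].
have [->|A0] := eqVneq A 0.
  exists 1%:M, 1%:M, 0; split; try exact: iunit1.
  - by rewrite linear0 mulmx0 mul0mx.
  - by move=> i j _; rewrite !mxE.
  - by move=> c c0 _ i; rewrite mxE (nrm0 L).
pose f (u : 'I_n.+1 * 'I_n.+1) := nrm (A u.1 u.2).
have [[i0 j0] hmax] : exists u, forall v, f v <= f u.
  exists [arg max_(u > (ord0, ord0)) f u]%O; case: arg_maxP => // u _ h v; exact: h.
have a0 : A i0 j0 != 0.
  apply: contra A0 => /eqP a0; apply/eqP/matrixP => i j; rewrite mxE; apply/(nrm_eq0P L)/eqP.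
  by rewrite eq_le (nrm_ge0 L) andbT; have := hmax (i, j); rewrite /f /= a0 (nrm0 L).
pose P0 : 'M[F]_(1 + n) := tperm_mx ord0 i0; pose Q0 : 'M[F]_(1 + n) := tperm_mx ord0 j0.
pose B : 'M[F]_(1 + n) := P0 *m A *m Q0.
have BE i j : B i j = A (tperm ord0 i0 i) (tperm ord0 j0 j).
  by rewrite /B /P0 /Q0 -xrowE -xcolE !mxE.
set a := A i0 j0 in a0.
have Ba : ulsubmx B = a%:M.
  apply/matrixP => i j; rewrite !ord1 [LHS]mxE [LHS]mxE BE [RHS]mxE.
  have -> : lshift n (0 : 'I_1) = ord0 by apply: val_inj.
  by rewrite !tpermL mulr1n.
have Ble i j : nrm (B i j) <= nrm a by rewrite BE; exact: (hmax (_, _)).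
pose u := ursubmx B; pose v := dlsubmx B; pose C := drsubmx B - a^-1 *: (v *m u).
have ule i j : nrm (u i j) <= nrm a by rewrite mxE mxE.
have vle i j : nrm (v i j) <= nrm a by rewrite mxE mxE.
have Cle i j : nrm (C i j) <= nrm a.
  rewrite mxE [X in _ + X]mxE; apply: (nrmB L); first by rewrite mxE mxE.
  rewrite mxE mxE.
  rewrite (nrmM L) (nrmV L) ler_pdivrMl ?(nrm_gt0 L) //.
  apply: (nrm_sum L) => [|k _]; first by rewrite mulr_ge0 ?(nrm_ge0 L).
  by rewrite (nrmM L) ler_pM ?(nrm_ge0 L) //.
have [P1 [Q1 [s1 [hP1 hQ1 e1 so1 b1]]]] := ih C.
pose Lo : 'M[F]_(1 + n) := block_mx 1%:M 0 (a^-1 *: v) 1%:M.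
pose Up : 'M[F]_(1 + n) := block_mx 1%:M (a^-1 *: u) 0 1%:M.
have hdiv k : nrm k <= nrm a -> nrm (a^-1 * k) <= 1.
  by move=> h; rewrite (nrmM L) (nrmV L) ler_pdivrMl ?mulr1 // (nrm_gt0 L).
have hLo : integral_unit Lo.
  split; last by rewrite det_lblock !det1 mulr1 (nrm1 L).
  move=> i j; rewrite /Lo; case: (split_ordP i) => i' ->; case: (split_ordP j) => j' ->.
  - by rewrite block_mxEul; exact: small1.
  - by rewrite block_mxEur; exact: small0.
  - by rewrite block_mxEdl mxE; apply/hdiv/vle.
  - by rewrite block_mxEdr; exact: small1.
have hUp : integral_unit Up.
  split; last by rewrite det_ublock !det1 mulr1 (nrm1 L).
  move=> i j; rewrite /Up; case: (split_ordP i) => i' ->; case: (split_ordP j) => j' ->.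
  - by rewrite block_mxEul; exact: small1.
  - by rewrite block_mxEur mxE; apply/hdiv/ule.
  - by rewrite block_mxEdl; exact: small0.
  - by rewrite block_mxEdr; exact: small1.
have hD (X : 'M[F]_n) : integral_unit X -> integral_unit (block_mx 1%:M 0 0 X : 'M[F]_(1 + n)).
  move=> [hX dX]; split; last by rewrite det_ublock det1 mul1r.
  move=> i j; case: (split_ordP i) => i' ->; case: (split_ordP j) => j' ->.
  - by rewrite block_mxEul; exact: small1.
  - by rewrite block_mxEur; exact: small0.
  - by rewrite block_mxEdl; exact: small0.
  - by rewrite block_mxEdr; exact: hX.
have eB : B = Lo *m block_mx 1%:M 0 0 P1 *m diag_mx (row_mx a%:M s1)
              *m (block_mx 1%:M 0 0 Q1 *m Up).
  rewrite -[LHS]submxK Ba diag_mx_row /Lo /Up -/u -/v.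
  rewrite !mulmx_block !(mulmx0, mul0mx, mul1mx, mulmx1, addr0, add0r).
  have -> : diag_mx a%:M = a%:M :> 'M[F]_1.
    by apply/matrixP => i j; rewrite !ord1 !mxE eqxx.
  congr block_mx.
  - by rewrite mul_scalar_mx scalerA mulfV // scale1r.
  - by rewrite mul_mx_scalar scalerA mulfV // scale1r.
  - rewrite mul_mx_scalar scalerA mulfV // scale1r -scalemxAr -e1 /C.
    by rewrite addrC subrK.
pose s0 : 'rV[F]_(1 + n) := row_mx a%:M s1.
have s0l i : s0 0 (lshift n i) = a by rewrite /s0 row_mxEl ord1 mxE eqxx mulr1n.
have s0r i : s0 0 (rshift 1 i) = s1 0 i by rewrite /s0 row_mxEr.
have s0_sorted (i j : 'I_(1 + n)) : (i <= j)%N -> nrm (s0 0 j) <= nrm (s0 0 i).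
  case: (split_ordP i) => i' ->; case: (split_ordP j) => j' ->.
  - by rewrite !s0l.
  - by rewrite s0l s0r => _; exact: (b1 _ (nrm_ge0 L _) Cle).
  - by rewrite ord1.
  - by rewrite !s0r => h; apply: so1.
have s0_le c : 0 <= c -> (forall i j, nrm (A i j) <= c) -> forall i, nrm (s0 0 i) <= c.
  move=> c0 hc i; case: (split_ordP i) => i' ->; first by rewrite s0l; apply: hc.
  rewrite s0r; apply: (le_trans (b1 _ (nrm_ge0 L _) Cle _)); exact: hc.
exists (P0 *m (Lo *m block_mx 1%:M 0 0 P1)), ((block_mx 1%:M 0 0 Q1 *m Up) *m Q0), s0.
split => //.
- by apply: iunitM; [exact: iunit_tperm|apply: iunitM => //; exact: hD].
- by apply: iunitM; [apply: iunitM => //; exact: hD|exact: iunit_tperm].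
have tK i j : tperm_mx i j *m tperm_mx i j = 1%:M :> 'M[F]_(1 + n).
  by rewrite -perm_mxM tperm2 perm_mx1.
have eA : A = P0 *m B *m Q0.
  by rewrite /B /P0 /Q0 !mulmxA tK mul1mx -mulmxA tK mulmx1.
by rewrite {1}eA {1}eB !mulmxA.
Qed.

End SingularValues.

(** * Covering numbers and the singular value function *)

Section CoveringNumbers.
Variables (R : realType) (F : fieldType) (nrm : F -> R) (L : local_field nrm).

Notation q := (lf_q L).
Notation pi := (lf_pi L).
Notation th := (th L).
Notation small := (small L).

Lemma iunit_small n (P : 'M[F]_n) (x : 'cV[F]_n) k :
  integral_unit L P -> small k (P *m x) <-> small k x.
Proof.
move=> hP; split=> h; last by apply: smallMl => //; exact: hP.1.
rewrite -(mulKmx (iunit_unitmx hP) x); apply: smallMl => //.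
exact: (iunitV hP).1.
Qed.

Lemma singvals_exist n (T : 'M[F]_n) : (0 < n)%N -> \det T != 0 -> exists sv, na_singvals nrm T sv.
Proof.
move=> n0 dT; have [P [Q [s [hP hQ e so _]]]] := smith_form L T.
exists [seq nrm (s 0 i) | i <- enum 'I_n], P, Q, s; split; first exact/(In_groupP L).
split; first exact/(In_groupP L).
split=> //; split=> //; split => // i; apply: (nrm_gt0 L); apply: contra dT => /eqP si.
by rewrite e !det_mulmx det_diag (bigD1 i) //= si mul0r mulr0 mul0r.
Qed.

(** [na_sv_of] picks some list; the decomposition behind that choice is recovered here. Divisibility
    of [T] by [pi^l] passes to the diagonal matrix [P^-1 T Q^-1]. *)
Lemma sv_ofP n (T : 'M[F]_n) : (0 < n)%N -> \det T != 0 -> small 0 T ->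
  exists (P Q : 'M[F]_n) (s : 'rV[F]_n) (j : 'I_n -> nat),
  [/\ [/\ integral_unit L P, integral_unit L Q & T = P *m diag_mx s *m Q],
      forall i, nrm (s 0 i) = th ^+ j i,
      forall a b : 'I_n, (a <= b)%N -> (j a <= j b)%N,
      na_sv_of nrm T = [seq th ^+ j i | i <- enum 'I_n] &
      forall l, small l T -> forall i, (l <= j i)%N].
Proof.
move=> n0 dT sT.
have := xgetPex [::] (singvals_exist n0 dT); rewrite -/(na_sv_of nrm T).
move=> [P [Q [s [/(In_groupP L) hP [/(In_groupP L) hQ [e [so [pos esv]]]]]]]].
have {}hP := hP n0; have {}hQ := hQ n0.
have sl l : small l T -> forall i, nrm (s 0 i) <= th ^+ l.
  move=> hl i; have : small l (diag_mx s).
    have -> : diag_mx s = invmx P *m T *m invmx Q.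
      by rewrite e !mulmxA mulVmx ?(iunit_unitmx hP) // mul1mx mulmxK // (iunit_unitmx hQ).
    apply: smallMr; last exact: (iunitV hQ).1.
    by apply: smallMl => //; exact: (iunitV hP).1.
  by move=> /(_ i i); rewrite mxE eqxx mulr1n.
have /choice[j hj] : forall i, exists k, nrm (s 0 i) = th ^+ k.
  move=> i; apply: nrm_val; last by rewrite -[leRHS](expr0 th) sl.
  by apply/eqP => s0; have := pos i; rewrite s0 (nrm0 L) ltxx.
exists P, Q, s, j; split => //.
- by move=> a b /so; rewrite !hj ler_thX.
- by rewrite esv; apply: eq_map.
- by move=> l /sl h i; rewrite -(ler_thX L) -hj.
Qed.

Definition covers n k (T : 'M[F]_n) (N : nat) := exists c : 'I_N -> 'cV[F]_n,
  forall z, small 0 z -> exists i, small k (T *m z - c i).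

Definition separates n k (T : 'M[F]_n) (N : nat) := exists z : 'I_N -> 'cV[F]_n,
  (forall i, small 0 (z i)) /\ forall i i', small k (T *m (z i - z i')) -> i = i'.

(** Pigeonhole: two separated points in one ball of the cover would be congruent. *)
Lemma separates_le_covers n k (T : 'M[F]_n) N N' :
  separates k T N -> covers k T N' -> (N <= N')%N.
Proof.
move=> [z [z0 hz]] [c hc].
have /choice[f hf] : forall i, exists i', small k (T *m z i - c i') by move=> i; exact: hc.
have fI : injective f.
  move=> i i' e; apply: hz; rewrite mulmxBr.
  apply: small_tri (hf i) _; rewrite e; apply: smallBC; exact: hf.
by have := leq_card f fI; rewrite !card_ord.
Qed.

(* Ultrametric balls make minimal covers and maximal separated sets of [T O^n] equally large,
   so at most one [N] qualifies; [covnumP] below excludes the junk value [0]. *)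
Definition covnum n k (T : 'M[F]_n) : nat :=
  xget 0%N [set N | covers k T N /\ separates k T N].

Lemma covnum_uniq n k (T : 'M[F]_n) N : covers k T N -> separates k T N -> covnum k T = N.
Proof.
move=> h1 h2; apply: xget_unique => // N' [h1' h2'].
by apply/eqP; rewrite eqn_leq (separates_le_covers h2 h1') (separates_le_covers h2' h1).
Qed.

Lemma covers_card n k (T : 'M[F]_n) (I : finType) (c : I -> 'cV[F]_n) :
  (forall z, small 0 z -> exists i, small k (T *m z - c i)) -> covers k T #|I|.
Proof.
move=> h; exists (fun i => c (enum_val i)) => z /h [i hi].
by exists (enum_rank i); rewrite enum_rankK.
Qed.

Lemma separates_card n k (T : 'M[F]_n) (I : finType) (z : I -> 'cV[F]_n) :
  (forall i, small 0 (z i)) -> (forall i i', small k (T *m (z i - z i')) -> i = i') ->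
  separates k T #|I|.
Proof.
move=> h0 h; exists (fun i => z (enum_val i)); split=> // i i' /h.
exact: enum_val_inj.
Qed.

(** Up to isometries [T O^n] is the product of the ideals [pi^(j i) O], and each contributes
    [q^(k - j i)] classes modulo [pi^k]. Truncated subtraction yields the single class when
    [j i >= k]. *)
Lemma covnum_smith n k (P Q : 'M[F]_n) (s : 'rV[F]_n) (j : 'I_n -> nat) :
  integral_unit L P -> integral_unit L Q -> (forall i, nrm (s 0 i) = th ^+ j i) ->
  let T := P *m diag_mx s *m Q in let N := (q ^ \sum_i (k - j i))%N in
  covers k T N /\ separates k T N.
Proof.
move=> hP hQ hs T N.
pose I := {dffun forall i : 'I_n, 'I_(q ^ (k - j i))}.
have -> : N = #|I|.
  rewrite card_dep_ffun foldrE big_map big_enum /= /N expn_sum.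
  by apply: eq_bigr => i _; rewrite card_ord.
have diagE (y : 'cV[F]_n) i : (diag_mx s *m y) i 0 = s 0 i * y i 0.
  rewrite mul_diag_mx mxE; by [].
pose c (f : I) : 'cV[F]_n := \col_i rep L (k - j i) (f i).
split.
  apply: (@covers_card _ _ _ _ (fun f : I => P *m (diag_mx s *m c f))) => z z0.
  have y0 : small 0 (Q *m z) by apply/iunit_small.
  have h i : exists a : 'I_(q ^ (k - j i)),
      nrm ((Q *m z) i 0 - rep L (k - j i) a) <= th ^+ (k - j i).
    have [a ha hr] := rep_surj L (k - j i) (y0 i 0).
    by exists (Ordinal ha).
  pose f : I := [ffun i => sval (cid (h i))].
  exists f; rewrite /T -!mulmxA -mulmxBr; apply/iunit_small => //.
  rewrite -mulmxBr => i i0; rewrite ord1 diagE !mxE ffunE.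
  case: cid => a /= ha; rewrite (nrmM L) hs.
  apply: le_trans (_ : th ^+ (j i) * th ^+ (k - j i) <= _).
    by rewrite ler_pM2l ?thX_gt0 //; move: ha; rewrite mxE.
  by rewrite -exprD thX_leW //; lia.
apply: (@separates_card _ _ _ _ (fun f : I => invmx Q *m c f)) => [f|f g].
  apply/iunit_small; first exact: iunitV.
  by move=> i i0; rewrite mxE expr0 rep_le1.
rewrite /T -!mulmxA -mulmxBr mulKVmx ?(iunit_unitmx hQ) // => /iunit_small h.
apply/ffunP => i; apply/val_inj/(@rep_inj _ _ _ L (k - j i)); try exact: ltn_ord.
have := h hP i 0; rewrite diagE !mxE (nrmM L) hs.
have [jk|jk _] := leqP (j i) k.
  have -> : th ^+ k = th ^+ j i * th ^+ (k - j i) by rewrite -exprD subnKC.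
  by rewrite ler_pM2l ?thX_gt0.
have -> : th ^+ (k - j i) = 1 by rewrite (eqP (ltnW jk)) expr0.
by apply: (nrmB L); exact: rep_le1.
Qed.


(* Slope of [s |-> log (phi^s)]: the [i]-th singular value (counted from 0) enters [phi^s]
   with exponent [svweight n s i]. *)
Definition svweight (n : nat) (s : R) (i : nat) : R :=
  if s <= n%:R then Num.max 0 (Num.min 1 (s - i%:R)) else s / n%:R.

Lemma svweight_ge0 n s i : 0 <= s -> 0 <= svweight n s i.
Proof. by move=> s0; rewrite /svweight; case: ifP => _; rewrite ?le_max ?lexx ?divr_ge0. Qed.

Lemma svweight_le1 n s i : s <= n%:R -> svweight n s i <= 1.
Proof. by move=> sn; rewrite /svweight sn ge_max ler01 ge_min lexx. Qed.

Lemma svweight_mono n s s' i : (0 < n)%N -> s <= s' -> svweight n s i <= svweight n s' i.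
Proof.
move=> n0 ss'; rewrite /svweight; case: ifPn => sn; case: ifPn => sn'.
- rewrite ge_max le_max lexx /= le_max; apply/orP; right.
  by rewrite le_min ge_min lexx /= ge_min lerB ?orbT.
- move: sn'; rewrite -ltNge => sn'.
  have : 1 <= s' / n%:R by rewrite ler_pdivlMr ?ltr0n // mul1r ltW.
  move=> h; rewrite ge_max (le_trans ler01 h) /=; apply: le_trans h.
  by rewrite ge_min lexx.
- by move: sn; rewrite (le_trans ss').
- by rewrite ler_pM2r ?invr_gt0 ?ltr0n.
Qed.

Lemma absz_ceil (s : R) : 0 < s -> exists m, [/\ absz (Num.ceil s) = m.+1, m%:R < s & s <= m.+1%:R].
Proof.
move=> s0; have c0 : (0 < Num.ceil s)%R by rewrite ceil_gt0.
have := ceil_itv s.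
case: (Num.ceil s) c0 => [[|m]|m] // _; exists m; split => //.
  by case/andP: H => h _; rewrite -addn1 PoszD addrK in h.
by case/andP: H.
Qed.

Lemma svweight_eq1 n s i : s <= n%:R -> i.+1%:R <= s -> svweight n s i = 1.
Proof.
move=> sn; rewrite -natr1 => h; have h1 : 1 <= s - i%:R by rewrite lerBrDr addrC.
by rewrite /svweight sn min_l // max_r // ler01.
Qed.

Lemma svweight_eq0 n s i : s <= n%:R -> s <= i%:R -> svweight n s i = 0.
Proof.
move=> sn h; have h0 : s - i%:R <= 0 by rewrite subr_le0.
by rewrite /svweight sn min_r ?max_l // (le_trans h0 ler01).
Qed.

Lemma svweight_frac n s m : s <= n%:R -> m%:R < s -> s <= m.+1%:R -> svweight n s m = s - m%:R.
Proof.
move=> sn ms; rewrite -natr1 => sm; have h0 : s - m%:R <= 1 by rewrite lerBlDr addrC.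
by rewrite /svweight sn min_r // max_r // subr_ge0 ltW.
Qed.

Lemma sum_svweight n (s : R) (g : nat -> R) m : m%:R < s -> s <= m.+1%:R -> s <= n%:R ->
  \sum_(i < n) g i * svweight n s i = \sum_(i < m) g i + g m * (s - m%:R).
Proof.
move=> ms sm sn.
have mn : (m < n)%N by rewrite -(ltr_nat R) (lt_le_trans ms).
rewrite -(big_mkord xpredT (fun i => g i * svweight n s i)).
rewrite (@big_cat_nat _ _ _ m.+1) //= big_nat_recr //=.
rewrite [X in _ + X]big1_seq ?addr0; last first.
  move=> i; rewrite mem_index_iota => /andP[_ /andP[mi _]].
  by rewrite svweight_eq0 ?mulr0 // (le_trans sm) // ler_nat.
rewrite svweight_frac //; congr (_ + _).
rewrite big_mkord; apply: eq_bigr => i _.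
by rewrite svweight_eq1 ?mulr1 // (le_trans _ (ltW ms)) // ler_nat.
Qed.

Lemma sum_svweight1 n (s : R) : (0 < n)%N -> 0 <= s -> \sum_(i < n) svweight n s i = s.
Proof.
move=> n0; rewrite le_eqVlt => /predU1P[<-|s0].
  by rewrite big1 // => i _; rewrite svweight_eq0.
have [sn|sn] := leP s n%:R.
  have [m [_ ms sm]] := absz_ceil s0.
  have := sum_svweight (fun=> 1) ms sm sn.
  under eq_bigr do rewrite mul1r.
  by move=> ->; rewrite sumr_const card_ord mul1r addrC subrK.
under eq_bigr do rewrite /svweight leNgt sn /=.
rewrite sumr_const card_ord -[LHS]mulr_natr mulfVK // pnatr_eq0; by case: n n0 {sn}.
Qed.

Lemma thX_powR k : th ^+ k = th `^ k%:R.
Proof. by rewrite powR_mulrn ?th_ge0. Qed.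

Lemma th_powR_le x y : x <= y -> th `^ y <= th `^ x.
Proof. by apply: ger_powR; rewrite th_gt0 th_le1. Qed.

Lemma th_powRD x y : th `^ (x + y) = th `^ x * th `^ y.
Proof. by rewrite powRD // (gt_eqF (th_gt0 L)) implybT. Qed.

Lemma phi_svweight n (T : 'M[F]_n) (j : 'I_n -> nat) s : (0 < n)%N -> 0 <= s ->
  na_sv_of nrm T = [seq th ^+ j i | i <- enum 'I_n] ->
  na_phi nrm s T = th `^ (\sum_(i < n) (j i)%:R * svweight n s i).
Proof.
move=> n0 s0 e; rewrite /na_phi e.
(* [na_phi] indexes the list by natural numbers, so the exponents are extended by 0 outside
   ['I_n]. *)
pose J i := oapp j 0%N (insub i).
have JE (i : 'I_n) : J i = j i by rewrite /J valK.
set a := map _ _.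
have aE i : (i < n)%N -> nth 0 a i = th ^+ J i.
  move=> hi; rewrite (nth_map (Ordinal hi)) ?size_enum_ord //.
  by rewrite -JE nth_enum_ord.
have -> : \sum_(i < n) (j i)%:R * svweight n s i = \sum_(i < n) (J i)%:R * svweight n s i.
  by apply: eq_bigr => i _; rewrite JE.
have prodE m : (m <= n)%N -> \prod_(i < m) nth 0 a i = th `^ (\sum_(i < m) (J i)%:R).
  elim: m => [|m ih] hm; first by rewrite !big_ord0 powRr0.
  by rewrite !big_ord_recr /= ih ?(ltnW hm) // aE // th_powRD thX_powR.
case: ifPn => sn.
  case: eqP => [->|/eqP sn0].
    by rewrite big1 ?powRr0 // => i _; rewrite svweight_eq0 ?mulr0.
  have {sn0}s0 : 0 < s by rewrite lt_def sn0.
  have [m [-> ms sm]] := absz_ceil s0.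
  rewrite /= (sum_svweight (fun i => (J i)%:R) ms sm sn).
  have mn : (m < n)%N by rewrite -(ltr_nat R) (lt_le_trans ms).
  rewrite prodE ?(ltnW mn) // th_powRD aE // thX_powR -powRrM.
  by congr (_ * _ `^ (_ * _)); rewrite -natr1; ring.
rewrite prodE // -powRrM big_distrl /=; congr (_ `^ _); apply: eq_bigr => i _.
by rewrite /svweight (negbTE sn).
Qed.

Definition good n (T : 'M[F]_n) := small 0 T /\ \det T != 0.

Lemma goodM n (T U : 'M[F]_n) : good T -> good U -> good (T *m U).
Proof.
move=> [h1 h2] [h3 h4]; split; first exact: smallMl.
by rewrite det_mulmx mulf_neq0.
Qed.

Lemma good1 n : good (1%:M : 'M[F]_n).
Proof. by split; [exact: small1|rewrite det1 oner_neq0]. Qed.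

Section Good.
Variables (n : nat) (n0 : (0 < n)%N).
Implicit Types T U : 'M[F]_n.

Lemma good_exponents T : good T -> exists j : 'I_n -> nat,
  [/\ forall a b : 'I_n, (a <= b)%N -> (j a <= j b)%N,
      forall k, covnum k T = (q ^ \sum_i (k - j i))%N,
      forall k, covers k T (covnum k T) /\ separates k T (covnum k T),
      forall s, 0 <= s -> na_phi nrm s T = th `^ (\sum_(i < n) (j i)%:R * svweight n s i) &
      forall l, small l T -> forall i, (l <= j i)%N].
Proof.
move=> [sT dT]; have [P [Q [s [j [[hP hQ eT] hs jm esv jl]]]]] := sv_ofP n0 dT sT.
have h k := covnum_smith k hP hQ hs; rewrite -eT /= in h.
have E k : covnum k T = (q ^ \sum_i (k - j i))%N by apply: covnum_uniq; have [] := h k.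
by exists j; split => // [k|t t0]; [rewrite E|exact: phi_svweight].
Qed.

Lemma covnumP k T : good T -> covers k T (covnum k T) /\ separates k T (covnum k T).
Proof. by move=> /good_exponents [j [_ _ h _ _]]. Qed.

Lemma covnum_gt0 k T : good T -> (0 < covnum k T)%N.
Proof. by move=> /good_exponents [j [_ -> _ _ _]]; rewrite expn_gt0 q_gt0. Qed.

Lemma covnum_small k T : good T -> small k T -> covnum k T = 1%N.
Proof.
move=> /good_exponents [j [_ -> _ _ jl]] /jl h.
by rewrite big1 // => i _; apply/eqP; rewrite subn_eq0.
Qed.

(** Cover [U O^n] at scale [l]. Each piece lies in some [e + pi^l O^n], whose image under [T] is a
    translate of [pi^l T O^n] and takes [covnum k T] balls at scale [k + l]. *)
Lemma covnum_mul k l T U : good T -> good U ->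
  (covnum (k + l) (T *m U) <= covnum k T * covnum l U)%N.
Proof.
move=> gT gU; have [_ sTU] := covnumP (k + l) (goodM gT gU).
have [[c hc] _] := covnumP k gT; have [[e he] _] := covnumP l gU.
apply: (separates_le_covers sTU).
have -> : (covnum k T * covnum l U)%N = #|{: 'I_(covnum k T) * 'I_(covnum l U)}|.
  by rewrite card_prod !card_ord.
apply: (@covers_card _ _ _ _ (fun u => T *m e u.2 + pi ^+ l *: c u.1)) => z /he [b hb].
have [y y0 yE] : exists2 y, small 0 y & U *m z - e b = pi ^+ l *: y.
  have pl : pi ^+ l != 0 by rewrite expf_neq0 // pi_neq0.
  exists (pi ^- l *: (U *m z - e b)); last by rewrite scalerA mulfV // scale1r.
  by apply/(small_piZ0 L l); rewrite scalerA mulfV // scale1r.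
have [a ha] := hc y y0; exists (a, b) => /=.
have -> : T *m U *m z - (T *m e b + pi ^+ l *: c a) = pi ^+ l *: (T *m y - c a).
  by rewrite scalerBr scalemxAr -yE mulmxBr mulmxA opprD addrA.
by rewrite addnC; apply/small_piZ.
Qed.

Lemma covnum_mulr k T U : good T -> good U -> (covnum k (T *m U) <= covnum k T)%N.
Proof.
move=> gT gU; have := covnum_mul k 0 gT gU.
by rewrite addn0 (covnum_small gU gU.1) muln1.
Qed.

(** Each truncated difference [k - j i] is convex in [k]. *)
Lemma covnum_convex k T : good T ->
  (covnum k.+1 T ^ 2 <= covnum k T * covnum k.+2 T)%N.
Proof.
move=> /good_exponents [j [_ E _ _ _]]; rewrite !E -expnD -expnM leq_exp2l ?q_gt1 //.
by rewrite muln2 -addnn -!big_split /=; apply: leq_sum => i _; lia.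
Qed.

Lemma phi_gt0 s T : good T -> 0 <= s -> 0 < na_phi nrm s T.
Proof. by move=> /good_exponents [j [_ _ _ h _]] s0; rewrite h // powR_gt0 // th_gt0. Qed.

Lemma qX_powR N : (q ^ N)%:R = th `^ (- N%:R) :> R.
Proof. by rewrite powRN -thX_powR natrX exprVn invrK. Qed.

(* Legendre duality: [phi^s T] is the minimum over [k] of [covnum k T * th^(k s)]. Products of
   covers then give the submultiplicativity of [phi^s] without exterior powers. *)
Lemma phi_le_covnum s k T : good T -> 0 <= s -> s <= n%:R ->
  na_phi nrm s T <= (covnum k T)%:R * th `^ (k%:R * s).
Proof.
move=> /good_exponents [j [_ E _ h _]] s0 sn; rewrite h // E qX_powR -th_powRD.
apply: th_powR_le; rewrite -{1}(sum_svweight1 n0 s0) natr_sum -sumrN mulr_sumr -big_split /=.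
apply: ler_sum => i _.
have w0 := svweight_ge0 n i s0; have w1 := svweight_le1 i sn.
have [jk|jk] := leqP (j i) k.
  rewrite natrB //; have : (0 : R) <= k%:R - (j i)%:R by rewrite subr_ge0 ler_nat.
  nra.
rewrite (eqP (ltnW jk)) oppr0 add0r ler_wpM2r // ler_nat; exact: ltnW.
Qed.

(** For [m < s <= m + 1] the minimum is attained at the exponent with index [m]: smaller indices
    have weight 1 and exponent at most [k], larger ones have weight 0 and add nothing to
    [covnum k T]. *)
Lemma phi_eq_covnum s l T : good T -> small l T -> 0 <= s -> s <= n%:R ->
  exists2 k, (l <= k)%N & na_phi nrm s T = (covnum k T)%:R * th `^ (k%:R * s).
Proof.
move=> gT lT s0 sn; have [j [jm E _ h jl]] := good_exponents gT.
move: s0; rewrite le_eqVlt => /predU1P[<-|s0].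
  exists l => //; rewrite covnum_small // mulr0 powRr0 h //.
  by rewrite big1 ?powRr0 ?mulr1 // => i _; rewrite svweight_eq0 ?mulr0.
have [m [_ ms sm]] := absz_ceil s0.
have mn : (m < n)%N by rewrite -(ltr_nat R) (lt_le_trans ms).
exists (j (Ordinal mn)); first exact: jl.
set k := j _; rewrite h ?(ltW s0) // E qX_powR -th_powRD; congr (_ `^ _).
rewrite -{2}(sum_svweight1 n0 (ltW s0)) natr_sum -sumrN mulr_sumr -big_split /=.
apply: eq_bigr => i _.
have [im|mi|im] := ltngtP i m.
- have jk : (j i <= k)%N by apply: jm; exact: ltnW.
  rewrite natrB // svweight_eq1 ?(le_trans _ (ltW ms)) ?ler_nat //; ring.
- have jk : (k <= j i)%N by apply: jm; exact: ltnW.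
  rewrite (eqP jk) svweight_eq0 ?(le_trans sm) ?ler_nat //; ring.
- have -> : i = Ordinal mn by apply: val_inj.
  by rewrite -/k subnn oppr0 add0r.
Qed.

Lemma phi_mul s T U : good T -> good U -> 0 <= s -> s <= n%:R ->
  na_phi nrm s (T *m U) <= na_phi nrm s T * na_phi nrm s U.
Proof.
move=> gT gU s0 sn.
have [k _ ->] := phi_eq_covnum gT gT.1 s0 sn; have [l _ ->] := phi_eq_covnum gU gU.1 s0 sn.
apply: le_trans (phi_le_covnum (k + l) (goodM gT gU) s0 sn) _.
rewrite natrD mulrDl th_powRD mulrACA ler_wpM2r ?mulr_ge0 ?powR_ge0 //.
by rewrite -natrM ler_nat covnum_mul.
Qed.

(** The weights gain [s' - s] in total, and each multiplies an exponent of at least [l]. *)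
Lemma phi_decr s s' l T : good T -> small l T -> 0 <= s -> s <= s' ->
  na_phi nrm s' T <= na_phi nrm s T * th `^ (l%:R * (s' - s)).
Proof.
move=> gT lT s0 ss'; have [j [_ _ _ h jl]] := good_exponents gT.
have s'0 := le_trans s0 ss'.
rewrite !h // -th_powRD; apply: th_powR_le.
have -> : s' - s = \sum_(i < n) (svweight n s' i - svweight n s i).
  by rewrite sumrB !sum_svweight1.
rewrite mulr_sumr -big_split /=; apply: ler_sum => i _.
have w := svweight_mono i n0 ss'; have := jl l lT i; rewrite -(ler_nat R).
nra.
Qed.

End Good.
End CoveringNumbers.

(** * Sums over words and the pressure equation *)

Lemma sum_if_lt (R : realType) (c : R) k N : 0 <= c ->
  \sum_(0 <= j < N) (if (j < k)%N then c else 0) <= k%:R * c.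
Proof.
move=> c0; apply: (@le_trans _ _ ((minn N k)%:R * c)); last first.
  by rewrite ler_wpM2r // ler_nat geq_minr.
elim: N => [|N ih]; first by rewrite big_geq // min0n mul0r.
rewrite big_nat_recr //=; case: ltnP => Nk.
  move: ih; rewrite (minn_idPl (ltnW Nk)) (minn_idPl Nk) => ih.
  by rewrite -natr1 mulrDl mul1r lerD2r.
by rewrite addr0 (minn_idPr (leqW Nk)); move: ih; rewrite (minn_idPr Nk).
Qed.

Lemma sum_geometric (R : realType) (x : R) p : 0 <= x -> x < 1 -> \sum_(j < p) x ^+ j <= (1 - x)^-1.
Proof.
move=> x0 x1; have h : 0 < 1 - x by rewrite subr_gt0.
suff -> : \sum_(j < p) x ^+ j = (1 - x ^+ p) / (1 - x).
  by rewrite ler_pdivrMr // mulVf ?gt_eqF // lerBlDr lerDl exprn_ge0.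
have hn : 1 - x != 0 by rewrite gt_eqF.
by apply: (mulIf hn); rewrite mulfVK // -[RHS]opprB subrX1 -mulNr opprB mulrC.
Qed.

Section WordSums.
Variables (R : realType) (M : nat).
Implicit Types (f g : seq 'I_M -> R) (w : seq 'I_M).

(** Recursion on the first letter lets a prefix move into [f], as the inductions over the word tree
    require; [sum_tuple_wsum] is the bridge to the sum in [na_is_dimd]. *)
Fixpoint wsum (r : nat) f : R :=
  if r is r'.+1 then \sum_(i < M) wsum r' (fun u => f (i :: u)) else f [::].

Lemma sum_tuple_wsum r f : \sum_(w : r.-tuple 'I_M) f w = wsum r f.
Proof.
elim: r f => [|r ih] f.
  rewrite (bigD1 [tuple]) //= big1 ?addr0 // => w /negP[].
  by apply/eqP/val_inj => /=; exact/nilP/eqP/size_tuple.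
rewrite /= (reindex (fun p : 'I_M * r.-tuple 'I_M => [tuple of p.1 :: p.2])) /=; last first.
  exists (fun w : r.+1.-tuple 'I_M => (thead w, [tuple of behead w])).
    by move=> [i w] _ /=; congr (_, _); apply: val_inj.
  by move=> w _; rewrite [RHS]tuple_eta.
rewrite -(pair_bigA _ (fun i (w : r.-tuple 'I_M) => f (i :: w))) /=.
by apply: eq_bigr => i _; rewrite -ih.
Qed.

Lemma ler_wsum r f g : (forall w, size w = r -> f w <= g w) -> wsum r f <= wsum r g.
Proof.
elim: r f g => [|r ih] f g h /=; first exact: h.
by apply: ler_sum => i _; apply: ih => w e; apply: h; rewrite /= e.
Qed.

Lemma eq_wsum r f g : (forall w, size w = r -> f w = g w) -> wsum r f = wsum r g.
Proof.
by move=> h; apply/eqP; rewrite eq_le !ler_wsum // => w e; rewrite h.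
Qed.

Lemma wsum_ge0 r f : (forall w, 0 <= f w) -> 0 <= wsum r f.
Proof. by elim: r f => [|r ih] f h //=; apply: sumr_ge0 => i _; apply: ih. Qed.

Lemma wsumMr r f (c : R) : wsum r (fun w => f w * c) = wsum r f * c.
Proof.
elim: r f => [|r ih] f //=; rewrite mulr_suml; apply: eq_bigr => i _; exact: ih.
Qed.

Lemma wsum_sum r (I : Type) (s : seq I) (P : pred I) (F : I -> seq 'I_M -> R) :
  wsum r (fun w => \sum_(i <- s | P i) F i w) = \sum_(i <- s | P i) wsum r (F i).
Proof.
elim: r F => [|r ih] F //=; rewrite exchange_big /=; apply: eq_bigr => i _; exact: ih.
Qed.

Lemma wsumD r f g : wsum r (fun w => f w + g w) = wsum r f + wsum r g.
Proof.
by elim: r f g => [|r ih] f g //=; rewrite -big_split; apply: eq_bigr => i _; exact: ih.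
Qed.

Lemma wsum_cat r p f : wsum (r + p) f = wsum r (fun u => wsum p (fun v => f (u ++ v))).
Proof. by elim: r f => [|r ih] f //=; apply: eq_bigr => i _; exact: ih. Qed.

Lemma wsum_cst r (c : R) : wsum r (fun=> c) = (M ^ r)%:R * c.
Proof.
elim: r => [|r ih] /=; first by rewrite expn0 mul1r.
by rewrite ih sumr_const card_ord expnS natrM -mulrA [RHS]mulr_natl.
Qed.

End WordSums.

(** * Exponential growth of the sums of [phi^s] over words *)

Section Pressure.
Variables (R : realType) (F : fieldType) (nrm : F -> R) (L : local_field nrm).
Variables (n M : nat) (T : 'I_M -> 'M[F]_n).

Notation q := (lf_q L).
Notation th := (th L).
Notation small := (small L).

Definition Tw (w : seq 'I_M) : 'M[F]_n := foldr (fun i A => T i *m A) 1%:M w.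

Lemma Tw_cat u v : Tw (u ++ v) = Tw u *m Tw v.
Proof. by elim: u => [|i u ih] /=; rewrite ?mul1mx // ih mulmxA. Qed.

Lemma Tw_rcons u i : Tw (rcons u i) = Tw u *m T i.
Proof. by rewrite -cats1 Tw_cat /= mulmx1. Qed.

Definition phiw (s : R) (w : seq 'I_M) : R := na_phi nrm s (Tw w).
Definition Zs (s : R) (r : nat) : R := wsum r (phiw s).

Lemma dimd_lnZ d : na_is_dimd nrm T d -> forall e, 0 < e ->
  exists r0 : nat, forall r, (r0 <= r)%N -> `|ln (Zs d r)| <= e * r%:R.
Proof.
move=> [_ /cvgr0Pnorm_le h] e e0; have [r0 _ hr0] := h e e0.
exists r0.+1 => r hr; have r_gt0 : (0 : R) < r%:R by rewrite ltr0n; lia.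
have := hr0 r (ltnW hr); rewrite /= normrM. rewrite (ger0_norm (_ : 0 <= r%:R^-1)) ?invr_ge0 ?ler0n //.
by rewrite ler_pdivrMl // mulrC (sum_tuple_wsum r (phiw d)).
Qed.

(** If [n = 0] or [d = 0], then [phi^d] is constantly 1 and the sums equal [M^r], whose growth rate
    [ln M > 0] contradicts the pressure equation. *)
Lemma dimd_gt0 d : (2 <= M)%N -> na_is_dimd nrm T d -> (0 < n)%N /\ 0 < d.
Proof.
move=> M2 hd; have d0 : 0 <= d by case: hd.
have key : ~ (forall w, phiw d w = 1).
  move=> phi1; have lnM : 0 < ln (M%:R : R) by rewrite ln_gt0 // ltr1n.
  have [r0 h] := dimd_lnZ hd (divr_gt0 lnM (ltr0n R 2)).
  have := h r0.+1 (leqnSn r0).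
  have -> : Zs d r0.+1 = (M%:R) ^+ r0.+1.
    by rewrite /Zs (eq_wsum (g := fun=> 1)) // wsum_cst mulr1 natrX.
  rewrite lnXn ?ltr0n; last lia.
  rewrite ger0_norm ?mulrn_wge0 ?(ltW lnM) // -(mulr_natr (ln _)) ler_pM2r ?ltr0n //.
  lra.
split.
  rewrite lt0n; apply/eqP => n0; apply: key => w; rewrite /phiw /na_phi.
  move: (Tw w); rewrite n0 => A; rewrite big_ord0 powR1.
  have [d0'|//] := leP d 0; case: eqP => // -[].
  by apply/eqP; rewrite eq_le d0' d0.
rewrite lt_def d0 andbT; apply/eqP => e; apply: key => w.
by rewrite /phiw /na_phi e ler0n eqxx.
Qed.

Hypotheses (n0 : (0 < n)%N) (gT : forall i, good L (T i)) (sT : forall i, small 1 (T i)).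

Lemma Tw_good w : good L (Tw w).
Proof. by elim: w => [|i w ih] /=; [exact: good1|exact: goodM]. Qed.

Lemma Tw_small w : small (size w) (Tw w).
Proof.
elim: w => [|i w ih] /=; first exact: small1.
by rewrite -[(size w).+1]add1n; apply: smallM.
Qed.

Lemma phiw_gt0 s w : 0 <= s -> 0 < phiw s w.
Proof. by move=> s0; apply: (phi_gt0 n0 (L := L)) => //; exact: Tw_good. Qed.

Lemma Zs_ge0 s r : 0 <= s -> 0 <= Zs s r.
Proof. by move=> s0; apply: wsum_ge0 => w; apply/ltW/phiw_gt0. Qed.

Lemma phiw_cat s u v : 0 <= s -> s <= n%:R -> phiw s (u ++ v) <= phiw s u * phiw s v.
Proof.
by move=> s0 sn; rewrite /phiw Tw_cat; apply: (phi_mul n0 (L := L)) => //; exact: Tw_good.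
Qed.

Lemma phiw_nil s : 0 <= s -> s <= n%:R -> phiw s [::] = 1.
Proof.
move=> s0 sn; have [k _ e] := phi_eq_covnum n0 (good1 L n) (@small1 _ _ _ L n) s0 sn.
apply/eqP; rewrite eq_le; apply/andP; split.
  have := phi_le_covnum n0 0 (good1 L n) s0 sn.
  by rewrite mul0r powRr0 mulr1 covnum_small //; [exact: good1|exact: small1].
(* Submultiplicativity at the empty word reads [phi <= phi^2], which gives the lower bound 1. *)
have := phiw_cat [::] [::] s0 sn; rewrite cats0.
by rewrite ler_pMl // phiw_gt0.
Qed.

Lemma Zs_decr s s' r : 0 <= s -> s <= s' -> Zs s' r <= Zs s r * th `^ (r%:R * (s' - s)).
Proof.
move=> s0 ss'; rewrite /Zs -wsumMr; apply: ler_wsum => w e.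
by apply: (phi_decr n0) => //; [exact: Tw_good|rewrite -e; exact: Tw_small].
Qed.

Lemma Zs_gt0 s r : (0 < M)%N -> 0 <= s -> 0 < Zs s r.
Proof.
move=> M0 s0; rewrite /Zs; move: (phiw s) (fun w => phiw_gt0 w s0).
elim: r => [|r ih] f hf /=; first exact: hf.
rewrite (bigD1 (Ordinal M0)) //= ltr_wpDr ?ih //.
by apply: sumr_ge0 => i _; apply: wsum_ge0 => w; apply/ltW.
Qed.

Lemma lnth_lt0 : ln th < 0.
Proof. by rewrite ln_lt0 // th_gt0 th_lt1. Qed.

Lemma th_powRE x : th `^ x = expR (x * ln th).
Proof. by rewrite /powR (gt_eqF (th_gt0 L)). Qed.

(** At [d] the sums grow subexponentially, and passing to [s] brings the factor [th^(r (s - d))].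
    Half of that rate, the constant [e], pays for the growth at [d]; the other half leaves a
    geometric series. *)
Lemma sum_Zs_bounded d s : (0 < M)%N -> na_is_dimd nrm T d -> d < s ->
  exists C, forall p, \sum_(j < p) Zs s j <= C.
Proof.
move=> M0 hd ds; have d0 : 0 <= d by case: hd.
have s0 : 0 <= s := le_trans d0 (ltW ds).
have lt0 := lnth_lt0.
pose e := (s - d) * - ln th / 2.
have e0 : 0 < e by rewrite divr_gt0 // mulr_gt0 ?oppr_gt0 ?subr_gt0.
have [r0 h] := dimd_lnZ hd e0.
pose x := expR (- e); have x1 : x < 1 by rewrite expR_lt1 oppr_lt0.
have x0 : 0 <= x := expR_ge0 _.
have Zx r : (r0 <= r)%N -> Zs s r <= x ^+ r.
  move=> hr; apply: le_trans (Zs_decr r d0 (ltW ds)) _.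
  have hZ : Zs d r <= expR (e * r%:R).
    by rewrite -ler_ln ?posrE ?expR_gt0 ?Zs_gt0 // expRK (le_trans (ler_norm _)) ?h.
  rewrite -[x ^+ r]expRM_natl th_powRE.
  apply: le_trans (ler_wpM2r (expR_ge0 _) hZ) _.
  rewrite -expRD ler_expR /e; lra.
exists (\sum_(j < r0) Zs s j + (1 - x)^-1) => p.
have [pr|rp] := leqP p r0.
  have -> : r0 = (p + (r0 - p))%N by rewrite subnKC.
  rewrite big_split_ord /= -addrA lerDl addr_ge0 ?invr_ge0 ?subr_ge0 ?(ltW x1) //.
  by apply: sumr_ge0 => i _; exact: Zs_ge0.
have -> : p = (r0 + (p - r0))%N by rewrite subnKC // ltnW.
rewrite big_split_ord /= lerD2l.
apply: le_trans (sum_geometric (p - r0) x0 x1).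
apply: ler_sum => i _; apply: le_trans (Zx _ (leq_addr _ _)) _.
by rewrite exprD ler_piMl ?exprn_ge0 // exprn_ile1 // ltW.
Qed.

(** A bound at [s] would force exponential decay at [d], against the pressure equation. *)
Lemma Zs_unbounded d s C : (0 < M)%N -> na_is_dimd nrm T d -> 0 <= s -> s < d ->
  ~ (forall r, Zs s r <= C).
Proof.
move=> M0 hd s0 sd hC; have lt0 := lnth_lt0.
have d0 : 0 <= d by case: hd.
pose e := (d - s) * - ln th / 2.
have e0 : 0 < e by rewrite divr_gt0 // mulr_gt0 ?oppr_gt0 ?subr_gt0.
have [r0 h] := dimd_lnZ hd e0.
have C0 : 0 < C := lt_le_trans (Zs_gt0 0 M0 s0) (hC 0%N).
have key r : (r0 <= r)%N -> e * r%:R <= ln C.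
  move=> hr.
  have : ln (Zs d r) <= ln C + r%:R * (d - s) * ln th.
    rewrite -ler_expR lnK ?posrE ?Zs_gt0 // expRD lnK ?posrE // -th_powRE.
    apply: le_trans (Zs_decr r s0 (ltW sd)) _; apply: ler_wpM2r => //; exact: powR_ge0.
  have := h r hr; rewrite ler_norml => /andP[+ _]; rewrite /e => h1 h2; lra.
pose r := (r0 + Num.truncn (ln C / e)).+1.
have := key r (leqW (leq_addr _ _)); rewrite mulrC -ler_pdivlMr // leNgt => /negP; apply.
apply: lt_le_trans (truncnS_gt _) _.
by rewrite ler_nat /r ltnS leq_addl.
Qed.

End Pressure.

(** * Covers of the attractor *)

Section BallCovers.
Variables (R : realType) (F : fieldType) (nrm : F -> R) (L : local_field nrm) (n : nat).

Notation q := (lf_q L).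
Notation th := (th L).
Notation small := (small L).

(** The count is bounded by a real [x], so that estimates in terms of [phi^s] can be added without
    rounding. *)
Definition ball_cover (k : nat) (E : set 'cV[F]_n) (x : R) := exists N (c : 'I_N -> 'cV[F]_n),
  N%:R <= x /\ forall y, E y -> exists i, small k (y - c i).

Lemma ball_coverW k (E E' : set 'cV[F]_n) x y :
  E `<=` E' -> x <= y -> ball_cover k E' x -> ball_cover k E y.
Proof. by move=> EE xy [N [c [h1 h2]]]; exists N, c; split=> [|z /EE /h2//]; exact: le_trans xy. Qed.

Lemma ball_cover_bigcup k (I : finType) (E : I -> set 'cV[F]_n) (x : I -> R) :
  (forall i, ball_cover k (E i) (x i)) -> ball_cover k (\bigcup_(i in [set: I]) E i) (\sum_i x i).
Proof.
move=> h; have {}h i : {N : nat & {c : 'I_N -> 'cV[F]_n |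
    N%:R <= x i /\ forall y, E i y -> exists a, small k (y - c a)}}.
  by have [N /cid [c hc]] := cid (h i); exists N, c.
pose J := {i : I & 'I_(projT1 (h i))}.
exists #|{: J}|, (fun a => sval (projT2 (h (tag (enum_val a)))) (tagged (enum_val a))); split.
  rewrite card_tagged sumnE big_map big_enum /= natr_sum; apply: ler_sum => i _.
  by rewrite card_ord; case: (projT2 (h i)) => c [].
move=> y [i _ Ey]; have [a ha] : exists a, small k (y - sval (projT2 (h i)) a).
  by case: (projT2 (h i)) => c [_ hc] /=; exact: hc.
exists (enum_rank (Tagged (fun i => 'I_(projT1 (h i))) a : J)).
by rewrite enum_rankK.
Qed.

(** Multiplication by [pi^l] carries [E] into [O^n], where [covnum] applies, and turns scale [k]
    into [k + l]. *)
Lemma ball_cover_image (A : 'M[F]_n) (c : 'cV[F]_n) (E : set 'cV[F]_n) k l :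
  (0 < n)%N -> good L A -> (forall x, E x -> small 0 (lf_pi L ^+ l *: x)) ->
  ball_cover k [set A *m x + c | x in E] (covnum L (k + l) A)%:R.
Proof.
move=> n0 gA hE; have [[e he] _] := covnumP n0 (k + l) gA.
exists (covnum L (k + l) A), (fun i => c + lf_pi L ^- l *: e i); split => // _ [x /hE /he [i hi] <-].
exists i; apply/(small_piZ L k l); rewrite [(l + k)%N]addnC.
have pl : lf_pi L ^+ l != 0 by rewrite expf_neq0 // pi_neq0.
suff -> : lf_pi L ^+ l *: (A *m x + c - (c + lf_pi L ^- l *: e i)) = A *m (lf_pi L ^+ l *: x) - e i by [].
by rewrite opprD addrA addrK scalerBr scalerA mulfV // scale1r scalemxAr.
Qed.

Lemma small_open_dist (x y : 'cV[F]_n) k :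
  na_vnorm nrm (x - y) < th ^+ k -> small k (x - y).
Proof. by move=> h; apply/vnorm_small/ltW. Qed.

(** The sets [pi^-l O^n] are open, increasing and exhaust the space, so the largest one of a finite
    subcover contains [K]. *)
Lemma compact_bounded (K : set 'cV[F]_n) :
  na_mcompact (fun x y => na_vnorm nrm (x - y)) K ->
  exists l, forall x, K x -> small 0 (lf_pi L ^+ l *: x).
Proof.
move=> Kc.
pose B (l : nat) : set 'cV[F]_n := [set x | small 0 (lf_pi L ^+ l *: x)].
have Bmono l l' : (l <= l')%N -> B l `<=` B l'.
  move=> h x hx; rewrite /B /= -(subnK h) exprD -scalerA.
  by apply: (smallW (leq0n (l' - l)%N)); apply/small_piZ0.
have Bopen U : [set B l | l in setT] U -> na_mopen (fun x y => na_vnorm nrm (x - y)) U.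
  move=> [l _ <-] x Bx; exists 1 => // y; rewrite /= -[X in _ < X](expr0 th) => /small_open_dist h.
  have -> : B l y = small 0 (lf_pi L ^+ l *: x - lf_pi L ^+ l *: (x - y)).
    by rewrite -scalerBr opprB addrC subrK.
  apply: smallB => //; apply: (smallW (leq0n l)); exact/small_piZ0.
have [k [V [hV KV]]] := Kc _ Bopen (fun x _ => let: ex_intro l hl := small_int L x in
   ex_intro2 _ _ (B l) (ex_intro2 _ _ l I erefl) hl).
have /choice[f hf] : forall j, exists l, (j < k)%N -> B l = V j.
  move=> j; have [jk|jk] := ltnP j k; last by exists 0%N.
  by have [l _ hl] := hV j jk; exists l.
exists (\max_(j < k) f j) => x /KV [j /= jk]; rewrite -hf //.
by apply: Bmono; exact: (leq_bigmax (Ordinal jk)).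
Qed.

End BallCovers.

(** * Covering the attractor by stopped cylinders *)

Section CylinderCover.
Variables (R : realType) (F : fieldType) (nrm : F -> R) (L : local_field nrm).
Variables (n M : nat) (T : 'I_M -> 'M[F]_n).

Notation q := (lf_q L).
Notation th := (th L).
Notation small := (small L).
Notation Tw := (Tw T).

(** The point [S_w(0)]: the composed map of [w] is [x |-> Tw w *m x + xw b w]. *)
Definition xw (b : 'M[F]_(n, M)) (w : seq 'I_M) : 'cV[F]_n :=
  foldr (fun i y => T i *m y + col i b) 0 w.

Lemma xw_cat b u v : xw b (u ++ v) = xw b u + Tw u *m xw b v.
Proof.
elim: u => [|i u ih] /=; first by rewrite mul1mx add0r.
by rewrite ih mulmxDr mulmxA -!addrA [_ + col i b]addrC.
Qed.

(** Ratios of successive terms do not decrease, so one strict increase is followed only by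
    increases. *)
Lemma log_convex_increasing (a : nat -> R) k0 k : (forall i, 0 < a i) ->
  (forall i, a i.+1 ^+ 2 <= a i * a i.+2) -> (k0 < k)%N -> a k0 < a k ->
  forall k1, (k <= k1)%N -> a k <= a k1.
Proof.
move=> a0 ac kk ak.
have [i ik ai] : exists2 i, (i < k)%N & a i < a i.+1.
  apply: contrapT => h; have {}h i : (i < k)%N -> a i.+1 <= a i.
    by move=> ik; rewrite leNgt; apply/negP => ai; apply: h; exists i.
  have {}h : a k <= a k0.
    rewrite -(subnKC (ltnW kk)).
    have : (k0 + (k - k0) <= k)%N by rewrite subnKC // ltnW.
    elim: (k - k0)%N => [|j ih] hj; first by rewrite addn0.
    by rewrite addnS in hj *; rewrite (le_trans (h _ hj)) // ih // ltnW.
  by have := lt_le_trans ak h; rewrite ltxx.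
have inc j : a (i + j)%N < a (i + j).+1.
  elim: j => [|j ih]; first by rewrite addn0.
  rewrite addnS -(ltr_pM2l (a0 (i + j).+1)) -expr2.
  by rewrite (le_lt_trans (ac _)) // ltr_pM2r.
move=> k1 kk1; rewrite -(subnKC kk1); elim: (k1 - k)%N => [|j ih]; first by rewrite addn0.
rewrite addnS (le_trans ih) //.
have -> : (k + j = i + (k - i + j))%N by lia.
exact: ltW.
Qed.

Hypotheses (n0 : (0 < n)%N) (gT : forall i, good L (T i)) (sT : forall i, small 1 (T i)).
Let Twg w : good L (Tw w) := Tw_good gT w.

(* At scale [k] the cylinder of [w] is not subdivided further once this holds. By log-convexity
   of [covnum] in [k], failure at [w] puts the minimum defining [phi^s] at a scale where the
   children of [w] are controlled by [phi^s (Tw w)]. *)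
Definition stops (s : R) (k : nat) (w : seq 'I_M) := forall k', (k' <= k)%N ->
  (covnum L k (Tw w))%:R * th `^ (k%:R * s) <= (covnum L k' (Tw w))%:R * th `^ (k'%:R * s).

Lemma stops_small s k w : 0 <= s -> (k <= size w)%N -> stops s k w.
Proof.
move=> s0 kw k' kk'; rewrite covnum_small //; last first.
  by apply: smallW kw _; exact: Tw_small.
rewrite ler_pM ?powR_ge0 ?ler1n ?covnum_gt0 //.
by apply: th_powR_le; rewrite ler_wpM2r ?ler_nat.
Qed.

Lemma stops_rcons s k w i : 0 <= s -> s <= n%:R -> ~ stops s k w -> stops s k (rcons w i) ->
  (covnum L k (Tw (rcons w i)))%:R * th `^ (k%:R * s) <= phiw nrm T s w.
Proof.
move=> s0 sn nst st.
have [k0 _ e] := phi_eq_covnum n0 (Twg w) (Twg w).1 s0 sn; rewrite /phiw e.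
have le k' : (covnum L k' (Tw (rcons w i)))%:R * th `^ (k'%:R * s) <=
    (covnum L k' (Tw w))%:R * th `^ (k'%:R * s).
  rewrite ler_wpM2r ?powR_ge0 // ler_nat Tw_rcons; exact: covnum_mulr.
(* If the minimizing scale [k0] is at most [k], the stopping inequality of the child at [k0]
   suffices. *)
have [kk|/ltnW kk] := leqP k0 k; first exact: le_trans (st _ kk) (le k0).
apply: le_trans (le k) _.
(* Now [k <= k0]. Failure at [w] yields an increase before [k], after which log-convexity keeps the
   value at [k] below the one at [k0]. *)
have [k' kk' lt] : exists2 k', (k' < k)%N &
    (covnum L k' (Tw w))%:R * th `^ (k'%:R * s) < (covnum L k (Tw w))%:R * th `^ (k%:R * s).
  apply: contrapT => h; apply: nst => k' kk'; rewrite leNgt; apply/negP => lt.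
  apply: h; exists k' => //; rewrite ltn_neqAle kk' andbT.
  by apply/eqP => ek; move: lt; rewrite ek ltxx.
apply: (@log_convex_increasing
  (fun k => (covnum L k (Tw w))%:R * th `^ (k%:R * s)) k' k _ _ kk' lt k0 kk) => j.
  by rewrite mulr_gt0 ?powR_gt0 ?th_gt0 // ltr0n covnum_gt0.
rewrite [leRHS]mulrACA exprMn; set t := th `^ _; have -> : t ^+ 2 = t * t by [].
rewrite /t -!th_powRD.
have -> : j.+1%:R * s + j.+1%:R * s = j%:R * s + j.+2%:R * s.
  by rewrite -!mulrDl -!natrD; congr (_%:R * _); lia.
rewrite ler_wpM2r ?powR_ge0 // -natrX -natrM ler_nat.
exact: covnum_convex.
Qed.

Variables (b : 'M[F]_(n, M)) (K : set 'cV[F]_n).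
Hypothesis Ka : na_attractor nrm T b K.

Definition cylinder w := [set Tw w *m x + xw b w | x in K].

Lemma cylinder_split w : cylinder w `<=` \bigcup_(i in [set: 'I_M]) cylinder (rcons w i).
Proof.
move=> _ [x Kx <-]; case: Ka => _ [_ Ke]; move: Kx; rewrite {1}Ke => -[i _ [y Ky <-]].
exists i => //; exists y => //; rewrite Tw_rcons -cats1 xw_cat /= mulmx0 add0r.
by rewrite mulmxDr mulmxA -addrA [xw b w + _]addrC.
Qed.

Lemma cylinder_sub w : cylinder w `<=` K.
Proof.
elim: w => [|i w ih]; first by move=> _ [x Kx <-]; rewrite mul1mx addr0.
move=> _ [x Kx <-]; case: Ka => _ [_ ->]; exists i => //.
exists (Tw w *m x + xw b w); first by apply: ih; exists x.
by rewrite /= mulmxDr mulmxA addrA.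
Qed.

(** A stopped child costs at most [phi^s] of its unstopped parent, up to the scale factor, so an
    unstopped word is charged at most [M] times. [p] bounds the remaining generations: by
    [stops_small] the subdivision has ended at length [k + l]. *)
Lemma cylinder_cover s k l : 0 <= s -> s <= n%:R ->
  (forall x, K x -> small 0 (lf_pi L ^+ l *: x)) ->
  forall p w, (k + l <= size w + p)%N -> ~ stops s (k + l) w ->
  ball_cover L k (cylinder w) (M%:R * th `^ (- ((k + l)%:R * s)) *
    \sum_(j < p) wsum j (fun u => phiw nrm T s (w ++ u))).
Proof.
move=> s0 sn hl; elim=> [|p ih] w hp nst.
  by case: nst; apply: stops_small; rewrite // -(addn0 (size w)).
set c := th `^ _.
have c0 : 0 < c by rewrite powR_gt0 // th_gt0.
pose x i := c * (phiw nrm T s w + M%:R * \sum_(j < p) wsum j (fun u => phiw nrm T s (rcons w i ++ u))).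
have phi0 u : 0 <= phiw nrm T s u by apply/ltW/(phiw_gt0 n0 gT).
apply: (ball_coverW (@cylinder_split w) (x := \sum_i x i)).
  have -> : \sum_(j < p.+1) wsum j (fun u => phiw nrm T s (w ++ u)) = phiw nrm T s w +
      \sum_(i < M) \sum_(j < p) wsum j (fun u => phiw nrm T s (rcons w i ++ u)).
    rewrite big_ord_recl /= cats0 exchange_big; congr (_ + _); apply: eq_bigr => j _.
    by apply: eq_bigr => i _; apply: eq_wsum => u _; rewrite cat_rcons.
  rewrite /x -mulr_sumr big_split /= sumr_const card_ord -mulr_sumr -[_ *+ M]mulr_natl.
  by rewrite le_eqVlt (_ : _ == _) //; apply/eqP; ring.
apply: ball_cover_bigcup => i.
have [st|nsti] := pselect (stops s (k + l) (rcons w i)); last first.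
  apply: ball_coverW (ih (rcons w i) _ nsti) => //.
    by rewrite /x mulrDr mulrCA mulrA lerDr mulr_ge0 // ltW.
  by rewrite size_rcons addSnnS.
apply: ball_coverW (ball_cover_image (xw b (rcons w i)) k n0 (Twg (rcons w i)) hl) => //.
have := stops_rcons s0 sn nst st.
rewrite -ler_pdivlMr ?powR_gt0 ?th_gt0 // -powRN -/c mulrC => h.
apply: (le_trans h); rewrite /x ler_pM2l // lerDl mulr_ge0 //.
by apply: sumr_ge0 => j _; apply: wsum_ge0.
Qed.

Lemma attractor_cover_le_dimd d s : (0 < M)%N -> na_is_dimd nrm T d -> d < s -> s <= n%:R ->
  exists2 C, 0 < C & forall k, ball_cover L k K (C * th `^ (- (k%:R * s))).
Proof.
move=> M0 hd ds sn; have d0 : 0 <= d by case: hd.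
have s0 : 0 <= s := le_trans d0 (ltW ds).
have [l hl] := compact_bounded L Ka.2.1.
have [C hC] := sum_Zs_bounded n0 gT sT M0 hd ds.
have phi0 u : 0 <= phiw nrm T s u by apply/ltW/(phiw_gt0 n0 gT).
have C0 : 0 <= C by have := hC 0%N; rewrite big_ord0.
(* The summand 1 pays for the case where the empty word already stops; the power of [th] undoes the
   shift of scale by [l]. *)
exists ((M%:R * C + 1) * th `^ (- (l%:R * s))).
  by rewrite mulr_gt0 ?powR_gt0 ?th_gt0 // ltr_wpDl ?mulr_ge0.
move=> k; have cE : th `^ (- ((k + l)%:R * s)) = th `^ (- (l%:R * s)) * th `^ (- (k%:R * s)).
  by rewrite -th_powRD; congr (_ `^ _); rewrite natrD; ring.
have K0 : K `<=` cylinder [::] by move=> x Kx; exists x => //; rewrite mul1mx addr0.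
rewrite -mulrA -cE.
have [st|nst] := pselect (stops s (k + l) [::]).
  apply: ball_coverW (ball_cover_image (xw b [::]) k n0 (Twg [::]) hl) => //.
  have := st 0%N (leq0n _); rewrite mul0r powRr0 mulr1 [covnum L 0 _]covnum_small //; last exact: (Twg [::]).1.
  rewrite -ler_pdivlMr ?powR_gt0 ?th_gt0 // -powRN => h; apply: (le_trans h).
  by rewrite ler_wpM2r ?powR_ge0 // lerDr mulr_ge0.
apply: ball_coverW (cylinder_cover (p := (k + l)%N) s0 sn hl _ nst) => //.
rewrite mulrAC ler_wpM2r ?powR_ge0 //.
by apply: le_trans (ler_wpM2l (ler0n _ M) (hC (k + l)%N)) _; rewrite lerDl.
Qed.

Lemma attractor_cover_le_n :
  exists2 C, 0 < C & forall k, ball_cover L k K (C * th `^ (- (k%:R * n%:R))).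
Proof.
have [l hl] := compact_bounded L Ka.2.1.
exists (th `^ (- (l%:R * n%:R))); first by rewrite powR_gt0 ?th_gt0.
move=> k; have K0 : K `<=` cylinder [::] by move=> x Kx; exists x => //; rewrite mul1mx addr0.
apply: ball_coverW (ball_cover_image (xw b [::]) k n0 (Twg [::]) hl) => //.
have [j [_ -> _ _ _]] := good_exponents n0 (Twg [::]).
rewrite qX_powR -th_powRD; apply: th_powR_le.
rewrite -opprD lerN2 -mulrDl -natrD -natrM ler_nat [(l + k)%N]addnC.
apply: (@leq_trans (\sum_(i < n) (k + l))%N).
  by apply: leq_sum => i _; exact: leq_subr.
by rewrite sum_nat_const card_ord mulnC.
Qed.

End CylinderCover.

(** * Box and Hausdorff dimensions *)

Section Dimensions.
Variables (R : realType) (F : fieldType) (nrm : F -> R) (L : local_field nrm) (n : nat).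
Implicit Types E : set 'cV[F]_n.

Notation q := (lf_q L).
Notation th := (th L).
Notation small := (small L).

Lemma thX_scale (delta : R) : 0 < delta -> delta <= 1 ->
  exists k, th ^+ k <= delta /\ delta * th < th ^+ k.
Proof.
move=> d0 d1; have [k0 hk0] := thX_small L d0.
have ex : exists k, th ^+ k <= delta by exists k0; exact: ltW.
have kP := ex_minnP ex; case: kP => [[|k] hk kmin].
  exists 0%N; split=> //; rewrite expr0 in hk *.
  have -> : delta = 1 by apply/eqP; rewrite eq_le d1 hk.
  by rewrite mul1r th_lt1.
exists k.+1; split=> //; rewrite exprSr ltr_pM2r ?th_gt0 // ltNge.
by apply/negP => /kmin; rewrite ltnn.
Qed.

Lemma diam_le_ball (c : 'cV[F]_n) k delta : th ^+ k <= delta ->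
  na_diam_le nrm [set y | small k (y - c)] delta.
Proof.
move=> h x y /= hx hy; apply: le_trans h; apply/vnorm_small.
by apply: small_tri hx _; exact: smallBC.
Qed.

Lemma Ncover_le E k delta x : th ^+ k <= delta -> ball_cover L k E x ->
  exists2 N : nat, N%:R <= x & (na_Ncover nrm delta E <= N%:R%:E)%E.
Proof.
move=> hk [N [c [Nx hc]]]; exists N => //.
apply: ereal_inf_lbound; exists N => //=.
(* [na_Ncover] bounds the diameter of every [U j], so the sequence is continued by empty sets. *)
exists (fun j => if insub j is Some i then [set y | small k (y - c i)] else set0); split.
  by move=> y /hc [i hi]; exists (val i) => //=; rewrite valK.
by move=> j; case: insubP => [i _ _|_] //; exact: diam_le_ball.
Qed.

Lemma Ncover_ge1 E delta : E !=set0 -> (1 <= na_Ncover nrm delta E)%E.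
Proof.
move=> [x Ex]; apply/ereal_infP => _ [k [U [EU _]] <-].
have [j /= jk _] := EU x Ex; rewrite lee_fin ler1n; exact: leq_ltn_trans jk.
Qed.

Lemma boxratio_ge0 E delta : E !=set0 -> 0 < delta < 1 -> 0 <= na_boxratio nrm E delta.
Proof.
move=> E0 /andP[d0 d1]; rewrite /na_boxratio divr_ge0 //.
  have := Ncover_ge1 delta E0; case: (na_Ncover _ _ _) => [r| |] //=; rewrite ?lee_fin.
    exact: ln_ge0.
  (* An infinite covering number is sent to 0 by [fine], and [ln 0] is 0. *)
  by rewrite ln0.
by rewrite oppr_ge0 ltW // ln_lt0 // d0.
Qed.

Lemma ubox_le E s C : E !=set0 -> 0 <= s -> 0 < C ->
  (forall k, ball_cover L k E (C * th `^ (- (k%:R * s)))) -> (na_ubox nrm E <= s%:E)%E.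
Proof.
move=> E0 s0 C0 hC; apply/lee_addgt0Pr => e e0.
(* [A] bounds the constants left after taking logarithms, and [d0] is so small that
   [A <= e * - ln delta] for all [delta < d0]. *)
pose A := `|ln C - s * ln th| + 1.
have A0 : 0 < A by rewrite ltr_wpDl.
pose d0 := expR (- (A / e)).
have d0_gt0 : 0 < d0 := expR_gt0 _.
have d0_lt1 : d0 < 1 by rewrite expR_lt1 oppr_lt0 divr_gt0.
apply: ge_ereal_inf; exists (ereal_sup [set (na_boxratio nrm E delta)%:E
  | delta in [set delta : R | 0 < delta < d0]]); first by exists d0; rewrite //= d0_gt0.
apply: ge_ereal_sup => _ [delta /= /andP[de0 ded0] <-].
have de1 : delta < 1 := lt_trans ded0 d0_lt1.
have lnd : A / e <= - ln delta.
  by rewrite -[leLHS]opprK lerN2 -ler_expR lnK ?posrE // ltW.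
have lnd0 : 0 < - ln delta by rewrite (lt_le_trans _ lnd) // divr_gt0.
have [k [hk1 hk2]] := thX_scale de0 (ltW de1).
have [N Nle hN] := Ncover_le hk1 (hC k).
have := Ncover_ge1 delta E0; rewrite /na_boxratio.
move: hN; case: (na_Ncover _ _ _) => [r| |] //; rewrite !lee_fin /= => rN r1.
rewrite ler_pdivrMr //.
have r0 : 0 < r := lt_le_trans ltr01 r1.
have le1 : r <= C * (delta * th) `^ (- s).
  apply: le_trans rN (le_trans Nle _); rewrite ler_pM2l //.
  rewrite -mulrN powRrM -thX_powR !powRN lef_pV2 ?posrE ?powR_gt0 ?thX_gt0 ?mulr_gt0 ?th_gt0 //.
  by rewrite ge0_ler_powR ?nnegrE ?thX_ge0 ?mulr_ge0 ?th_ge0 // ltW.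
have : ln r <= ln C + - s * (ln delta + ln th).
  rewrite -lnM ?posrE ?th_gt0 // -ln_powR -lnM ?posrE ?powR_gt0 ?mulr_gt0 ?th_gt0 //.
  by rewrite ler_ln ?posrE ?mulr_gt0 ?powR_gt0 ?mulr_gt0 ?th_gt0.
move=> h; have hA : ln C - s * ln th <= A by rewrite /A (le_trans (ler_norm _)) // lerDl.
have : A <= e * - ln delta by rewrite mulrC -ler_pdivrMr.
nra.
Qed.

Lemma lbox_le_ubox E : (na_lbox nrm E <= na_ubox nrm E)%E.
Proof.
apply: ge_ereal_sup => _ [d0 /= /andP[d00 d01] <-].
apply: le_ereal_inf_tmp => _ [d1 /= /andP[d10 d11] <-].
have m0 : 0 < Num.min d0 d1 by rewrite lt_min d00.
have h : 0 < Num.min d0 d1 / 2 < Num.min d0 d1.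
  by rewrite divr_gt0 //= ltr_pdivrMr // ltr_pMr // ltr1n.
have /andP[h0 h1] := h; move: h1; rewrite lt_min => /andP[h1 h2].
apply: (@le_trans _ _ (na_boxratio nrm E (Num.min d0 d1 / 2))%:E).
  by apply: ereal_inf_lbound; exists (Num.min d0 d1 / 2); rewrite //= h0.
by apply: ereal_sup_ubound; exists (Num.min d0 d1 / 2); rewrite //= h0.
Qed.

(** The summand of [na_Hcontent]. Empty sets are set apart because their [na_diam] is 0 and
    [powR 0 0 = 1]. *)
Definition diam_term (s : R) (U : set 'cV[F]_n) : \bar R :=
  if `[< U !=set0 >] then (powR (na_diam nrm U) s)%:E else 0%E.

Lemma na_diam_ge0_le (U : set 'cV[F]_n) delta : U !=set0 -> na_diam_le nrm U delta ->
  0 <= na_diam nrm U <= delta.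
Proof.
move=> [x Ux] h; rewrite /na_diam; set S := [set r | _].
have ub : has_ubound S by exists delta => _ [a [b [Ua [Ub ->]]]]; exact: h.
have S0 : S 0 by exists x, x; rewrite subrr; split=> //; split=> //; apply/eqP;
  rewrite eq_le vnorm_ge0 /=; apply/vnorm_le => // i; rewrite mxE (nrm0 L).
rewrite ub_le_sup //=; apply: ge_sup; first by exists 0.
by move=> _ [a [b [Ua [Ub ->]]]]; exact: h.
Qed.

Lemma diam_ub (U : set 'cV[F]_n) delta x y : na_diam_le nrm U delta -> U x -> U y ->
  na_vnorm nrm (x - y) <= na_diam nrm U.
Proof.
move=> h Ux Uy; apply: ub_le_sup; last by exists x, y.
by exists delta => _ [a [b [Ua [Ub ->]]]]; exact: h.
Qed.

Lemma diam_term_ge0 s U : (0 <= diam_term s U)%E.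
Proof. by rewrite /diam_term; case: ifP => // _; rewrite lee_fin powR_ge0. Qed.

Lemma diam_term_le s U delta : 0 <= s -> 0 <= delta -> na_diam_le nrm U delta ->
  (diam_term s U <= (delta `^ s)%:E)%E.
Proof.
move=> s0 d0 h; rewrite /diam_term; case: asboolP => U0; last by rewrite lee_fin powR_ge0.
have /andP[h0 h1] := na_diam_ge0_le U0 h.
by rewrite lee_fin ge0_ler_powR // nnegrE.
Qed.

Lemma Hcontent_le E delta s k (U : nat -> set 'cV[F]_n) : 0 <= s -> 0 <= delta ->
  E `<=` \bigcup_(j in [set j | (j < k)%N]) U j -> (forall j, na_diam_le nrm (U j) delta) ->
  (na_Hcontent nrm delta s E <= (k%:R * delta `^ s)%:E)%E.
Proof.
move=> s0 d0 EU hU.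
pose V j := if (j < k)%N then U j else set0.
apply: ge_ereal_inf; exists (\sum_(0 <= j <oo) diam_term s (V j))%E.
  exists V => //=; split.
    by move=> x /EU [j /= jk Uj]; exists j; rewrite // /V jk.
  by move=> j; rewrite /V; case: ifP => // _.
have t0 j : (0 <= j)%N -> true -> (0 <= diam_term s (V j))%E by move=> *; exact: diam_term_ge0.
apply: lime_le; first exact: is_cvg_ereal_nneg_natsum_cond.
apply: nearW => N.
apply: (@le_trans _ _ (\sum_(0 <= j < N) (if (j < k)%N then (delta `^ s)%:E else 0))%E).
  apply: lee_sum => j _; rewrite /V; case: ifP => _; first exact: diam_term_le.
  by rewrite /diam_term asboolF // => -[].
rewrite (eq_bigr (fun j : nat => (if (j < k)%N then delta `^ s else 0)%:E)); last first.
  by move=> j _; case: ifP.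
rewrite sumEFin lee_fin.
by apply: sum_if_lt; exact: powR_ge0.
Qed.

(** A small scale [de] with box ratio below [r + e / 2] gives a cover by fewer than
    [2 de^(-(r + e/2))] sets, so the content of exponent [r + e] is at most [2 de^(e/2)]. *)
Lemma dimH_le_lbox E : E !=set0 -> (forall k, exists x, ball_cover L k E x) ->
  (na_dimH nrm E <= na_lbox nrm E)%E.
Proof.
move=> E0 hE.
have lb0 : (0 <= na_lbox nrm E)%E.
  apply: (@le_trans _ _ (ereal_inf [set (na_boxratio nrm E delta)%:E
                           | delta in [set delta : R | 0 < delta < 2^-1]])); last first.
    by apply: ereal_sup_ubound; exists 2^-1 => //=; rewrite invr_gt0 ltr0n invf_lt1 ?ltr1n.
  apply: le_ereal_inf_tmp => _ [d /= /andP[d0 d1] <-]; rewrite lee_fin boxratio_ge0 // d0 /=.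
  by rewrite (lt_trans d1) // invf_lt1 ?ltr1n.
move: lb0; case eb : (na_lbox nrm E) => [r| |] //; last by move=> _; rewrite leey.
rewrite lee_fin => r0; apply/lee_addgt0Pr => e e0.
apply: ereal_inf_lbound; exists (r + e) => //; split; first by rewrite addr_ge0 // ltW.
have re0 : 0 <= r + e by rewrite addr_ge0 // ltW.
apply/eqP; rewrite eq_le; apply/andP; split; last first.
  apply: le_ereal_sup_tmp; exists (na_Hcontent nrm 1 (r + e) E); first by exists 1 => //=.
  by apply: le_ereal_inf_tmp => _ [U _ <-]; apply: nneseries_ge0 => j _ _; exact: (diam_term_ge0 (r + e) (U j)).
apply: ge_ereal_sup => _ [d0 /= d00 <-].
apply/lee_addgt0Pr => eta eta0; rewrite add0e.
(* The solution of [2 d1^(e/2) = eta]. *)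
pose d1 := (eta / 2) `^ (2 / e).
have d1_gt0 : 0 < d1 by rewrite powR_gt0 // divr_gt0.
pose dm := Num.min (Num.min d0 d1) 2^-1.
have dm0 : 0 < dm by rewrite !lt_min d00 d1_gt0 invr_gt0 ltr0n.
have dm1 : dm < 1 by rewrite gt_min invf_lt1 ?ltr1n // orbT.
have : (ereal_inf [set (na_boxratio nrm E delta)%:E
                           | delta in [set delta : R | (0 < delta < dm)%R]] < (r + e / 2)%:E)%E.
  apply: (@le_lt_trans _ _ (na_lbox nrm E)); last by rewrite eb lte_fin ltrDl divr_gt0.
  by apply: ereal_sup_ubound; exists dm => //=; rewrite dm0.
move/ereal_inf_lt => [_ [de /= /andP[de0 dedm] <-]]; rewrite lte_fin.
have de1 : de < 1 := lt_trans dedm dm1.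
have lnd0 : 0 < - ln de by rewrite oppr_gt0 ln_lt0 // de0.
rewrite /na_boxratio ltr_pdivrMr // => hln.
(* A finite cover has to be exhibited: an infinite covering number would turn into 0 under [fine],
   and the bound on the ratio would say nothing. *)
have [k [hk _]] := thX_scale de0 (ltW de1); have [x hx] := hE k.
have [N _ hN] := Ncover_le hk hx.
have := Ncover_ge1 de E0; move: hN hln.
case eN : (na_Ncover nrm de E) => [y| |] //=; rewrite !lee_fin => _ hln y1.
have y0 : 0 < y := lt_le_trans ltr01 y1.
have hy : y < de `^ (- (r + e / 2)).
  by rewrite -ltr_ln ?posrE ?powR_gt0 // ln_powR mulNr -mulrN.
(* The covering number is an infimum; doubling it leaves room for an actual cover. *)
have : (na_Ncover nrm de E < (2 * y)%:E)%E by rewrite eN lte_fin; lra.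
move/ereal_inf_lt => [_ [k' [U [EU hU]] <-]]; rewrite lte_fin => hk'.
have ded0 : de <= d0.
  by apply/ltW/(lt_le_trans dedm); rewrite /dm !ge_min lexx.
have hU0 j : na_diam_le nrm (U j) d0 by move=> a b Ua Ub; apply: le_trans ded0; exact: (hU j).
have hmono : (na_Hcontent nrm d0 (r + e) E <= na_Hcontent nrm de (r + e) E)%E.
  apply: ereal_inf_le_tmp => _ [W [EW hW] <-]; exists W => //; split=> // j a b Wa Wb.
  by apply: le_trans ded0; exact: (hW j).
apply: (le_trans hmono); apply: (le_trans (Hcontent_le re0 (ltW de0) EU hU)).
rewrite lee_fin.
apply: (@le_trans _ _ (2 * de `^ (- (r + e / 2)) * de `^ (r + e))).
  by rewrite ler_wpM2r ?powR_ge0 // (le_trans (ltW hk')) // ler_pM2l // ltW.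
rewrite -mulrA -powRD; last by rewrite (gt_eqF de0) implybT.
have -> : - (r + e / 2) + (r + e) = e / 2 by lra.
rewrite mulrC -ler_pdivlMr //.
have -> : eta / 2 = d1 `^ (e / 2).
  rewrite /d1 -powRrM; have -> : 2 / e * (e / 2) = 1 by rewrite mulf_div [2 * e]mulrC divff // mulf_neq0 // gt_eqF.
  by rewrite powRr1 // divr_ge0 // ltW.
rewrite ge0_ler_powR ?nnegrE ?divr_ge0 ?(ltW e0) ?(ltW de0) ?(ltW d1_gt0) //.
by apply/ltW/(lt_le_trans dedm); rewrite /dm !ge_min lexx orbT.
Qed.

End Dimensions.

(** * Lower bounds for the Hausdorff dimension from finite ball covers *)

Section HausdorffLowerBound.
Variables (R : realType) (F : fieldType) (nrm : F -> R) (L : local_field nrm) (n : nat).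
Implicit Types E : set 'cV[F]_n.

Notation q := (lf_q L).
Notation th := (th L).
Notation small := (small L).

Lemma thX_diam (D : R) k1 : 0 < D -> D <= th ^+ k1 ->
  exists k, [/\ (k1 <= k)%N, D <= th ^+ k & th ^+ k.+1 <= D].
Proof.
move=> D0 Dk1; have [k' [h1 h2]] := thX_scale L D0 (le_trans Dk1 (thX_le1 L k1)).
have [k [hk hk']] : exists k, D <= th ^+ k /\ th ^+ k.+1 <= D.
  case: k' h1 h2 => [|k] h1 h2.
    exists 0%N; split; first by rewrite (le_trans Dk1) // thX_le1 // expr0.
    by rewrite (le_trans _ h1) // thX_leW.
  by exists k; split=> //; move: h2; rewrite exprSr ltr_pM2r ?th_gt0 // => /ltW.
have [kk|kk] := leqP k1 k; first by exists k.
exists k1; split=> //; apply: le_trans hk'; apply: thX_leW; lia.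
Qed.

Lemma th_powR_small (t e : R) k1 : 0 < t -> 0 < e -> exists2 k, (k1 <= k)%N & th `^ (k%:R * t) <= e.
Proof.
move=> t0 e0.
have [k hk] := thX_small L (powR_gt0 (t^-1) e0).
exists (maxn k1 k); first exact: leq_maxl.
rewrite powRrM -thX_powR.
have h : th ^+ maxn k1 k <= e `^ t^-1.
  by apply: le_trans (ltW hk); apply: thX_leW; exact: leq_maxr.
have -> : e = (e `^ t^-1) `^ t by rewrite -powRrM mulVf ?gt_eqF // powRr1 // ltW.
by rewrite ge0_ler_powR ?nnegrE ?thX_ge0 ?powR_ge0 // ltW.
Qed.

Lemma ball_open (c : 'cV[F]_n) k :
  na_mopen (fun x y => na_vnorm nrm (x - y)) [set y | small k (y - c)].
Proof.
move=> x hx; exists (th ^+ k); first exact: thX_gt0.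
move=> y /= /(small_open_dist (L := L)) h.
by apply: small_tri (smallBC h) hx.
Qed.

(** If [th^(k+1) <= diam U <= th^k], then [th^(k t)] is at most [th^(-t)] times [diam^t], and
    [diam^t <= diam^s]. Empty and one-point sets have no such [k]; a deep scale is used and charged
    to [e]. *)
Lemma enclosing_ball (U : set 'cV[F]_n) k1 s t e : 0 <= s -> s < t -> 0 < e ->
  na_diam_le nrm U (th ^+ k1) -> exists c k, [/\ (k1 <= k)%N, U `<=` [set y | small k (y - c)] &
    ((th `^ (k%:R * t))%:E <= (th `^ (- t))%:E * diam_term nrm s U + e%:E)%E].
Proof.
move=> s0 st e0 hU; have t0 : 0 < t := le_lt_trans s0 st.
have [k0 hk0 hke] := th_powR_small k1 t0 e0.
have diam0 V : ((th `^ (k0%:R * t))%:E <= (th `^ (- t))%:E * diam_term nrm s V + e%:E)%E.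
  apply: (@le_trans _ _ e%:E); first by rewrite lee_fin.
  by rewrite leeDr // mule_ge0 ?lee_fin ?powR_ge0 ?diam_term_ge0.
have [U0|U0] := pselect (U !=set0); last first.
  by exists 0, k0; split=> // x Ux; case: U0; exists x.
have [c Uc] := U0; have /andP[D0 Dk1] := na_diam_ge0_le L U0 hU.
have hD x : U x -> na_vnorm nrm (x - c) <= na_diam nrm U by move=> Ux; exact: diam_ub hU Ux Uc.
move: D0; rewrite le_eqVlt => /predU1P[D0|D0].
  exists c, k0; split=> // x /hD; rewrite -D0 => h; apply/vnorm_small.
  by rewrite (le_trans h) // thX_ge0.
have [k [kk1 Dk kD]] := thX_diam D0 Dk1.
exists c, k; split=> //.
  by move=> x /hD h; apply/vnorm_small; exact: le_trans Dk.
rewrite /diam_term asboolT // -EFinM -EFinD lee_fin.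
apply: (@le_trans _ _ (th `^ (- t) * na_diam nrm U `^ s)); last by rewrite lerDl ltW.
apply: (@le_trans _ _ (th `^ (- t) * na_diam nrm U `^ t)); last first.
  rewrite ler_pM2l ?powR_gt0 ?th_gt0 //; apply: ger_powR; last exact: ltW.
  by rewrite D0 (le_trans Dk1) // thX_le1.
have -> : th `^ (k%:R * t) = th `^ (- t) * th `^ (k.+1%:R * t).
  by rewrite -th_powRD; congr (_ `^ _); rewrite -natr1; ring.
rewrite ler_pM2l ?powR_gt0 ?th_gt0 // powRrM -thX_powR.
by rewrite ge0_ler_powR ?nnegrE ?thX_ge0 // ltW.
Qed.

(* Mass distribution principle in contrapositive form: a lower bound for all finite covers by
   balls suffices because balls are open and [E] is compact. *)
Lemma dimH_ge E t k1 c0 : na_mcompact (fun x y => na_vnorm nrm (x - y)) E -> 0 < c0 ->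
  (forall J (c : nat -> 'cV[F]_n) (k : nat -> nat), (forall j, (k1 <= k j)%N) ->
     E `<=` \bigcup_(j in [set j | (j < J)%N]) [set y | small (k j) (y - c j)] ->
     c0 <= \sum_(j < J) th `^ ((k j)%:R * t)) ->
  (t%:E <= na_dimH nrm E)%E.
Proof.
move=> Ec c0_gt0 hE; apply: le_ereal_inf_tmp => _ [s [s0 Hs] <-].
rewrite lee_fin leNgt; apply/negP => st.
(* Chosen so that [(th^(-t) + 1) eta = c0 / 2]: the diameters contribute at most [th^(-t) eta], the
   errors of the enclosing balls at most [eta]. *)
pose eta := c0 / (2 * (th `^ (- t) + 1)).
have den0 : 0 < th `^ (- t) + 1 by rewrite ltr_wpDl ?powR_ge0.
have eta0 : 0 < eta by rewrite divr_gt0 // mulr_gt0.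
have : (na_Hcontent nrm (th ^+ k1) s E < eta%:E)%E.
  apply: (@le_lt_trans _ _ (na_Hmeasure nrm s E)); last by rewrite Hs lte_fin.
  by apply: ereal_sup_ubound; exists (th ^+ k1) => //=; exact: thX_gt0.
move/ereal_inf_lt => [_ [U [EU hU] <-]] hsum.
have e0 j : 0 < eta / 2 * 2^-1 ^+ j by apply: mulr_gt0; [exact: divr_gt0|apply: exprn_gt0; rewrite invr_gt0].
have /choice[ck hck] : forall j, exists ck : 'cV[F]_n * nat, [/\ (k1 <= ck.2)%N,
    U j `<=` [set y | small ck.2 (y - ck.1)] &
    ((th `^ (ck.2%:R * t))%:E <= (th `^ (- t))%:E * diam_term nrm s (U j) + (eta / 2 * 2^-1 ^+ j)%:E)%E].
  move=> j; have [c [k h]] := enclosing_ball s0 st (e0 j) (hU j).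
  by exists (c, k).
pose B j := [set y | small (ck j).2 (y - (ck j).1)].
have Bopen V : range B V -> na_mopen (fun x y => na_vnorm nrm (x - y)) V.
  by move=> [j _ <-]; exact: ball_open.
have EB : E `<=` \bigcup_(V in range B) V.
  by move=> x /EU [j _ Ux]; exists (B j); [exists j|have [_ h _] := hck j; exact: h].
have [m [V [hV EV]]] := Ec _ Bopen EB.
have /choice[f hf] : forall i, exists j, (i < m)%N -> B j = V i.
  move=> i; have [im|im] := ltnP i m; last by exists 0%N.
  by have [j _ hj] := hV i im; exists j.
pose J := (\max_(i < m) f i).+1.
have EJ : E `<=` \bigcup_(j in [set j | (j < J)%N]) B j.
  move=> x /EV [i /= im]; rewrite -hf // => Bx; exists (f i) => //=.
  by rewrite ltnS; exact: (leq_bigmax (Ordinal im)).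
have := hE J (fun j => (ck j).1) (fun j => (ck j).2) (fun j => let: And3 h _ _ := hck j in h) EJ.
apply/negP; rewrite -ltNge -lte_fin -sumEFin.
apply: (@le_lt_trans _ _ (\sum_(j < J) ((th `^ (- t))%:E * diam_term nrm s (U j)
    + (eta / 2 * 2^-1 ^+ j)%:E))%E).
  by apply: lee_sum => j _; have [_ _] := hck j.
rewrite big_split /= -ge0_sume_distrr; last by move=> j _; exact: diam_term_ge0.
have h1 : (\sum_(j < J) diam_term nrm s (U j) <= eta%:E)%E.
  apply: le_trans (ltW hsum); rewrite -(big_mkord xpredT (fun j => diam_term nrm s (U j))).
  by apply: nneseries_lim_ge => j _ _; exact: diam_term_ge0.
have h2 : (\sum_(j < J) (eta / 2 * 2^-1 ^+ j)%:E <= eta%:E)%E.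
  rewrite sumEFin lee_fin -mulr_sumr.
  have := @sum_geometric R 2^-1 J; rewrite invr_ge0 ler0n invf_lt1 ?ltr1n // => /(_ isT isT) h.
  apply: le_trans (ler_wpM2l _ h) _; first by rewrite divr_ge0 // ltW.
  have -> : (1 - 2^-1)^-1 = 2 :> R by rewrite (_ : 1 - 2^-1 = 2^-1) ?invrK //; lra.
  by rewrite mulfVK.
apply: (@le_lt_trans _ _ ((th `^ (- t))%:E * eta%:E + eta%:E)%E).
  by apply: leeD => //; apply: lee_wpmul2l; rewrite ?lee_fin ?powR_ge0.
rewrite -EFinM -EFinD lte_fin -[X in _ + X]mul1r -mulrDl /eta.
have -> : (th `^ (- t) + 1) * (c0 / (2 * (th `^ (- t) + 1))) = c0 / 2.
  by field; rewrite gt_eqF.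
by rewrite gtr_pMr // invf_lt1 // ltr1n.
Qed.

End HausdorffLowerBound.

(** * A Frostman measure on the tree of words *)

Section Flow.
Variables (R : realType) (M : nat) (f : seq 'I_M -> R).
Hypotheses (M0 : (0 < M)%N) (f0 : forall w, 0 < f w) (f_nil : f [::] = 1).
Hypothesis f_cat : forall u v, f (u ++ v) <= f u * f v.
Hypothesis f_unbounded : forall C, ~ (forall r, wsum r f <= C).

(* Maximal flow through the first [N] generations below [w] when the capacity of each
   vertex [u] is [f u]. *)
Fixpoint maxflow (N : nat) (w : seq 'I_M) : R :=
  if N is N'.+1 then Num.min (f w) (\sum_(i < M) maxflow N' (rcons w i)) else f w.

Lemma maxflow_ge0 N w : 0 <= maxflow N w.
Proof.
elim: N w => [|N ih] w /=; first exact: ltW.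
by rewrite le_min ltW //= sumr_ge0.
Qed.

Lemma maxflow_le N w : maxflow N w <= f w.
Proof. by case: N => [|N] //=; rewrite ge_min lexx. Qed.

Lemma maxflow_decr N w : maxflow N.+1 w <= maxflow N w.
Proof.
elim: N w => [|N ih] w; first exact: maxflow_le.
rewrite /= le_min ge_min lexx /= ge_min; apply/orP; right.
by apply: ler_sum => i _; exact: ih.
Qed.

Lemma wsum_gt0 r : 0 < wsum r f.
Proof.
move: f f0; elim: r => [|r ih] g g0 //=.
rewrite (bigD1 (Ordinal M0)) //= ltr_wpDr ?ih //.
by apply: sumr_ge0 => i _; apply: wsum_ge0 => w; apply/ltW.
Qed.

(** The minima taken in [maxflow] select a cut within [N] generations. Below a cut vertex at depth
    [a] submultiplicativity leaves the sum over words of length [r - a], which is at most [C]. *)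
Lemma wsum_le_maxflow N r w C : (N <= r)%N ->
  (forall j, (r - N <= j <= r)%N -> wsum j f <= C) ->
  wsum r (fun u => f (w ++ u)) <= maxflow N w * C.
Proof.
have base r' w' : (forall j, (r' - r' <= j <= r')%N -> True) -> wsum r' f <= C ->
    wsum r' (fun u => f (w' ++ u)) <= f w' * C.
  move=> _ hC; apply: (@le_trans _ _ (f w' * wsum r' f)).
    by rewrite [leRHS]mulrC -wsumMr; apply: ler_wsum => u _; rewrite mulrC f_cat.
  by rewrite ler_pM2l.
elim: N r w => [|N ih] r w Nr hC /=; first by apply: base => //; apply: hC; rewrite subn0 leqnn.
case: (leP (f w) _) => _; first by apply: base => //; apply: hC; rewrite leq_subr leqnn.
case: r Nr hC => // r Nr hC /=; rewrite mulr_suml; apply: ler_sum => i _.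
rewrite (eq_wsum (g := fun u => f (rcons w i ++ u))); last by move=> u _; rewrite cat_rcons.
by apply: ih => // j /andP[h1 h2]; apply: hC; rewrite subSS h1 leqW.
Qed.

(* A cut of total capacity less than 1 could be iterated by submultiplicativity, which would
   keep the sums [wsum r f] bounded. *)
Lemma maxflow_nil N : maxflow N [::] = 1.
Proof.
apply/eqP; rewrite eq_le -{1}f_nil maxflow_le /= leNgt; apply/negP => lt1.
apply: (@f_unbounded (\sum_(j < N.+1) wsum j f)) => r.
set C := \sum_(j < _) _.
have C0 : 0 <= C by apply: sumr_ge0 => j _; apply/ltW/wsum_gt0.
elim/ltn_ind: r => r ih; have [rN|Nr] := leqP r N.
  rewrite /C (bigD1 (Ordinal (rN : r < N.+1)%N)) //= lerDl.
  by apply: sumr_ge0 => j _; apply/ltW/wsum_gt0.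
rewrite leNgt; apply/negP => Cr.
(* Shorter words have sums at most [C], so [wsum r f] dominates every [wsum j f] with [j <= r] and
   serves as the constant itself. *)
have : wsum r f <= maxflow N [::] * wsum r f.
  apply: (@wsum_le_maxflow N r [::]) => [|j /andP[_]]; first exact: ltnW.
  rewrite leq_eqVlt => /predU1P[->//|/ih h]; exact: le_trans (ltW Cr).
by rewrite leNgt gtr_pMl ?wsum_gt0 // lt1.
Qed.

Definition limflow (w : seq 'I_M) : R := limn (maxflow ^~ w).

Lemma maxflow_cvg w : maxflow ^~ w @ \oo --> limflow w.
Proof.
apply: nonincreasing_is_cvgn; first by apply/nonincreasing_seqP => N; exact: maxflow_decr.
by exists 0 => _ [N _ <-]; exact: maxflow_ge0.
Qed.

Lemma limflow_ge0 w : 0 <= limflow w.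
Proof. by apply: limr_ge; [exact: maxflow_cvg|apply: nearW => N; exact: maxflow_ge0]. Qed.

Lemma limflow_le w : limflow w <= f w.
Proof. by apply: limr_le; [exact: maxflow_cvg|apply: nearW => N; exact: maxflow_le]. Qed.

Lemma limflow_nil : limflow [::] = 1.
Proof.
rewrite /limflow (_ : maxflow ^~ [::] = fun=> 1) ?lim_cst //.
by apply/funext => N; exact: maxflow_nil.
Qed.

Lemma limflow_sum w : limflow w <= \sum_(i < M) limflow (rcons w i).
Proof.
have h : (fun N => \sum_(i < M) maxflow N (rcons w i)) @ \oo --> \sum_(i < M) limflow (rcons w i).
  elim: (index_enum _) => [|i s ih].
    by rewrite big_nil; under eq_fun do rewrite big_nil; exact: cvg_cst.
  rewrite big_cons; under eq_fun do rewrite big_cons.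
  by apply: cvgD => //; exact: maxflow_cvg.
have h' : (fun N => maxflow N.+1 w) @ \oo --> limflow w.
  by rewrite (cvg_shiftS (maxflow ^~ w)); exact: maxflow_cvg.
rewrite -(cvg_lim _ h) // -(cvg_lim _ h') //.
apply: ler_lim; [by apply: cvgP h'|by apply: cvgP h|].
by apply: nearW => N /=; rewrite ge_min lexx orbT.
Qed.

(** [limflow] may increase when summed over children, so the flow is split among them in proportion
    to [limflow]. The word is reversed because a child appends a letter at the end. *)
Fixpoint rev_flow (u : seq 'I_M) : R :=
  if u is i :: u' then
    rev_flow u' * (limflow (rcons (rev u') i) / \sum_(j < M) limflow (rcons (rev u') j))
  else 1.

Definition flow (w : seq 'I_M) := rev_flow (rev w).

Lemma flow_rcons w i : flow (rcons w i) =
  flow w * (limflow (rcons w i) / \sum_(j < M) limflow (rcons w j)).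
Proof. by rewrite /flow rev_rcons /= revK. Qed.

Lemma sum_limflow_ge0 w : 0 <= \sum_(j < M) limflow (rcons w j).
Proof. by apply: sumr_ge0 => j _; exact: limflow_ge0. Qed.

Lemma flow_ge0 w : 0 <= flow w.
Proof.
elim/last_ind: w => [|w i ih]; first exact: ler01.
by rewrite flow_rcons mulr_ge0 // divr_ge0 ?limflow_ge0 ?sum_limflow_ge0.
Qed.

Lemma flow_le_limflow w : flow w <= limflow w.
Proof.
elim/last_ind: w => [|w i ih]; first by rewrite limflow_nil.
rewrite flow_rcons; set S := \sum_(j < M) _.
have [S0|S0] := eqVneq S 0; first by rewrite S0 invr0 !mulr0 limflow_ge0.
have Sp : 0 < S by rewrite lt_def S0 sum_limflow_ge0.
rewrite mulrA ler_pdivrMr // mulrC ler_wpM2l ?limflow_ge0 //.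
exact: le_trans ih (limflow_sum w).
Qed.

Lemma sum_flow w : \sum_(i < M) flow (rcons w i) = flow w.
Proof.
under eq_bigr do rewrite flow_rcons.
rewrite -mulr_sumr -mulr_suml; set S := \sum_(j < M) _.
(* If [limflow] vanishes at all children, the quotients are 0, and so is [flow w], being at most
   [limflow w <= S]. *)
have [S0|S0] := eqVneq S 0; last by rewrite divff // mulr1.
rewrite S0 mul0r mulr0; apply/eqP; rewrite eq_le flow_ge0 /=.
by rewrite -S0 (le_trans (flow_le_limflow w)) // limflow_sum.
Qed.

Lemma unit_flow_exists : exists nu : seq 'I_M -> R, [/\ nu [::] = 1, forall w, 0 <= nu w,
  forall w, nu w <= f w & forall w, \sum_(i < M) nu (rcons w i) = nu w].
Proof.
exists flow; split=> // [w|w|w]; [exact: flow_ge0| |exact: sum_flow].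
exact: le_trans (flow_le_limflow w) (limflow_le w).
Qed.

End Flow.

(** * The energy estimate *)

Section Energy.
Variables (R : realType) (F : fieldType) (nrm : F -> R) (L : local_field nrm).
Variables (n M : nat) (T : 'I_M -> 'M[F]_n).

Notation q := (lf_q L).
Notation th := (th L).
Notation small := (small L).
Notation Tw := (Tw T).
Notation xw := (xw T).

Hypotheses (n0 : (0 < n)%N) (gT : forall i, good L (T i)) (sT : forall i, small 1 (T i)).

Lemma xwD b b' w : xw (b + b') w = xw b w + xw b' w.
Proof.
elim: w => [|i w ih] /=; first by rewrite addr0.
by rewrite ih mulmxDr linearD /= addrACA.
Qed.

Lemma xwZ a b w : xw (a *: b) w = a *: xw b w.
Proof.
elim: w => [|i w ih] /=; first by rewrite scaler0.
by rewrite ih -scalemxAr linearZ /= scalerDr.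
Qed.

Lemma xwN b w : xw (- b) w = - xw b w.
Proof. by rewrite -scaleN1r xwZ scaleN1r. Qed.

Lemma xwB b b' w : xw (b - b') w = xw b w - xw b' w.
Proof. by rewrite xwD xwN. Qed.

Lemma xw_small k b w : small k b -> small k (xw b w).
Proof.
move=> hb; elim: w => [|i w ih] /=; first exact: small0.
by apply: smallD; [apply: smallMl => //; exact: (gT i).1|exact: small_col].
Qed.

Definition branch (i : 'I_M) (u : seq 'I_M) (j : 'I_M) (v : seq 'I_M) (b : 'M[F]_(n, M)) :=
  xw b (i :: u) - xw b (j :: v).

Lemma xw_branch b w i u j v :
  xw b (w ++ i :: u) - xw b (w ++ j :: v) = Tw w *m branch i u j v b.
Proof. by rewrite !xw_cat opprD addrACA subrr add0r -mulmxBr. Qed.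

Lemma branchD i u j v b b' : branch i u j v (b + b') = branch i u j v b + branch i u j v b'.
Proof. by rewrite /branch !xwD opprD addrACA. Qed.

Definition in_col (i : 'I_M) (x : 'cV[F]_n) : 'M[F]_(n, M) := \matrix_(a, c) (x a 0 *+ (c == i)).

Lemma in_colB i x y : in_col i (x - y) = in_col i x - in_col i y.
Proof. by apply/matrixP => a c; rewrite !mxE mulrnBl. Qed.

Lemma in_col_small k i x : small k x -> small k (in_col i x).
Proof.
move=> hx a c; rewrite mxE; case: (c == i); rewrite ?mulr1n ?mulr0n //.
by rewrite (nrm0 L) thX_ge0.
Qed.

(** Since [i <> j], only the first letter of [i :: u] adds [x] undamped; every other occurrence of
    column [i] passes through some [T] and gains a factor [pi]. *)
Lemma branch_in_col k i u j v x : i != j -> small k x ->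
  small k.+1 (branch i u j v (in_col i x) - x).
Proof.
move=> ij hx; rewrite /branch /=.
have -> : col i (in_col i x) = x by apply/matrixP => a c; rewrite !mxE eqxx ord1.
have -> : col j (in_col i x) = 0.
  by apply/matrixP => a c; rewrite !mxE eq_sym (negbTE ij).
rewrite addr0 addrAC addrK -[k.+1]add1n.
by apply: smallB; apply: smallM => //; apply: xw_small; exact: in_col_small.
Qed.

(* Fixed-point iteration: [x |-> branch (in_col i x)] is a contractive perturbation of [id]. *)
Lemma branch_surj k i u j v y : i != j -> small 0 y ->
  exists2 b, small 0 b & small k (branch i u j v b - y).
Proof.
move=> ij hy.
suff [x hx h] : exists2 x, small 0 x & small k (branch i u j v (in_col i x) - y).
  by exists (in_col i x) => //; exact: in_col_small.
elim: k => [|k [x hx h]].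
  exists 0; first exact: small0.
  apply: smallB => //; apply: smallB; apply: xw_small; apply: in_col_small; exact: small0.
set r := branch _ _ _ _ _ - y in h.
exists (x - r); first by apply: smallB => //; exact: smallW h.
have -> : branch i u j v (in_col i (x - r)) - y = r - branch i u j v (in_col i r).
  rewrite in_colB branchD /r addrAC; congr (_ + _).
  by rewrite /branch !xwN opprK opprB addrC.
by apply: smallBC; exact: branch_in_col.
Qed.

(** Integral translations modulo [pi^k], coded as in [rep]: the finite probability space that
    represents Haar measure at scale [k]. *)
Definition residues k := {ffun 'I_n * 'I_M -> 'I_(q ^ k)}.
Definition residue_mx k (be : residues k) : 'M[F]_(n, M) := \matrix_(i, j) rep L k (be (i, j)).

Lemma residue_mx_small k (be : residues k) : small 0 (residue_mx be).
Proof. by move=> i j; rewrite mxE expr0 rep_le1. Qed.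

Lemma residue_exists k b : small 0 b -> exists be : residues k, small k (b - residue_mx be).
Proof.
move=> hb; have /choice[f hf] : forall ij : 'I_n * 'I_M, exists a : 'I_(q ^ k),
    nrm (b ij.1 ij.2 - rep L k a) <= th ^+ k.
  move=> ij; have [a ha h] := rep_surj L k (hb ij.1 ij.2).
  by exists (Ordinal ha).
by exists [ffun ij => f ij] => i j; rewrite !mxE ffunE; exact: (hf (i, j)).
Qed.

Lemma residue_inj k (be be' : residues k) : small k (residue_mx be - residue_mx be') -> be = be'.
Proof.
move=> h; apply/ffunP => -[i j]; apply/val_inj/(rep_inj (L := L) (k := k)); try exact: ltn_ord.
by have := h i j; rewrite !mxE.
Qed.

Definition collide k (u v : seq 'I_M) (b : 'M[F]_(n, M)) : bool := `[< small k (xw b u - xw b v) >].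

Definition ncollide k u v : nat := #|[set be : residues k | collide k u v (residue_mx be)]%SET|.

(** Shift each colliding residue by translations [b a] whose branch is [z a] modulo [pi^k], where
    [z] is a family separated by [T_w]. For the shifted residue [T_w] maps the branch to [T_w z_a],
    which reveals [a] and then the original residue: an injection into all residues. *)
Lemma ncollide_branch k w i u j v : i != j ->
  (ncollide k (w ++ i :: u) (w ++ j :: v) * covnum L k (Tw w) <= #|{: residues k}|)%N.
Proof.
move=> ij; have [_ [z [z0 zsep]]] := covnumP n0 k (Tw_good gT w).
have /choice[b hb] : forall a, exists b, small 0 b /\ small k (branch i u j v b - z a).
  by move=> a; have [b h1 h2] := branch_surj k u v ij (z0 a); exists b.
pose c (p : residues k * 'I_(covnum L k (Tw w))) := residue_mx p.1 + b p.2.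
have c0 p : small 0 (c p) by apply: smallD; [exact: residue_mx_small|case: (hb p.2)].
have /choice[g hg] : forall p, exists be : residues k, small k (c p - residue_mx be).
  by move=> p; exact: residue_exists.
rewrite /ncollide; set S := [set be | _]%SET.
have -> : (#|S| * covnum L k (Tw w))%N = #|finset.setX S [set: 'I_(covnum L k (Tw w))]%SET|.
  by rewrite cardsX cardsT card_ord.
rewrite -(card_in_imset (f := g)); first exact: max_card.
move=> [be a] [be' a'] /setXP[/= + _] /setXP[/= + _] e.
rewrite !inE /collide !xw_branch => hbe hbe'.
have hc : small k (c (be, a) - c (be', a')).
  by apply: small_tri (hg _) _; rewrite e; apply: smallBC; exact: hg.
have hz p : small k (branch i u j v (residue_mx p.1) + z p.2 - branch i u j v (c p)).
  by rewrite /c branchD opprD addrACA subrr add0r; apply: smallBC; case: (hb p.2).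
have hcz : small k (branch i u j v (c (be, a)) - branch i u j v (c (be', a'))).
  have -> : branch i u j v (c (be, a)) - branch i u j v (c (be', a')) =
     branch i u j v (c (be, a) - c (be', a')).
    rewrite branchD; congr (_ + _); rewrite /branch !xwN opprK.
    by rewrite opprB addrC.
  by apply: smallB; exact: xw_small.
have aa' : a = a'.
  apply: zsep; have := small_tri (hz (be, a)) (small_tri hcz (smallBC (hz (be', a')))).
  move=> /= /(smallMl (Tw_good gT w).1); rewrite opprD addrACA mulmxDr mulmxBr => h.
  have := smallB h (smallB hbe hbe'); by rewrite addrAC subrr add0r.
congr (_, _) => //; apply: residue_inj.
by move: hc; rewrite /c /= aa' opprD addrACA subrr addr0.
Qed.

Lemma wsum_flow (nu : seq 'I_M -> R) r w : (forall w, \sum_(i < M) nu (rcons w i) = nu w) ->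
  wsum r (fun u => nu (w ++ u)) = nu w.
Proof.
move=> hnu; elim: r w => [|r ih] w /=; first by rewrite cats0.
rewrite -hnu; apply: eq_bigr => i _; rewrite -ih.
by apply: eq_wsum => u _; rewrite cat_rcons.
Qed.

Variables (s : R) (nu : seq 'I_M -> R).
Hypotheses (s0 : 0 <= s) (sn : s <= n%:R).
Hypotheses (nu1 : nu [::] = 1) (nu0 : forall w, 0 <= nu w) (nu_phi : forall w, nu w <= phiw nrm T s w).
Hypothesis nu_sum : forall w, \sum_(i < M) nu (rcons w i) = nu w.

(** Length [k] suffices: for integral [b] a longer word projects into the same ball of radius [th^k]
    as its prefix, see [mass_take]. *)
Definition mass k (c : 'cV[F]_n) b : R :=
  wsum k (fun v => nu v * (`[< small k (xw b v - c) >])%:R).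

Definition energy k b : R := wsum k (fun u => nu u * mass k (xw b u) b).

Notation Bk k := (#|{: residues k}|%:R : R).

Lemma nu_covnum k w : nu w <= (covnum L k (Tw w))%:R * th `^ (k%:R * s).
Proof. exact: le_trans (nu_phi w) (phi_le_covnum n0 k (Tw_good gT w) s0 sn). Qed.

(* Words that separate right after the prefix [w] collide for at most one residue in
   [covnum k (Tw w)], and [nu w <= covnum k (Tw w) * th^(k s)]. *)
Lemma pair_sum_bound k r w : (size w + r)%N = k ->
  wsum r (fun u => wsum r (fun v => nu (w ++ u) * (nu (w ++ v) * (ncollide k (w ++ u) (w ++ v))%:R)))
  <= nu w * r.+1%:R * Bk k * th `^ (k%:R * s).
Proof.
elim: r w => [|r ih] w hk.
  rewrite /= !cats0 mulr1 -[leRHS]mulrA.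
  apply: ler_wpM2l => //; rewrite [leRHS]mulrC; apply: ler_pM => //; rewrite ?ler_nat ?max_card //.
  have := nu_covnum k w; rewrite covnum_small ?mul1r //; first exact: Tw_good.
  rewrite -hk addn0; exact: Tw_small.
have N0 : (0 : R) < (covnum L k (Tw w))%:R by rewrite ltr0n covnum_gt0 //; exact: Tw_good.
pose N : R := (covnum L k (Tw w))%:R.
rewrite /=.
pose A := r.+1%:R * Bk k * th `^ (k%:R * s).
have A0 : 0 <= A by rewrite !mulr_ge0 ?powR_ge0.
have BN0 : 0 <= Bk k / N by rewrite divr_ge0.
apply: (@le_trans _ _ (\sum_(i < M) \sum_(j < M) (nu (rcons w i) * A *+ (j == i)
    + nu (rcons w i) * (nu (rcons w j) * (Bk k / N))))).
  apply: ler_sum => i _.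
  rewrite (eq_wsum (g := fun u => \sum_(j < M) wsum r (fun v => nu (rcons w i ++ u) *
     (nu (rcons w j ++ v) * (ncollide k (rcons w i ++ u) (rcons w j ++ v))%:R)))); last first.
    move=> u _; apply: eq_bigr => j _; apply: eq_wsum => v _; by rewrite !cat_rcons.
  rewrite wsum_sum; apply: ler_sum => j _.
  have [->|ij] := eqVneq j i.
    rewrite mulr1n; apply: ler_wpDr; first by apply: mulr_ge0 => //; apply: mulr_ge0.
    rewrite /A 2!mulrA; apply: ih; by rewrite size_rcons addSnnS.
  rewrite mulr0n add0r.
  rewrite -(wsum_flow r (rcons w i) nu_sum) -(wsum_flow r (rcons w j) nu_sum) -!wsumMr.
  apply: ler_wsum => u _; rewrite [leRHS]mulrC -wsumMr; apply: ler_wsum => v _.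
  rewrite [leRHS]mulrC ler_wpM2l // ler_wpM2l // ler_pdivlMr // -natrM ler_nat !cat_rcons.
  by apply: ncollide_branch; rewrite eq_sym.
rewrite (eq_bigr (fun i => nu (rcons w i) * (A + nu w * (Bk k / N)))); last first.
  move=> i _; rewrite big_split /= -mulr_sumr -mulr_suml nu_sum mulrDr; congr (_ + _).
  rewrite (bigD1 i) //= eqxx mulr1n big1 ?addr0 // => j ji.
  by rewrite (negbTE ji).
rewrite -mulr_suml nu_sum.
have -> : nu w * r.+2%:R * Bk k * th `^ (k%:R * s) = nu w * (A + Bk k * th `^ (k%:R * s)).
  by rewrite /A -[r.+2%:R]natr1; ring.
rewrite ler_wpM2l // lerD2l mulrCA ler_wpM2l // ler_pdivrMr // mulrC; exact: nu_covnum.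
Qed.

Lemma sum_energy k : \sum_(be : residues k) energy k (residue_mx be) <=
  k.+1%:R * Bk k * th `^ (k%:R * s).
Proof.
have := @pair_sum_bound k k [::] (add0n k); rewrite nu1 mul1r; apply: le_trans.
rewrite /energy -wsum_sum; apply: ler_wsum => u _.
rewrite -mulr_sumr /mass -wsum_sum mulrC -wsumMr; apply: ler_wsum => v _.
rewrite mulrC ler_wpM2l // -mulr_sumr ler_wpM2l // /ncollide.
rewrite -sum1_card natr_sum [leRHS]big_mkcond /=; apply: ler_sum => be _.
rewrite inE /collide; case: (asboolP (small k (xw _ v - _))) => h.
  by rewrite asboolT //; exact: smallBC.
by case: ifP.
Qed.

Lemma mass_ge0 k c b : 0 <= mass k c b.
Proof. by apply: wsum_ge0 => v; rewrite mulr_ge0. Qed.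

Lemma energy_ge0 k b : 0 <= energy k b.
Proof. by apply: wsum_ge0 => v; rewrite mulr_ge0 ?mass_ge0. Qed.

Lemma energy_residue k b b' : small k (b - b') -> energy k b = energy k b'.
Proof.
move=> hb; apply: eq_wsum => u _; congr (_ * _); apply: eq_wsum => v _; congr (_ * _).
congr ((nat_of_bool _)%:R); have h w : small k (xw b w - xw b' w).
  by rewrite -xwB; exact: xw_small.
apply: asbool_equiv_eq; split=> hs.
  exact: small_tri (smallBC (h v)) (small_tri hs (h u)).
exact: small_tri (h v) (small_tri hs (smallBC (h u))).
Qed.

Definition bad_residues (t : R) k : {set residues k} :=
  [set be : residues k | th `^ (k%:R * t) < energy k (residue_mx be)]%SET.

(** Markov's inequality for the uniform distribution on residues. *)
Lemma card_bad_residues t k : #|bad_residues t k|%:R <=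
  k.+1%:R * Bk k * th `^ (k%:R * (s - t)).
Proof.
have p0 : 0 < th `^ (k%:R * t) by rewrite powR_gt0 ?th_gt0.
rewrite mulrBr powRD ?(gt_eqF (th_gt0 L)) ?implybT // powRN mulrA ler_pdivlMr //.
apply: le_trans (sum_energy k).
rewrite -sum1_card natr_sum mulr_suml [leLHS]big_mkcond /=; apply: ler_sum => be _.
by rewrite inE; case: ifP => [/ltW|_]; rewrite ?mul1r ?energy_ge0.
Qed.

End Energy.

(** * Null sets of translations *)

Section Haar.
Variables (R : realType) (F : fieldType) (nrm : F -> R) (L : local_field nrm).
Variables (mu : set F -> \bar R) (Hmu : na_is_haar nrm mu).

Notation q := (lf_q L).
Notation pi := (lf_pi L).
Notation th := (th L).

Lemma borel_open (U : set F) : na_mopen (na_distF nrm) U -> na_borelF nrm U.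
Proof. by move=> hU S _ _ _ h; exact: h. Qed.

(** The radius is the norm of a field element, so shrinking it by the factor [q] is multiplication
    of [c] by [pi]. *)
Definition dball (c r : F) : set F := [set x | nrm (x - r) <= nrm c].

Lemma dball_borel c r : c != 0 -> na_borelF nrm (dball c r).
Proof.
move=> c0; apply: borel_open => x hx; exists (nrm c); first exact: (nrm_gt0 L).
move=> y /=; rewrite /na_distF /dball /= => h.
have -> : y - r = (x - r) - (x - y) by ring.
by apply: (nrmB L) => //; exact: ltW.
Qed.

Lemma borel0 : na_borelF nrm set0.
Proof. by move=> S h _ _ _. Qed.

Lemma mu_dball_center c r : c != 0 -> mu (dball c r) = mu (dball c 0).
Proof.
move=> c0; have [_ [_ [_ [htr _]]]] := Hmu.
rewrite -(htr r (dball c 0)); last exact: dball_borel.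
congr (mu _); apply/seteqP; split => x /=.
  move=> hx; exists (x - r); last by rewrite addrC subrK.
  by rewrite /dball /= subr0.
by move=> [y + <-]; rewrite /dball /= subr0 addrC addKr.
Qed.

(** One translate of the smaller ball for each residue class of [x / c]. *)
Lemma mu_dball_split c : c != 0 -> mu (dball c 0) = (q%:R%:E * mu (dball (pi * c) 0))%E.
Proof.
move=> c0; have pc0 : pi * c != 0 by rewrite mulf_neq0 // pi_neq0.
have [mu0 [_ [hadd _]]] := Hmu.
pose B j := if insub j is Some i then dball (pi * c) (c * lf_res L i) else set0.
have Bb j : na_borelF nrm (B j).
  by rewrite /B; case: insubP => [i _ _|_]; [exact: dball_borel|exact: borel0].
have resE x i : nrm (x - c * lf_res L i) <= nrm (pi * c) -> nrm (x / c - lf_res L i) < 1.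
  move=> h; have -> : x / c - lf_res L i = (x - c * lf_res L i) / c by field.
  rewrite (nrmM L) (nrmV L) ltr_pdivrMr ?(nrm_gt0 L) // mul1r (le_lt_trans h) //.
  by rewrite (nrmM L) nrm_pi gtr_pMl ?th_lt1 // (nrm_gt0 L).
have uB : \bigcup_j B j = dball c 0.
  apply/seteqP; split => x.
    move=> [j _]; rewrite /B; case: insubP => // i _ _ /= h; rewrite /dball /= subr0.
    rewrite -(subrK (c * lf_res L i) x); apply: (nrmD L).
      by apply: le_trans h _; rewrite (nrmM L) nrm_pi ler_piMl ?(nrm_ge0 L) // th_le1.
    by rewrite (nrmM L) ler_piMr ?(nrm_ge0 L) // lf_res1.
  rewrite /dball /= subr0 => hx.
  have hxc : nrm (x / c) <= 1.
    by rewrite (nrmM L) (nrmV L) ler_pdivrMr ?(nrm_gt0 L) // mul1r.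
  have [i [/= hi _]] := lf_resP L hxc; exists (val i) => //; rewrite /B valK /dball /=.
  have -> : x - c * lf_res L i = c * (x / c - lf_res L i) by field.
  by rewrite !(nrmM L) nrm_pi mulrC ler_pM2r ?(nrm_gt0 L) //; exact: nrm_lt1.
have dB i j : i <> j -> B i `&` B j = set0.
  move=> ij; apply/seteqP; split => // x []; rewrite /B.
  case: insubP => // i' _ ei; case: insubP => // j' _ ej; rewrite /dball /= => hi hj.
  have hxc : nrm (x / c) <= 1.
    have := resE x i' hi => h; rewrite -(subrK (lf_res L i') (x / c)).
    by apply: (nrmD L); [exact: ltW|exact: lf_res1].
  have [k [_ u]] := lf_resP L hxc.
  by apply: ij; rewrite -ei -ej -(u i' (resE _ _ hi)) -(u j' (resE _ _ hj)).
have := hadd B Bb dB; rewrite uB => hc.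
have : (fun N => (\sum_(i < N) mu (B i))%E) @ \oo --> (q%:R%:E * mu (dball (pi * c) 0))%E.
  apply: cvg_near_cst; exists q => // N /= qN.
  rewrite -(subnKC qN) big_split_ord /= [X in (_ + X)%E]big1 ?adde0; last first.
    move=> i _; rewrite /B; case: insubP => //= i' + _; by rewrite ltnNge leq_addr.
  rewrite (eq_bigr (fun=> mu (dball (pi * c) 0))); last first.
    by move=> i _; rewrite /B valK mu_dball_center.
  elim: (q) => [|m ih]; first by rewrite big_ord0 mul0e.
  by rewrite big_ord_recr /= ih -[X in (_ + X)%E]mul1e -ge0_muleDl ?lee_fin // -EFinD natr1.
by move=> hc'; exact: (cvg_unique _ hc hc').
Qed.

Lemma mu_dball l k r : mu (dball (pi ^- l * pi ^+ k) r) = ((q ^ l)%:R * th ^+ k)%:E.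
Proof.
have p0 := pi_neq0 L.
have pl l' : pi ^- l' != 0 by rewrite invr_eq0 expf_neq0.
have q0 : (0 : R) < q%:R by rewrite ltr0n q_gt0.
rewrite mu_dball_center; last by rewrite mulf_neq0 // expf_neq0.
elim: k => [|k ih].
  rewrite expr0 !mulr1; elim: l => [|l ih].
    rewrite expr0 invr1 expn0; have [_ [_ [_ [_ <-]]]] := Hmu; congr (mu _).
    by apply/seteqP; split=> x; rewrite /dball /= subr0 (nrm1 L).
  rewrite mu_dball_split //.
  have -> : pi * pi ^- l.+1 = pi ^- l by rewrite exprS invfM mulrA mulfV // mul1r.
  rewrite ih.
  by rewrite -EFinM expnS natrM.
have := @mu_dball_split (pi ^- l * pi ^+ k).
rewrite ih mulf_neq0 ?expf_neq0 // => /(_ isT).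
have -> : pi * (pi ^- l * pi ^+ k) = pi ^- l * pi ^+ k.+1 by rewrite exprS; ring.
have [_ [hpos _]] := Hmu.
have := hpos _ (@dball_borel (pi ^- l * pi ^+ k.+1) 0 _).
rewrite mulf_neq0 ?expf_neq0 // => /(_ isT).
(* Finiteness of the smaller measure is proved here: it is nonnegative, and [q] times infinity would
   not be real. *)
case: (mu _) => [y| |] //=.
  rewrite -EFinM => _ [e]; congr (_%:E); rewrite exprSr mulrA e mulrC mulKf ?gt_eqF //.
by rewrite gt0_muley ?lte_fin.
Qed.

Variables (n M : nat) (n0 : (0 < n)%N) (M0 : (0 < M)%N).
Implicit Types E : set 'M[F]_(n, M).

(* Covers by measurable rectangles whose measures are recorded as the reals [v j]. *)
Definition coverable E (e : R) := exists (A : nat -> 'I_n -> 'I_M -> set F) (v : nat -> R),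
  [/\ forall j k l, na_borelF nrm (A j k l),
      E `<=` \bigcup_j [set b | forall k l, A j k l (b k l)],
      forall j, (\prod_(k < n) \prod_(l < M) mu (A j k l))%E = (v j)%:E,
      forall j, 0 <= v j &
      forall N, \sum_(j < N) v j <= e].

Lemma prodnullP E : (forall e, 0 < e -> coverable E e) -> na_prodnull nrm mu E.
Proof.
move=> h e /h [A [v [h1 h2 h3 h4 h5]]]; exists A; split=> //; split=> // N.
rewrite (eq_bigr (fun j : 'I_N => (v j)%:E)) => [|j _]; last exact: h3.
rewrite sumEFin lee_fin; exact: h5.
Qed.

Lemma coverableW E E' e e' : E `<=` E' -> e' <= e -> coverable E' e' -> coverable E e.
Proof.
move=> EE ee [A [v [h1 h2 h3 h4 h5]]]; exists A, v; split=> // [b /EE /h2//|N].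
exact: le_trans ee.
Qed.

(** Empty rectangles pad the covers at no cost; for [n = 0] or [M = 0] the product would be empty
    and equal to 1. *)
Lemma prod_mu0 : (\prod_(k < n) \prod_(l < M) mu set0)%E = 0%E.
Proof.
have [mu0 _] := Hmu.
by rewrite (bigD1 (Ordinal n0)) //= (bigD1 (Ordinal M0)) //= mu0 !mul0e.
Qed.

Lemma coverable0 : coverable set0 0.
Proof.
exists (fun _ _ _ => set0), (fun=> 0); split=> //.
- by move=> *; exact: borel0.
- by move=> _; exact: prod_mu0.
- by move=> N; rewrite big1.
Qed.

Lemma coverable_rect (A : 'I_n -> 'I_M -> set F) v : (forall k l, na_borelF nrm (A k l)) ->
  (\prod_(k < n) \prod_(l < M) mu (A k l))%E = v%:E -> 0 <= v ->
  coverable [set b | forall k l, A k l (b k l)] v.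
Proof.
move=> hA hv v0.
exists (fun j k l => if j is 0%N then A k l else set0), (fun j => if j is 0%N then v else 0).
split.
- by case=> [|j] k l //; exact: borel0.
- by move=> b hb; exists 0%N.
- by case=> [|j] //; exact: prod_mu0.
- by case.
- by case=> [|N]; rewrite ?big_ord0 // big_ord_recl /= big1 ?addr0.
Qed.

(** A partial sum of the enumerated double series meets only pairs inside some square of side
    [K]. *)
Lemma sum_pickle_le (w : nat -> nat -> R) (e : nat -> R) c N :
  (forall a b, 0 <= w a b) -> (forall a N, \sum_(b < N) w a b <= e a) ->
  (forall N, \sum_(a < N) e a <= c) ->
  \sum_(j < N) (if pickle_inv j is Some p then w p.1 p.2 else 0 : R) <= c.
Proof.
move=> w0 we ec.
pose g j : R := if @pickle_inv (nat * nat)%type j is Some p then w p.1 p.2 else 0.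
pose K := (\max_(j < N) (if @pickle_inv (nat * nat)%type j is Some p then maxn p.1 p.2 else 0)).+1.
apply: le_trans (ec K); apply: (@le_trans _ _ (\sum_(a < K) \sum_(b < K) w a b)); last first.
  by apply: ler_sum => a _; exact: we.
rewrite pair_bigA /=.
apply: (@le_trans _ _ (\sum_(j < N) \sum_(p : 'I_K * 'I_K)
   (if pickle (nat_of_ord p.1, nat_of_ord p.2) == j then w p.1 p.2 else 0))).
  apply: ler_sum => j _; case ej : (pickle_inv _) => [[a b]|] /=; last first.
    by apply: sumr_ge0 => p _; case: ifP.
  have hab : (maxn a b < K)%N.
    rewrite ltnS; have := @leq_bigmax _ (fun j : 'I_N =>
      if @pickle_inv (nat * nat)%type j is Some p then maxn p.1 p.2 else 0%N) j.
    by rewrite ej.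
  have aK : (a < K)%N by apply: leq_ltn_trans hab; exact: leq_maxl.
  have bK : (b < K)%N by apply: leq_ltn_trans hab; exact: leq_maxr.
  rewrite (bigD1 (Ordinal aK, Ordinal bK)) //= ifT; last first.
    by have := @pickle_invK (nat * nat)%type j; rewrite /ocancel ej /= => ->.
  by rewrite lerDl; apply: sumr_ge0 => p _; case: ifP.
rewrite exchange_big /=; apply: ler_sum => p _.
have [h|h] := ltnP (pickle (nat_of_ord p.1, nat_of_ord p.2)) N.
  rewrite (bigD1 (Ordinal h)) //= eqxx big1 ?addr0 // => j /eqP hj.
  by case: eqP => // e1; case: hj; apply: val_inj.
rewrite big1 // => j _; case: eqP => // e1.
by move: (ltn_ord j); rewrite -e1 ltnNge h.
Qed.

Lemma coverable_bigcup (E : nat -> set 'M[F]_(n, M)) (e : nat -> R) c :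
  (forall i, coverable (E i) (e i)) -> (forall N, \sum_(i < N) e i <= c) ->
  coverable (\bigcup_i E i) c.
Proof.
move=> /choice[A] /choice[v] h ec.
exists (fun j k l => if @pickle_inv (nat * nat)%type j is Some p then A p.1 p.2 k l else set0),
  (fun j => if @pickle_inv (nat * nat)%type j is Some p then v p.1 p.2 else 0).
split.
- move=> j k l; case: pickle_inv => [p|]; last exact: borel0.
  by have [h1 _ _ _ _] := h p.1; exact: h1.
- move=> b [i _ Eb]; have [_ h2 _ _ _] := h i; have [j _ hj] := h2 b Eb.
  by exists (pickle (i, j)) => //=; rewrite pickleK_inv.
- move=> j; case: pickle_inv => [p|]; last exact: prod_mu0.
  by have [_ _ h3 _ _] := h p.1; exact: h3.
- move=> j; case: pickle_inv => [p|//]; by have [_ _ _ h4 _] := h p.1; exact: h4.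
move=> N; apply: (@sum_pickle_le v e) => // [a b|a N'].
  by have [_ _ _ h4 _] := h a; exact: h4.
by have [_ _ _ _ h5] := h a; exact: h5.
Qed.

Lemma coverable_fin (I : finType) (P : {set I}) (E : I -> set 'M[F]_(n, M)) e :
  0 <= e -> (forall i, coverable (E i) e) ->
  coverable (\bigcup_(i in [set i | i \in P]) E i) (#|P|%:R * e).
Proof.
move=> e0 hE.
pose E' j := if insub j is Some j' then E (@enum_val I (mem P) j') else set0.
apply: (@coverableW _ (\bigcup_j E' j) _ (#|P|%:R * e)) => //.
  move=> b [i /= iP Eb]; exists (enum_rank_in iP i) => //.
  by rewrite /E' valK enum_rankK_in.
apply: (@coverable_bigcup E' (fun j => if (j < #|P|)%N then e else 0)).
  by move=> j; rewrite /E'; case: insubP => [j' -> _|/negbTE ->] //; exact: coverable0.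
by move=> N; rewrite -(big_mkord xpredT (fun j => if (j < #|P|)%N then e else 0)) sum_if_lt.
Qed.

Lemma null_bigcup (E : nat -> set 'M[F]_(n, M)) :
  (forall i e, 0 < e -> coverable (E i) e) -> forall e, 0 < e -> coverable (\bigcup_i E i) e.
Proof.
move=> h e e0; apply: (@coverable_bigcup E (fun i => e / 2 * 2^-1 ^+ i)).
  by move=> i; apply: h; apply: mulr_gt0; [exact: divr_gt0|apply: exprn_gt0; rewrite invr_gt0].
move=> N; rewrite -mulr_sumr.
have := @sum_geometric R 2^-1 N; rewrite invr_ge0 ler0n invf_lt1 ?ltr1n // => /(_ isT isT) hg.
apply: le_trans (ler_wpM2l _ hg) _; first by rewrite divr_ge0 // ltW.
have -> : (1 - 2^-1)^-1 = 2 :> R by rewrite (_ : 1 - 2^-1 = 2^-1) ?invrK //; lra.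
by rewrite mulfVK.
Qed.

(** The set is contained in a single rectangle, with every entry of [b] in a ball of radius
    [q^l th^k]. *)
Lemma coverable_residue l k (r : 'M[F]_(n, M)) :
  coverable [set b | small L k (pi ^+ l *: b - r)] (((q ^ l)%:R * th ^+ k) ^+ (n * M)).
Proof.
have p0 := pi_neq0 L.
have pl : pi ^- l * pi ^+ k != 0 by rewrite mulf_neq0 // ?invr_eq0 expf_neq0.
set v := (q ^ l)%:R * th ^+ k.
have v0 : 0 <= v by rewrite mulr_ge0 ?thX_ge0.
apply: coverableW (@coverable_rect
   (fun i j => dball (pi ^- l * pi ^+ k) (pi ^- l * r i j)) (v ^+ (n * M)) _ _ _) => //.
- move=> b hb i j; have := hb i j; rewrite !mxE /dball /=.
  have -> : pi ^+ l * b i j - r i j = pi ^+ l * (b i j - pi ^- l * r i j).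
    by rewrite mulrBr mulrA mulfV ?mul1r // expf_neq0.
  rewrite !(nrmM L) (nrmV L) !nrm_piX.
  by rewrite [th ^- l * _]mulrC ler_pdivlMr ?thX_gt0 // mulrC.
- by move=> i j; exact: dball_borel.
- under eq_bigr do under eq_bigr do rewrite mu_dball.
  have prodE m (x : R) : (\prod_(i < m) x%:E)%E = (x ^+ m)%:E.
    by elim: m => [|m ih]; rewrite ?big_ord0 // big_ord_recr /= ih -EFinM exprSr.
  by under eq_bigr do rewrite prodE; rewrite prodE -exprM mulnC.
exact: exprn_ge0.
Qed.

End Haar.

(** * The dimension for almost every translation *)

(** [y^k] is the smallest of the [k + 1] terms of a geometric sum. *)
Lemma succ_geometric_le (R : realType) (y : R) k : 0 <= y -> y < 1 ->
  k.+1%:R * y ^+ k <= (1 - y)^-1.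
Proof.
move=> y0 y1; apply: le_trans (sum_geometric k.+1 y0 y1).
rewrite mulr_natl -[X in _ *+ X]card_ord -sumr_const; apply: ler_sum => j _.
by apply: ler_wiXn2l => //; [exact: ltW|rewrite -ltnS].
Qed.

Lemma wsum_take (R : realType) M (nu : seq 'I_M -> R) (g : seq 'I_M -> R) k N : (k <= N)%N ->
  (forall w, \sum_(i < M) nu (rcons w i) = nu w) ->
  wsum N (fun w => nu w * g (take k w)) = wsum k (fun u => nu u * g u).
Proof.
move=> kN hnu; rewrite -{1}(subnKC kN) wsum_cat; apply: eq_wsum => u hu.
rewrite -(wsum_flow (N - k) u hnu) -wsumMr; apply: eq_wsum => v _.
by rewrite take_cat hu ltnn subnn take0 cats0.
Qed.

Section AlmostEveryTranslation.
Variables (R : realType) (F : fieldType) (nrm : F -> R) (L : local_field nrm).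
Variables (n M : nat) (T : 'I_M -> 'M[F]_n).

Notation q := (lf_q L).
Notation pi := (lf_pi L).
Notation th := (th L).
Notation small := (small L).
Notation Tw := (Tw T).
Notation xw := (xw T).

Hypotheses (n0 : (0 < n)%N) (M0 : (0 < M)%N).
Hypotheses (gT : forall i, good L (T i)) (sT : forall i, small 1 (T i)).
Variables (s : R) (nu : seq 'I_M -> R).
Hypotheses (s0 : 0 <= s) (sn : s <= n%:R).
Hypotheses (nu1 : nu [::] = 1) (nu0 : forall w, 0 <= nu w) (nu_phi : forall w, nu w <= phiw nrm T s w).
Hypothesis nu_sum : forall w, \sum_(i < M) nu (rcons w i) = nu w.

Notation energy := (energy L T nu).
Notation mass := (mass L T nu).

Lemma mass_take k N c b : small 0 b -> (k <= N)%N ->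
  wsum N (fun w => nu w * (`[< small k (xw b w - c) >])%:R) = mass k c b.
Proof.
move=> hb kN; rewrite /mass -(wsum_take (fun u => (`[< small k (xw b u - c) >])%:R) kN nu_sum).
apply: eq_wsum => w hw; congr (_ * (nat_of_bool _)%:R).
have h : small k (xw b w - xw b (take k w)).
  rewrite -{1}(cat_take_drop k w) xw_cat addrAC subrr add0r; apply: smallMr; last exact: xw_small.
  have := Tw_small sT (take k w); rewrite size_takel ?hw //.
apply: asbool_equiv_eq; split=> hs; first exact: small_tri (smallBC h) hs.
exact: small_tri h hs.
Qed.

Lemma wsum_nu N : wsum N nu = 1.
Proof. by have := wsum_flow N [::] nu_sum; rewrite nu1 => <-. Qed.

Lemma th_powRX x k : th `^ (k%:R * x) = (th `^ x) ^+ k.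
Proof. by rewrite mulrC powRrM powR_mulrn ?powR_ge0. Qed.

Lemma th_powR_lt1 x : 0 < x -> th `^ x < 1.
Proof.
move=> x0; rewrite -(powRr0 th) /powR (gt_eqF (th_gt0 L)) mul0r ltr_expR.
by rewrite pmulr_rlt0 // lnth_lt0.
Qed.

(* A word lies in a ball of mass at most [th^(k t')], or in a heavy ball; the energy bound makes
   the total mass of the heavy balls at scales [k >= k1] at most 1/2. *)
Lemma energy_cover_bound t t' k1 b (J : nat) (c : nat -> 'cV[F]_n) (kk : nat -> nat) N :
  0 < t' -> t' < t -> small 0 b ->
  (forall k, (k1 <= k)%N -> energy k b <= th `^ (k%:R * t)) ->
  (th `^ (t - t')) ^+ k1 * (1 - th `^ (t - t'))^-1 <= 2^-1 ->
  (forall j, (j < J)%N -> (k1 <= kk j <= N)%N) ->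
  (forall w, size w = N -> exists2 j, (j < J)%N & small (kk j) (xw b w - c j)) ->
  2^-1 <= \sum_(j < J) th `^ ((kk j)%:R * t').
Proof.
move=> t'0 tt' hb hE hk1 hkk hcov.
set z := th `^ (t - t') in hk1.
have z1 : z < 1 by rewrite th_powR_lt1 // subr_gt0.
have z0 : 0 <= z by exact: powR_ge0.
pose light (j : 'I_J) : bool := mass (kk j) (c j) b <= th `^ ((kk j)%:R * t').
pose G1 w : R := \sum_(j < J) (light j)%:R * (`[< small (kk j) (xw b w - c j) >])%:R.
(* A word in a heavy ball at scale [k] makes the corresponding term of [G2] at least 1, so [G2]
   counts heavy words from above while its mean is a sum of energies. *)
pose G2 w : R := \sum_(k1 <= k < N.+1) th `^ (- (k%:R * t')) * mass k (xw b (take k w)) b.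
have mass0 k a b' : 0 <= mass k a b' by exact: mass_ge0.
have one_le w : size w = N -> 1 <= G1 w + G2 w.
  move=> hw; have [j jJ hj] := hcov w hw.
  have G1_0 : 0 <= G1 w by apply: sumr_ge0 => i _; rewrite mulr_ge0.
  have G2_0 : 0 <= G2 w by apply: sumr_ge0 => i _; rewrite mulr_ge0 ?powR_ge0.
  have /andP[kj1 kj2] := hkk j jJ.
  have [lj|] := boolP (light (Ordinal jJ)).
    apply: (@le_trans _ _ (G1 w)); last by rewrite lerDl.
    rewrite /G1 (bigD1 (Ordinal jJ)) //= lj asboolT // mulr1 lerDl.
    by apply: sumr_ge0 => i _; rewrite mulr_ge0.
  rewrite /light /= -ltNge => /ltW heavy.
  apply: (@le_trans _ _ (G2 w)); last by rewrite lerDr.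
  have jin : kk j \in index_iota k1 N.+1 by rewrite mem_index_iota kj1 ltnS.
  rewrite /G2 (bigD1_seq (kk j)) ?iota_uniq //= ler_wpDr //.
    by apply: sumr_ge0 => i _; rewrite mulr_ge0 ?powR_ge0.
  (* Every point of an ultrametric ball is a centre of it. *)
  have -> : mass (kk j) (xw b (take (kk j) w)) b = mass (kk j) (c j) b.
    have hx : small (kk j) (xw b (take (kk j) w) - c j).
      apply: small_tri hj; apply: smallBC.
      rewrite -{1}(cat_take_drop (kk j) w) xw_cat addrAC subrr add0r.
      apply: smallMr; last exact: xw_small.
      by have := Tw_small sT (take (kk j) w); rewrite size_takel ?hw.
    apply: eq_wsum => v _; congr (_ * (nat_of_bool _)%:R).
    apply: asbool_equiv_eq; split=> hs; first exact: small_tri hs hx.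
    by apply: small_tri hs _; exact: smallBC.
  by rewrite powRN mulrC ler_pdivlMr ?powR_gt0 ?th_gt0 // mul1r.
have h1 : wsum N (fun w => nu w * G1 w) <= \sum_(j < J) th `^ ((kk j)%:R * t').
  rewrite /G1 (eq_wsum (g := fun w => \sum_(j < J) nu w *
    ((light j)%:R * (`[< small (kk j) (xw b w - c j) >])%:R))) => [|w _]; last by rewrite mulr_sumr.
  rewrite wsum_sum; apply: ler_sum => j _.
  rewrite (eq_wsum (g := fun w => nu w * (`[< small (kk j) (xw b w - c j) >])%:R * (light j)%:R)); last first.
    by move=> w _; rewrite mulrCA mulrC.
  have /andP[_ kN] := hkk j (ltn_ord j).
  rewrite wsumMr mass_take //; case lj : (light j); first by rewrite mulr1.
  by rewrite mulr0 powR_ge0.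
have h2 : wsum N (fun w => nu w * G2 w) <= 2^-1.
  rewrite /G2 (eq_wsum (g := fun w => \sum_(k1 <= k < N.+1) nu w *
    (th `^ (- (k%:R * t')) * mass k (xw b (take k w)) b))) => [|w _]; last by rewrite mulr_sumr.
  rewrite wsum_sum; apply: (@le_trans _ _ (\sum_(k1 <= k < N.+1) z ^+ k)).
    rewrite [leLHS]big_nat_cond [leRHS]big_nat_cond; apply: ler_sum => k /andP[/andP[kk1 kN] _].
    rewrite ltnS in kN.
    rewrite (eq_wsum (g := fun w => nu w * mass k (xw b (take k w)) b * th `^ (- (k%:R * t')))); last first.
      by move=> w _; rewrite mulrCA mulrC.
    rewrite wsumMr (wsum_take (fun u => mass k (xw b u) b) kN nu_sum) -/(energy k b).
    apply: le_trans (ler_wpM2r _ (hE k kk1)) _; first exact: powR_ge0.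
    by rewrite -th_powRD -mulrBr th_powRX.
  apply: le_trans hk1; have [Nk|kN] := ltnP N k1.
    by rewrite big_geq // mulr_ge0 ?exprn_ge0 ?invr_ge0 ?subr_ge0 // ltW.
  rewrite -{1}[k1]add0n big_addn big_mkord.
  under eq_bigr do rewrite addnC exprD.
  by rewrite -mulr_sumr ler_wpM2l ?exprn_ge0 // sum_geometric.
have : 1 <= wsum N (fun w => nu w * G1 w) + wsum N (fun w => nu w * G2 w).
  rewrite -wsumD -(wsum_nu N); apply: ler_wsum => w hw.
  by rewrite -mulrDr -[leLHS]mulr1 ler_wpM2l // one_le.
move=> h; have := le_trans h (lerD h1 h2); lra.
Qed.

Lemma dimH_attractor_ge t t' l k0 b K : 0 < t' -> t' < t -> na_attractor nrm T b K ->
  small 0 (pi ^+ l *: b) ->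
  (forall k, (k0 <= k)%N -> energy k (pi ^+ l *: b) <= th `^ (k%:R * t)) ->
  (t'%:E <= na_dimH nrm K)%E.
Proof.
move=> t'0 tt' Ka hb hE.
set z := th `^ (t - t').
have z1 : z < 1 by rewrite th_powR_lt1 // subr_gt0.
have [k2 hk2] : exists k, z ^+ k * (1 - z)^-1 <= 2^-1.
  have tt0 : 0 < t - t' by rewrite subr_gt0.
  have e0 : 0 < 2^-1 * (1 - z) by rewrite mulr_gt0 ?invr_gt0 // subr_gt0.
  have [k _ hk] := th_powR_small L 0 tt0 e0.
  by exists k; rewrite ler_pdivrMr ?subr_gt0 // -th_powRX.
pose k1 := maxn k0 k2.
apply: (@dimH_ge _ _ _ L _ K t' k1 2^-1); [exact: Ka.2.1|by rewrite invr_gt0|].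
move=> J c kk hkk hcov.
have [x0 Kx0] := Ka.1; have [l0 hl0] := small_int L x0.
(* The cover is tested on the points [S_w(x0)] with [w] of length [N]. The summand [l0] clears the
   denominators of [x0], so that [T_w x0] is negligible at every scale [kk j]. *)
pose N := (\max_(j < J) kk j + l + l0)%N.
have kkN j : (j < J)%N -> (kk j <= \max_(j < J) kk j)%N.
  by move=> jJ; exact: (leq_bigmax (Ordinal jJ)).
apply: (@le_trans _ _ (\sum_(j < J) th `^ ((kk j + l)%:R * t'))); last first.
  apply: ler_sum => j _; apply: th_powR_le; rewrite ler_wpM2r ?ler_nat ?leq_addr //; exact: ltW.
apply: (@energy_cover_bound t t' k1 (pi ^+ l *: b) J (fun j => pi ^+ l *: c j)
   (fun j => kk j + l)%N N) => //.
- by move=> k hk; apply: hE; apply: leq_trans hk; exact: leq_maxl.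
- apply: le_trans hk2; rewrite -/z ler_wpM2r ?invr_ge0 ?subr_ge0 ?(ltW z1) //.
  by apply: ler_wiXn2l; rewrite ?powR_ge0 ?(ltW z1) // leq_maxr.
- move=> j jJ; rewrite (leq_trans (hkk j)) ?leq_addr //= /N -addnA.
  by rewrite leq_add ?kkN // leq_addr.
move=> w hw; have Kw : K (Tw w *m x0 + xw b w).
  by apply: (cylinder_sub Ka (w := w)); exists x0.
have [j /= jJ hj] := hcov _ Kw; exists j => //.
rewrite xwZ -scalerBr addnC; apply/small_piZ.
have -> : xw b w - c j = (Tw w *m x0 + xw b w - c j) - Tw w *m x0 by rewrite addrAC [_ + xw b w]addrC addrK.
apply: smallB => //.
have : small N (Tw w *m (pi ^+ l0 *: x0)) by apply: smallMr => //; rewrite -hw; exact: Tw_small.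
rewrite -scalemxAr /N addnC => /small_piZ; apply: smallW.
by rewrite (leq_trans (kkN j jJ)) // leq_addr.
Qed.

Variables (mu : set F -> \bar R) (Hmu : na_is_haar nrm mu).

Definition bad_translations t l k : set 'M[F]_(n, M) :=
  [set b | small 0 (pi ^+ l *: b) /\ th `^ (k%:R * t) < energy k (pi ^+ l *: b)].

(** The number of bad residues times the measure of one class; the number of all residues cancels
    against [th^(k n M)], and [q^(l n M)] undoes the homothety. *)
Lemma coverable_bad t l k : coverable nrm mu (bad_translations t l k)
  ((q ^ l)%:R ^+ (n * M) * (k.+1%:R * th `^ (k%:R * (s - t)))).
Proof.
pose v : R := ((q ^ l)%:R * th ^+ k) ^+ (n * M).
have v0 : 0 <= v by rewrite exprn_ge0 // mulr_ge0 ?thX_ge0.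
apply: coverableW (coverable_fin Hmu n0 M0 (bad_residues L T nu t k)
  (E := fun be => [set b | small k (pi ^+ l *: b - residue_mx be)]) v0 _).
- move=> b [hb hbad]; have [be hbe] := residue_exists k hb.
  exists be => //=; rewrite inE.
  by rewrite -(energy_residue gT nu hbe).
- apply: le_trans (ler_wpM2r v0 (card_bad_residues n0 gT sT s0 sn nu1 nu0 nu_phi nu_sum t k)) _.
  rewrite le_eqVlt; apply/orP; left; apply/eqP.
  have cB : #|{: residues L n M k}|%:R * (th ^+ k) ^+ (n * M) = 1 :> R.
    rewrite card_ffun card_prod !card_ord natrX -exprMn qXth expr1n //.
  rewrite /v exprMn.
  transitivity ((q ^ l)%:R ^+ (n * M) * (k.+1%:R * th `^ (k%:R * (s - t))) *
    (#|{: residues L n M k}|%:R * (th ^+ k) ^+ (n * M))); first ring.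
  by rewrite cB mulr1.
by move=> be; exact: coverable_residue.
Qed.

Lemma limsup_bad_null t l e : t < s -> 0 < e ->
  coverable nrm mu [set b | forall k0, exists2 k, (k0 <= k)%N & bad_translations t l k b] e.
Proof.
(* Half of the exponent [s - t] absorbs the factor [k + 1]; the other half keeps the series
   summable, as Borel-Cantelli requires. *)
move=> ts e0; pose y := th `^ ((s - t) / 2).
have st0 : 0 < (s - t) / 2 by rewrite divr_gt0 // subr_gt0.
have y1 : y < 1 by exact: th_powR_lt1.
have y0 : 0 <= y by exact: powR_ge0.
have iy0 : 0 <= (1 - y)^-1 by rewrite invr_ge0 subr_ge0 ltW.
pose C : R := (q ^ l)%:R ^+ (n * M) * (1 - y)^-1.
have C0 : 0 <= C by rewrite mulr_ge0 // exprn_ge0.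
have e1 : 0 < e * (1 - y) / (C + 1) by rewrite divr_gt0 ?ltr_wpDl // mulr_gt0 // subr_gt0.
have [k0 _ hk0] := th_powR_small L 0 st0 e1; rewrite th_powRX -/y in hk0.
have bad_le k : coverable nrm mu (bad_translations t l k) (C * y ^+ k).
  apply: coverableW (coverable_bad t l k) => //.
  rewrite /C -mulrA ler_wpM2l ?exprn_ge0 // th_powRX.
  have -> : th `^ (s - t) = y * y by rewrite -th_powRD; congr (_ `^ _); lra.
  by rewrite exprMn mulrA ler_wpM2r ?exprn_ge0 // succ_geometric_le.
apply: (@coverableW _ _ _ _ _ _ _ (\bigcup_i bad_translations t l (k0 + i)) _ e) => //.
  by move=> b /(_ k0) [k kk hk]; exists (k - k0)%N; rewrite // subnKC.
apply: (coverable_bigcup Hmu n0 M0 (e := fun i => C * y ^+ (k0 + i))) => [i|N]; first exact: bad_le.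
under eq_bigr do rewrite exprD mulrA.
rewrite -mulr_sumr; apply: (@le_trans _ _ (C * y ^+ k0 * (1 - y)^-1)).
  by rewrite ler_wpM2l ?mulr_ge0 ?exprn_ge0 // sum_geometric.
rewrite ler_pdivrMr ?subr_gt0 //.
apply: (@le_trans _ _ ((C + 1) * y ^+ k0)).
  by rewrite ler_wpM2r ?exprn_ge0 // lerDl.
by rewrite mulrC -ler_pdivlMr // ltr_wpDl.
Qed.

End AlmostEveryTranslation.

(** * Dimension bounds in terms of [min(n, d)] *)

Section Conclusion.
Variables (R : realType) (F : fieldType) (nrm : F -> R) (L : local_field nrm).
Variables (n M : nat) (T : 'I_M -> 'M[F]_n) (d : R).
Hypotheses (M2 : (2 <= M)%N) (Hd : na_is_dimd nrm T d).
Hypotheses (gT : forall i, good L (T i)) (sT : forall i, small L 1 (T i)).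

Let M0 : (0 < M)%N := ltnW M2.
Let n0 : (0 < n)%N := (dimd_gt0 M2 Hd).1.
Let d0 : 0 < d := (dimd_gt0 M2 Hd).2.

Lemma ubox_attractor_le b K : na_attractor nrm T b K ->
  (na_ubox nrm K <= (Num.min n%:R d)%:E)%E.
Proof.
move=> Ka; have K0 := Ka.1.
have hn : (na_ubox nrm K <= n%:R%:E)%E.
  have [C C0 hC] := attractor_cover_le_n n0 gT Ka.
  exact: (ubox_le K0 _ C0 hC).
have [nd|dn] := leP n%:R d; first exact: hn.
apply/lee_addgt0Pr => e e0.
have [sn|/ltW sn] := leP (d + e) n%:R; last by apply: (le_trans hn); rewrite lee_fin.
have ds : d < d + e by rewrite ltrDl.
have [C C0 hC] := attractor_cover_le_dimd n0 gT sT Ka M0 Hd ds sn.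
by apply: (ubox_le K0 _ C0 hC); rewrite addr_ge0 // ltW.
Qed.

Lemma dimH_attractor_le b K : na_attractor nrm T b K -> (na_dimH nrm K <= na_lbox nrm K)%E.
Proof.
move=> Ka; apply: (dimH_le_lbox (L := L)); first exact: Ka.1.
have [C C0 hC] := attractor_cover_le_n n0 gT Ka.
by move=> k; exists (C * th L `^ (- (k%:R * n%:R))).
Qed.

Lemma dimH_attractor_lt_null mu t e : na_is_haar nrm mu -> 0 < t -> t < Num.min n%:R d -> 0 < e ->
  coverable nrm mu [set b | exists2 K, na_attractor nrm T b K & ~ (t%:E <= na_dimH nrm K)%E] e.
Proof.
move=> Hmu t0 tx e0.
pose x := Num.min n%:R d.
rewrite -/x in tx.
(* In [t < t1 < s < min(n, d)] the flow lives at [s], the energies are bounded at [t1] and the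
   dimension at [t]; each strict gap pays for one geometric series. *)
pose s := (x + t) / 2; pose t1 := (s + t) / 2.
have hs : t < s /\ s < x by rewrite /s; split; lra.
have ht1 : t < t1 /\ t1 < s by rewrite /t1; case: hs => h1 h2; split; lra.
have s0 : 0 <= s by apply/ltW/(lt_trans t0); case: hs.
have xn : x <= n%:R by rewrite ge_min lexx.
have xd : x <= d by rewrite ge_min lexx orbT.
have sn : s <= n%:R by apply/ltW/(lt_le_trans hs.2 xn).
have sd : s < d := lt_le_trans hs.2 xd.
have [nu [nu1 nu0 nu_phi nu_sum]] := @unit_flow_exists R M (phiw nrm T s) M0
  (fun w => phiw_gt0 n0 gT w s0) (phiw_nil n0 gT s0 sn)
  (fun u v => phiw_cat n0 gT u v s0 sn)
  (fun C => @Zs_unbounded _ _ _ L _ _ T n0 gT sT d s C M0 Hd s0 sd).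
have hnull l e' (e'0 : 0 < e') :=
  limsup_bad_null n0 M0 gT sT s0 sn nu1 nu0 nu_phi nu_sum Hmu l ht1.2 e'0.
apply: coverableW (null_bigcup Hmu n0 M0 hnull e0) => // b [K Ka hK].
(* Every translation becomes integral after some [pi^l], so the union over [l] loses none. *)
have [l hl] := small_int L b; exists l => // k0.
apply: contrapT => h; apply: hK.
apply: (@dimH_attractor_ge _ _ _ L _ _ T gT sT nu nu1 nu0 nu_sum t1 t l k0 b K) => //.
  by case: ht1.
move=> k hk; rewrite leNgt; apply/negP => hb; apply: h; exists k => //.
Qed.

End Conclusion.

Theorem theorem1p1 (R : realType) (F : fieldType) (nrm : F -> R)
  (Habs : na_nonarch_abs nrm) (Hlc : na_locally_compact nrm) (Hnorm : na_normalized nrm)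
  (mu : set F -> \bar R) (Hmu : na_is_haar nrm mu)
  (n M : nat) (HM : (2 <= M)%N) (T : 'I_M -> 'M[F]_n)
  (HT : forall i, \det (T i) != 0 /\ na_opnorm nrm (T i) < 1)
  (d : R) (Hd : na_is_dimd nrm T d) :
  (forall (b : 'M[F]_(n, M)) (K : set 'cV[F]_n), na_attractor nrm T b K ->
     (na_dimH nrm K <= na_ubox nrm K)%E /\ (na_ubox nrm K <= d%:E)%E) /\
  na_prodnull nrm mu
    [set b : 'M[F]_(n, M) | ~ (forall K : set 'cV[F]_n, na_attractor nrm T b K ->
        na_dimH nrm K = (Num.min (n%:R) d)%:E /\
        na_lbox nrm K = (Num.min (n%:R) d)%:E /\
        na_ubox nrm K = (Num.min (n%:R) d)%:E)].
Proof.
have [pi [piP [q [r [r1 [rP npi]]]]]] := Hnorm.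
pose L := LocalField Habs piP r1 rP npi.
have sT i : small L 1 (T i) by apply: opnorm_lt1_small; case: (HT i).
have gT i : good L (T i).
  by split; [exact: smallW (leq0n 1) (sT i)|case: (HT i)].
have [n0 d0] := dimd_gt0 HM Hd.
have M0 : (0 < M)%N := ltnW HM.
split.
  move=> b K Ka; split.
    exact: le_trans (dimH_attractor_le HM Hd gT Ka) (lbox_le_ubox nrm K).
  apply: le_trans (ubox_attractor_le HM Hd gT sT Ka) _.
  by rewrite lee_fin ge_min lexx orbT.
apply: prodnullP => e e0.
set x := Num.min _ _; have x0 : 0 < x by rewrite lt_min ltr0n n0.
(* Exponents increasing to [x], so that countably many null sets suffice; the factor [2^-1] keeps
   [t 0] positive. *)
pose t i : R := x * (1 - 2^-1 * 2^-1 ^+ i).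
have p0 i : (0 : R) < 2^-1 ^+ i by apply: exprn_gt0; rewrite invr_gt0.
have p1 i : (2^-1 : R) ^+ i <= 1 by rewrite exprn_ile1 // invf_le1 // ler1n.
have t0 i : 0 < t i by rewrite mulr_gt0 //; have := p1 i; lra.
have tx i : t i < x by rewrite gtr_pMr //; have := p0 i; lra.
have hnull i e' (e'0 : 0 < e') := dimH_attractor_lt_null HM Hd gT sT Hmu (t0 i) (tx i) e'0.
apply: coverableW (null_bigcup Hmu n0 M0 hnull e0) => // b /= hb.
apply: contrapT => h; apply: hb => K Ka.
have hH : (x%:E <= na_dimH nrm K)%E.
  apply/lee_addgt0Pr => eta eta0.
  have eta1 : 0 < eta / x by rewrite divr_gt0.
  have [i hi] : exists i, (2^-1 : R) ^+ i <= eta / x.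
    have : (fun k => (2^-1 : R) ^+ k) @ \oo --> (0 : R).
      by apply: cvg_expr; rewrite ger0_norm ?invr_ge0 // invf_lt1 ?ltr1n.
    move/cvgr0Pnorm_lt => /(_ _ eta1) [N _ hN].
    exists N; have := hN N (leqnn N); rewrite /= ger0_norm; first exact: ltW.
    exact: ltW.
  have hti : ((t i)%:E <= na_dimH nrm K)%E.
    by apply: contrapT => hK; apply: h; exists i => //; exists K.
  apply: (@le_trans _ _ ((t i)%:E + eta%:E)%E); last exact: leeD.
  rewrite -EFinD lee_fin /t.
  move: hi; rewrite ler_pdivlMr // => hi; have := p0 i; nra.
have h1 := dimH_attractor_le HM Hd gT Ka.
have h2 := lbox_le_ubox nrm K.
have h3 := ubox_attractor_le HM Hd gT sT Ka.
have lE : na_lbox nrm K = x%:E.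
  by apply/eqP; rewrite eq_le (le_trans h2 h3) (le_trans hH h1).
split; first by apply/eqP; rewrite eq_le hH andbT -lE.
by split=> //; apply/eqP; rewrite eq_le h3 -lE.
Qed.
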